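(* Let $Y_n$ be a random walk on a group $\Gamma$ which acts on a set $S$. Fix $o\in S$, and let $p_n$ be the probability that the random walk $o.Y_k$ on $S$ does not return to $o$ in the first $n$ steps, i.e. $p_n=\mathbf{P}(o.Y_k\neq o\text{ for all }1\le k\le n)$. Assume that there is a constant $c$ so that for all $n\ge1$ $$\mathbf{E}|Y_n|+H\big[\{o,\,o.Y_1^{-1},\dots,o.Y_n^{-1}\}\big]+(p_0+\dots+p_n)\le c\,n\,p_n,$$ where the $H$ term is the Shannon entropy of the random set $\{o,o.Y_1^{-1},\dots,o.Y_n^{-1}\}$. Let $\Lambda$ be an infinite group and let $\lambda(n)$ be the expected displacement at time $n$ of a generating random walk in $\Lambda$. Then the switch-walk-switch random walk $X_n$ on the permutation wreath product $\Lambda\wr_S\Gamma$ satisfies $$\mathbf{E}|X_n|\asymp n\,p_n\,\lambda(1/p_n)\qquad(n\ge1),$$ i.e. the ratio of the two sides is bounded above and below by positive constants independent of $n$.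
   Context: All random walks are symmetric with finitely supported step distribution: $Y_n=G_1\cdots G_n$ with $G_i$ i.i.d. from a symmetric finitely supported measure on $\Gamma$. The groups are finitely generated and $\Gamma$ acts on $S$ on the right. ''Generating random walk in $\Lambda$'' means $L_1\cdots L_n$ with $L_i$ i.i.d. from a symmetric finitely supported measure whose support generates $\Lambda$, and $\lambda(n)=\mathbf{E}|L_1\cdots L_n|$; at non-integer arguments $t\ge1$ read $\lambda(t)$ as $\lambda(\lfloor t\rfloor)$. The permutation wreath product $\Lambda\wr_S\Gamma$ is the semidirect product of $\Lambda^S$ with $\Gamma$, with multiplication $(\ell,g)(\ell',g')=(\ell\,\ell'^{g^{-1}},gg')$, where $\ell'^{g^{-1}}(s)=\ell'(s.g)$. For $L\in\Lambda$ let $\bar L=(\ell,id_\Gamma)$ with $\ell(o)=L$ and $\ell(s)=id_\Lambda$ for $s\neq o$. The switch-walk-switch random walk is $X_n=\prod_{i=1}^n\bar L_iG_i\bar L'_i$, where $G_i$ are the steps of $Y_n$, and $L_i,L_i'$ are independent choices from the step distribution of the walk on $\Lambda$, all independent. A symmetric finitely supported measure on a group defines a Cayley graph (generators: its support), and $|g|$ denotes the corresponding graph distance of $g$ from the identity; for each of the walks $Y_n$, $L_1\cdots L_n$, $X_n$ it is taken with respect to the step distribution of that walk. The entropy of a discrete random variable $X$ is $H(X)=-\sum_x\mathbf{P}(X=x)\log\mathbf{P}(X=x)$. *)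

(* Defs.v *)
From HB Require Import structures.
From mathcomp Require Import all_boot all_order all_algebra finmap.
From mathcomp Require Import all_classical all_reals all_analysis.

Set Implicit Arguments.
Unset Strict Implicit.
Unset Printing Implicit Defensive.

Import Order.TTheory GRing.Theory Num.Theory.

Local Open Scope classical_set_scope.
Local Open Scope ring_scope.

(* The first [n] i.i.d. steps of a finitely supported walk are realised on the
   finite product space [n.-tuple Omega], where [Omega] is the one-step space;
   [P] is the weight function of a probability on [Omega]. *)

Section FiniteProbability.
Variables (R : realType) (Omega : finType) (P : Omega -> R).

Definition prob (A : pred Omega) : R := \sum_(w | A w) P w.

Definition expect (f : Omega -> R) : R := \sum_w P w * f w.

Definition entropy (B : eqType) (X : Omega -> B) : R :=
  - \sum_(x <- undup [seq X w | w : Omega])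
      prob [pred w | X w == x] * ln (prob [pred w | X w == x]).

Definition iid (n : nat) (w : n.-tuple Omega) : R :=
  \prod_(i < n) P (tnth w i).

End FiniteProbability.

Section Words.
Variable G : groupType.

Definition gprod (s : seq G) : G := (\prod_(g <- s) g)%g.

Definition generates (A : set G) : Prop :=
  forall g : G, exists2 s : seq G,
    gprod s = g & forall x, x \in s -> A x \/ A (x^-1)%g.

Definition fin_generated : Prop :=
  exists A : set G, finite_set A /\ generates A.

Definition word_of_length (A : set G) (g : G) (n : nat) : Prop :=
  exists s : seq G, [/\ size s = n, forall x, x \in s -> A x & gprod s = g].

(* Distance from [1] to [g] in the Cayley graph of [A], which is meant to be
   closed under inverses.  The junk value [0] outside the subgroup generated by
   [A] is never met by a walk with steps in [A]. *)
Definition wlen (A : set G) (g : G) : nat :=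
  if pselect (exists n, `[< word_of_length A g n >]) is left h
  then ex_minn h else 0.

End Words.

Section RandomWalk.
Variables (R : realType) (G : groupType).

(* A symmetric finitely supported probability measure on [G]. *)
Record step_dist := StepDist {
  step_mass :> {fsfun G -> R with 0%R};
  step_mass_ge0 : forall g, 0 <= step_mass g;
  step_mass_sum1 : \sum_(g <- finsupp step_mass) step_mass g = 1;
  step_mass_sym : forall g, step_mass (g^-1)%g = step_mass g }.

Section Steps.
Variables (Omega : finType) (P : Omega -> R) (step : Omega -> G).

(* Support of the law of one step: the generators of the Cayley graph. *)
Definition step_support : set G :=
  [set g | 0 < prob P [pred w | step w == g]].

(* [G_1 * ... * G_k], a product in this order. *)
Definition position (n : nat) (w : n.-tuple Omega) (k : nat) : G :=
  gprod [seq step x | x <- take k w].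

Definition mean_displacement (n : nat) : R :=
  expect (iid P (n := n))
    (fun w => (wlen step_support (position w n))%:R).

End Steps.

Variable mu : step_dist.

Definition step_weight (g : finsupp mu) : R := mu (val g).

Definition step_val (g : finsupp mu) : G := val g.

Definition speed (n : nat) : R := mean_displacement step_weight step_val n.

End RandomWalk.

Record right_action (Gam : groupType) (S : Type) := RightAction {
  ract :> S -> Gam -> S;
  ract1 : forall s, ract s 1%g = s;
  ractM : forall s g h, ract s (g * h)%g = ract (ract s g) h }.

Section OrbitWalk.
Variables (R : realType) (Gam : groupType) (S : choiceType).
Variables (act : right_action Gam S) (mu : step_dist R Gam) (o : S).

Definition walk_pos (n : nat) (w : n.-tuple (finsupp mu)) (k : nat) : Gam :=
  position (@step_val R Gam mu) w k.

(* Every [k <= n] is read off the same [n]-step trajectory. *)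
Definition no_return_prob (n : nat) : R :=
  prob (iid (@step_weight R Gam mu) (n := n))
    [pred w | [forall k : 'I_n, act o (walk_pos w k.+1) != o]].

(* The random set [{o, o.Y_1^-1, ..., o.Y_n^-1}]; the term [k = 0] is [o]. *)
Definition inverted_range (n : nat) (w : n.-tuple (finsupp mu)) : {fset S} :=
  [fset x in [seq act o (walk_pos w k)^-1%g | k <- iota 0 n.+1]]%fset.

Definition range_entropy (n : nat) : R :=
  entropy (iid (@step_weight R Gam mu) (n := n)) (@inverted_range n).

End OrbitWalk.

(* Lamp configurations are arbitrary functions [S -> Lam]; [act] is a parameter
   of the type so that the group structure below can be inferred from it. *)
Record wreath (Lam Gam : groupType) (S : choiceType)
    (act : right_action Gam S) := Wreath { lamps : S -> Lam; cursor : Gam }.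
Arguments Wreath {Lam Gam S act} lamps cursor.

Section WreathGroup.
Variables (Lam Gam : groupType) (S : choiceType) (act : right_action Gam S).
Local Notation W := (wreath Lam act).

HB.instance Definition _ := gen_eqMixin W.
HB.instance Definition _ := gen_choiceMixin W.

Definition wreath_one : W := Wreath (fun=> 1%g) 1%g.

(* [(l, g)(l', g') = (l l'^(g^-1), g g')] with [l'^(g^-1) s = l' (s.g)]. *)
Definition wreath_mul (x y : W) : W :=
  Wreath (fun s => (lamps x s * lamps y (act s (cursor x)))%g)
         (cursor x * cursor y)%g.

Definition wreath_inv (x : W) : W :=
  Wreath (fun s => ((lamps x (act s (cursor x)^-1))^-1)%g) ((cursor x)^-1)%g.

Lemma wreath_mulA : associative wreath_mul.
Proof.
move=> [f g] [f' g'] [f'' g'']; rewrite /wreath_mul /= mulgA; congr Wreath.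
by apply/funext => s; rewrite mulgA ractM.
Qed.

Lemma wreath_mul1 : left_id wreath_one wreath_mul.
Proof.
move=> [f g]; rewrite /wreath_mul /= mul1g; congr Wreath.
by apply/funext => s; rewrite mul1g ract1.
Qed.

Lemma wreath_mulr1 : right_id wreath_one wreath_mul.
Proof.
move=> [f g]; rewrite /wreath_mul /= mulg1; congr Wreath.
by apply/funext => s; rewrite mulg1.
Qed.

Lemma wreath_mulV : left_inverse wreath_one wreath_inv wreath_mul.
Proof.
move=> [f g]; rewrite /wreath_mul /= mulVg; congr Wreath.
by apply/funext => s; rewrite mulVg.
Qed.

Lemma wreath_mulrV : right_inverse wreath_one wreath_inv wreath_mul.
Proof.
move=> [f g]; rewrite /wreath_mul /= mulgV; congr Wreath.
by apply/funext => s; rewrite -ractM mulgV ract1 mulgV.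
Qed.

HB.instance Definition _ := isGroup.Build W
  wreath_mulA wreath_mul1 wreath_mulr1 wreath_mulV wreath_mulrV.

End WreathGroup.

Section SwitchWalkSwitch.
Variables (R : realType) (Lam Gam : groupType) (S : choiceType).
Variables (act : right_action Gam S) (o : S).
Variables (nu : step_dist R Lam) (mu : step_dist R Gam).

Definition lamp_at (l : Lam) : wreath Lam act :=
  Wreath (fun s => if s == o then l else 1%g) 1%g.

Definition walk_by (g : Gam) : wreath Lam act := Wreath (fun=> 1%g) g.

(* One step is [lamp_at L * walk_by G * lamp_at L'] with [L], [G], [L']
   independent of laws [nu], [mu], [nu]. *)
Definition sws_space : finType := (finsupp nu * finsupp mu * finsupp nu)%type.

Definition sws_weight (w : sws_space) : R :=
  step_weight w.1.1 * step_weight w.1.2 * step_weight w.2.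

Definition sws_step (w : sws_space) : wreath Lam act :=
  (lamp_at (step_val w.1.1) * walk_by (step_val w.1.2)
     * lamp_at (step_val w.2))%g.

Definition sws_speed (n : nat) : R :=
  mean_displacement sws_weight sws_step n.

End SwitchWalkSwitch.

(* Main.v *)
From HB Require Import structures.
Require Import Defs.
From mathcomp Require Import all_boot all_order all_algebra finmap.
From mathcomp Require Import all_classical all_reals all_analysis.
From mathcomp Require Import ring lra zify.

Set Implicit Arguments.
Unset Strict Implicit.
Unset Printing Implicit Defensive.

Import Order.TTheory GRing.Theory Num.Theory.

Local Open Scope ring_scope.

(** The lamps of the walk [X_n] sit at the sites [o.Y_k^-1], and given the path
    of the cursor they are independent walks on the lamp group, each run for a
    number of steps comparable to the number of visits to its site.  The length
    of [X_n] is comparable to the sum of the displacements of all lamps, plus the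
    length of a tour of the cursor through all sites.  Write [p] for [p_n] and
    [lam] for the displacement of the lamp walk.

    Sum over the lamps.  Counting each site at its last visit shows that the
    expected number of sites is [p_0 + ... + p_n], and decomposing at the last
    visit bounds the expected number of visits to a point by [1 / p]
    ([escape_visits]).  The total number of visits is [n + 1], so the local
    times are of order [1 / p] on about [n p] sites.  The function [lam] is
    subadditive, and it is increasing up to a constant because a symmetric walk
    cannot be shifted towards the identity by more than half of its displacement
    ([displacement_shift]).  Hence the sum over the lamps is of order
    [n p lam (1 / p)] ([lamp_sum_lower], [lamp_sum_upper]).  As a generator
    changes only two lamp factors, this gives the lower bound.

    The tour.  Replace the lamp group by the group of order two and use fair
    random bits.  The entropy of this lamplighter is at most the entropy of the
    range, plus one bit for each site, plus a multiple of the length of [Y_n],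
    hence of order [n p] by assumption.  The Varopoulos-Carne bound
    [varopoulos_carne], proved with Chebyshev polynomials of the convolution
    operator, says that the mean squared displacement is at most of the order of
    [n] times the entropy; so the lamplighter has displacement of order
    [n sqrt p] ([bit_walk_second_moment], [tour_cost]).  A word for its position
    is a tour of the lit sites, and switching the lamps at all visited sites
    preserves the law, so two such words give a tour of all sites
    ([speed_le_tour]).

    The tour is affordable.  It remains to see that [lam m] is at least of order
    [sqrt m] for every infinite group ([displacement_diffusive]); with [m] of
    order [1 / p] this bounds [n sqrt p] by a multiple of [n p lam (1 / p)].  If
    the return probability decays exponentially, the displacement is linear,
    since balls grow at most exponentially.  Otherwise there are times [2 m] at
    which the transition probabilities [p_2m (x)] vary slowly at unit scale and
    decay slowly in time.  They are positive definite in [x], and so are their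
    powers.  A suitable power of [p_2m (x) / p_2m (1)] drops from one by about
    [1 / t] in two steps, log-convexity of its means along the walk keeps the drops
    at this order up to a time of order [t], and the squared-distance bound on a
    positive definite function turns a drop of order one into a distance of order
    [sqrt t]. *)

(** * Weighted lists and random words *)

Section WeightedList.
Variable R : realType.

Section OneType.
Variable T : Type.
Implicit Types (u v : seq (R * T)) (F H : T -> R).

(** The integral of [F] against the finitely supported signed measure that a
    list of weighted points describes; points may be repeated. *)
Definition mean u F : R := \sum_(a <- u) a.1 * F a.2.

Lemma mean_nil F : mean [::] F = 0.
Proof. by rewrite /mean big_nil. Qed.

Lemma mean_cons a u F : mean (a :: u) F = a.1 * F a.2 + mean u F.
Proof. by rewrite /mean big_cons. Qed.

Lemma mean_cat u v F : mean (u ++ v) F = mean u F + mean v F.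
Proof. by rewrite /mean big_cat. Qed.

Lemma eq_mean u F H : F =1 H -> mean u F = mean u H.
Proof. by move=> e; apply: eq_bigr => a _; rewrite e. Qed.

Lemma meanD u F H : mean u (fun x => F x + H x) = mean u F + mean u H.
Proof. by rewrite /mean -big_split; apply: eq_bigr => a _; rewrite mulrDr. Qed.

Lemma meanZ u c F : mean u (fun x => c * F x) = c * mean u F.
Proof. by rewrite /mean mulr_sumr; apply: eq_bigr => a _; rewrite mulrCA. Qed.

Lemma meanB u F H : mean u (fun x => F x - H x) = mean u F - mean u H.
Proof.
rewrite -mulN1r -meanZ -meanD; apply: eq_mean => x.
by rewrite mulN1r.
Qed.

Lemma mean_sum u (I : Type) (r : seq I) (F : I -> T -> R) :
  mean u (fun x => \sum_(i <- r) F i x) = \sum_(i <- r) mean u (F i).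
Proof.
by rewrite /mean exchange_big; apply: eq_bigr => a _; rewrite mulr_sumr.
Qed.

End OneType.

Lemma mean_map (T U : Type) (f : T -> U) (u : seq (R * T)) F :
  mean [seq (a.1, f a.2) | a <- u] F = mean u (fun x => F (f x)).
Proof. by rewrite /mean big_map. Qed.

Lemma mean_scale (T U : Type) c (f : T -> U) (u : seq (R * T)) F :
  mean [seq (c * a.1, f a.2) | a <- u] F = c * mean u (fun x => F (f x)).
Proof. by rewrite /mean big_map mulr_sumr; apply: eq_bigr => a _; rewrite mulrA. Qed.

Lemma mean_swap (T U : Type) (u : seq (R * T)) (v : seq (R * U))
    (F : T -> U -> R) :
  mean u (fun x => mean v (F x)) = mean v (fun y => mean u (F ^~ y)).
Proof.
rewrite /mean; under eq_bigr do rewrite mulr_sumr.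
rewrite exchange_big; apply: eq_bigr => b _; rewrite mulr_sumr.
by apply: eq_bigr => a _; rewrite mulrCA.
Qed.

(** Positivity of all listed weights lets membership in the list stand for
    membership in the support. *)
Definition pdist (T : eqType) (u : seq (R * T)) :=
  (forall a, a \in u -> 0 < a.1) /\ \sum_(a <- u) a.1 = 1.

Section Pdist.
Variables (T : eqType) (u : seq (R * T)).

Lemma eq_mean_in F H :
  (forall a, a \in u -> F a.2 = H a.2) -> mean u F = mean u H.
Proof. by move=> e; apply: eq_big_seq => a /e ->. Qed.

Hypothesis pu : pdist u.

Lemma ler_mean F H :
  (forall a, a \in u -> F a.2 <= H a.2) -> mean u F <= mean u H.
Proof.
move=> e; rewrite /mean big_seq [leRHS]big_seq; apply: ler_sum => a au.
by rewrite ler_wpM2l ?e // ltW // pu.1.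
Qed.

Lemma mean_const c : mean u (fun=> c) = c.
Proof. by rewrite /mean -mulr_suml pu.2 mul1r. Qed.

Lemma mean_ge0 F : (forall x, 0 <= F x) -> 0 <= mean u F.
Proof. by move=> F0; rewrite -(mean_const 0); apply: ler_mean. Qed.

Lemma mean_le_const F c : (forall a, a \in u -> F a.2 <= c) -> mean u F <= c.
Proof. by move=> Fc; rewrite -[leRHS]mean_const; apply: ler_mean. Qed.

Lemma mean_point F a : (forall x, 0 <= F x) -> a \in u -> a.1 * F a.2 <= mean u F.
Proof.
move=> F0 au; rewrite /mean (perm_big _ (perm_to_rem au)) big_cons /= lerDl.
rewrite big_seq sumr_ge0 // => b /mem_rem bu.
by rewrite mulr_ge0 // ltW // pu.1.
Qed.

Lemma pdist_inhabited : exists a, a \in u.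
Proof.
case E: u => [|a v]; last by exists a; rewrite mem_head.
by case: pu => _; rewrite E big_nil => /esym/eqP; rewrite oner_eq0.
Qed.

Lemma pdist_map (U : eqType) (f : T -> U) : pdist [seq (a.1, f a.2) | a <- u].
Proof.
split=> [_ /mapP[a au ->]|]; first exact: pu.1.
by rewrite big_map pu.2.
Qed.

End Pdist.

Lemma mean_points (T : eqType) (u : seq (R * T)) F :
  mean u F = \sum_(x <- undup [seq a.2 | a <- u]) mean u (fun y => (y == x)%:R) * F x.
Proof.
transitivity (\sum_(x <- undup [seq a.2 | a <- u])
    mean u (fun y => F x * (y == x)%:R)); last first.
  by apply: eq_bigr => x _; rewrite meanZ mulrC.
rewrite -mean_sum; apply: eq_mean_in => a au.
rewrite (bigD1_seq a.2) ?undup_uniq //=; last first.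
  by rewrite mem_undup; apply: map_f.
rewrite eqxx mulr1 big1 ?addr0 // => x.
by rewrite eq_sym => /negbTE ->; rewrite mulr0.
Qed.

Lemma sum_uniq_eq_le1 (T : eqType) (s : seq T) y : uniq s ->
  \sum_(x <- s) (y == x)%:R <= 1 :> R.
Proof.
move=> us; have [ys|ns] := boolP (y \in s); last first.
  rewrite big_seq big1 ?ler01 // => x xs; case: eqP => // e.
  by rewrite e xs in ns.
rewrite (bigD1_seq y) //= eqxx big1 ?addr0 // => x.
by rewrite eq_sym => /negbTE ->.
Qed.

Lemma mean_uniq_le1 (T : eqType) (u : seq (R * T)) s : pdist u -> uniq s ->
  \sum_(x <- s) mean u (fun y => (y == x)%:R) <= 1.
Proof.
move=> pu us; rewrite -mean_sum; apply: mean_le_const => // a _.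
exact: sum_uniq_eq_le1.
Qed.

(** The law of [f x y] for independent [x] and [y]. *)
Definition product_law (T U V : Type) (f : T -> U -> V) (u : seq (R * T))
    (v : seq (R * U)) : seq (R * V) :=
  [seq (a.1 * b.1, f a.2 b.2) | a <- u, b <- v].

Lemma mean_product (T U V : Type) (f : T -> U -> V) u v F :
  mean (product_law f u v) F = mean u (fun x => mean v (fun y => F (f x y))).
Proof.
rewrite /mean big_allpairs_dep; apply: eq_bigr => a _; rewrite mulr_sumr.
by apply: eq_bigr => b _; rewrite mulrA.
Qed.

Lemma pdist_product (T U V : eqType) (f : T -> U -> V) u v :
  pdist u -> pdist v -> pdist (product_law f u v).
Proof.
move=> pu pv; split=> [_ /allpairsP[[a b] [/= /pu.1 a0 /pv.1 b0 ->]]|].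
  exact: mulr_gt0.
rewrite big_allpairs_dep -[RHS]pu.2; apply: eq_bigr => a _.
by rewrite -mulr_sumr pv.2 mulr1.
Qed.

Lemma mem_product (T U V : eqType) (f : T -> U -> V) u v c :
  c \in product_law f u v ->
  exists a b, [/\ a \in u, b \in v & c.2 = f a.2 b.2].
Proof. by move=> /allpairsP[[a b] [/= au bv ->]]; exists a, b. Qed.

Section Paths.
Variables (T : Type) (st : seq (R * T)).

(** All words of [n] independent letters of law [st]. *)
Fixpoint paths n : seq (R * seq T) :=
  if n is m.+1 then product_law cons st (paths m) else [:: (1, [::])].

Lemma mean_paths0 F : mean (paths 0) F = F [::].
Proof. by rewrite /mean big_seq1 mul1r. Qed.

Lemma mean_pathsS n F :
  mean (paths n.+1) F = mean st (fun x => mean (paths n) (fun y => F (x :: y))).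
Proof.
exact: mean_product.
Qed.

Lemma mean_paths_cat n m F :
  mean (paths (n + m)) F =
  mean (paths n) (fun y => mean (paths m) (fun z => F (y ++ z))).
Proof.
elim: n F => [|n IH] F; first by rewrite mean_paths0.
by rewrite addSn !mean_pathsS; apply: eq_mean => x; rewrite IH.
Qed.

End Paths.

Lemma mean_paths_map (T U : Type) (f : T -> U) (st : seq (R * T)) n F :
  mean (paths [seq (a.1, f a.2) | a <- st] n) F =
  mean (paths st n) (fun y => F (map f y)).
Proof.
elim: n F => [|n IH] F; first by rewrite !mean_paths0.
by rewrite !mean_pathsS mean_map; apply: eq_mean => x; rewrite IH.
Qed.

Lemma pdist_paths (T : eqType) (st : seq (R * T)) n :
  pdist st -> pdist (paths st n).
Proof.
move=> p; elim: n => [|n IH]; last exact: pdist_product.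
by split; [move=> a; rewrite inE => /eqP -> /= | rewrite big_seq1].
Qed.

Lemma mem_paths (T : eqType) (st : seq (R * T)) n a :
  a \in paths st n ->
  size a.2 = n /\ forall x, x \in a.2 -> x \in [seq b.2 | b <- st].
Proof.
elim: n a => [|n IH] a; first by rewrite inE => /eqP ->.
move=> /mem_product[b [c [bs /IH[<- cs] ->]]]; split=> //= x.
by rewrite inE => /predU1P[->|/cs //]; exact: map_f.
Qed.

(** The word [y] alone carries a mass of at least [q ^+ size y]. *)
Lemma mean_paths_point (T : eqType) (st : seq (R * T)) (q : R) y F :
  pdist st -> 0 <= q -> (forall a, a \in st -> q <= a.1) ->
  (forall x, x \in y -> x \in [seq b.2 | b <- st]) ->
  (forall z, 0 <= F z) ->
  q ^+ size y * F y <= mean (paths st (size y)) F.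
Proof.
move=> p q0 qst; elim: y F => [|x y IH] F ys F0.
  by rewrite mean_paths0 mul1r.
have /mapP[a ast ax] := ys x (mem_head _ _).
rewrite mean_pathsS exprS -mulrA.
apply: le_trans (mean_point p _ ast) => [|z]; last first.
  by apply: mean_ge0 => //; exact: pdist_paths.
rewrite -ax; apply: ler_pM => //; first by rewrite mulr_ge0 ?exprn_ge0.
  exact: qst.
by apply: IH => // z zy; apply: ys; rewrite inE zy orbT.
Qed.

Lemma iid_cons (Omega : finType) (P : Omega -> R) n x (w : n.-tuple Omega) :
  iid P [tuple of x :: w] = P x * iid P w.
Proof.
rewrite /iid big_ord_recl tnth0; congr (_ * _); apply: eq_bigr => i _.
by rewrite tnthS.
Qed.

(** The finite product space and the list of words carry the same law. *)
Lemma expect_iid (Omega : finType) (P : Omega -> R) n (F : seq Omega -> R) :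
  expect (iid P (n := n)) (fun w => F w) =
  mean (paths [seq (P w, w) | w <- enum Omega] n) F.
Proof.
elim: n F => [|n IH] F.
  rewrite mean_paths0 /expect (big_pred1 [tuple]) => [|w]; last first.
    by rewrite [w]tuple0 /= eqxx.
  by rewrite /iid big_ord0 mul1r.
transitivity (\sum_x P x *
    mean (paths [seq (P w, w) | w <- enum Omega] n) (fun y => F (x :: y))).
  2: by rewrite mean_pathsS [RHS]/mean big_map big_enum.
rewrite /expect (reindex (fun p : Omega * n.-tuple Omega => [tuple of p.1 :: p.2])) /=.
  rewrite -(pair_bigA _ (fun (x : Omega) (w : n.-tuple Omega) => iid P [tuple of x :: w] * F (x :: w))) /=.
  apply: eq_bigr => x _; rewrite -IH /expect mulr_sumr.
  by apply: eq_bigr => w _; rewrite iid_cons mulrA.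
exists (fun w : n.+1.-tuple Omega => (thead w, [tuple of behead w])).
  by move=> [x w] _ /=; congr pair; apply/val_inj.
by move=> w _; rewrite [RHS]tuple_eta; apply/val_inj.
Qed.

Lemma prob_expect (Omega : finType) (P : Omega -> R) (A : pred Omega) :
  prob P A = expect P (fun w => (A w)%:R).
Proof.
rewrite /prob /expect big_mkcond; apply: eq_bigr => w _.
by case: (A w); rewrite ?mulr1 ?mulr0.
Qed.

End WeightedList.

(** * Random walks on groups and word length *)

Section Words.
Variable G : groupType.
Implicit Types (g h : G) (s : seq G) (A : set G).

Lemma gprod_nil : gprod [::] = 1%g :> G.
Proof. by rewrite /gprod big_nil. Qed.

Lemma gprod_cons g s : gprod (g :: s) = (g * gprod s)%g.
Proof. by rewrite /gprod big_cons. Qed.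

Lemma gprod_cat s t : gprod (s ++ t) = (gprod s * gprod t)%g.
Proof. by rewrite /gprod big_cat. Qed.

Lemma gprod_rev_inv s : gprod (rev [seq (g^-1)%g | g <- s]) = ((gprod s)^-1)%g.
Proof.
elim: s => [|g s IH]; first by rewrite gprod_nil invg1.
by rewrite /= rev_cons -cats1 gprod_cat IH !gprod_cons gprod_nil mulg1 invgM.
Qed.

Definition reachable A g := exists n, word_of_length A g n.

Lemma word1 A : word_of_length A 1%g 0.
Proof. by exists [::]; split=> //; exact: gprod_nil. Qed.

Lemma word_letter (A : set G) g : A g -> word_of_length A g 1.
Proof.
move=> Ag; exists [:: g]; split=> [//|x|]; first by rewrite inE => /eqP ->.
by rewrite gprod_cons gprod_nil mulg1.
Qed.

Lemma wordM A g h m n : word_of_length A g m -> word_of_length A h n ->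
  word_of_length A (g * h)%g (m + n).
Proof.
move=> [s [<- sA <-]] [t [<- tA <-]]; exists (s ++ t).
split; [exact: size_cat| |exact: gprod_cat].
by move=> x; rewrite mem_cat => /orP[/sA|/tA].
Qed.

Lemma wordV (A : set G) g n : (forall x, A x -> A (x^-1)%g) ->
  word_of_length A g n -> word_of_length A (g^-1)%g n.
Proof.
move=> AV [s [<- sA <-]]; exists (rev [seq (g^-1)%g | g <- s]).
split; [by rewrite size_rev size_map| |exact: gprod_rev_inv].
by move=> x; rewrite mem_rev => /mapP[y /sA ? ->]; exact: AV.
Qed.

Lemma wlenP A g n : word_of_length A g n ->
  word_of_length A g (wlen A g) /\ (wlen A g <= n)%N.
Proof.
move=> w; rewrite /wlen; case: pselect => [h|[]]; last by exists n; exact/asboolP.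
by case: ex_minnP => m /asboolP wm mm; split=> //; apply/mm/asboolP.
Qed.

Lemma wlen_word A g : reachable A g -> word_of_length A g (wlen A g).
Proof. by move=> [n /wlenP[]]. Qed.

Lemma wlen_le A g n : word_of_length A g n -> (wlen A g <= n)%N.
Proof. by move/wlenP=> []. Qed.

Lemma wlen1 A : wlen A 1%g = 0%N.
Proof. by apply/eqP; rewrite -leqn0; apply/wlen_le/word1. Qed.

Lemma wlen_eq0 A g : reachable A g -> wlen A g = 0%N -> g = 1%g.
Proof.
move=> /wlen_word + w0; rewrite w0 => -[s [/size0nil -> _ <-]].
exact: gprod_nil.
Qed.

Lemma wlenM A g h : reachable A g -> reachable A h ->
  (wlen A (g * h)%g <= wlen A g + wlen A h)%N.
Proof. by move=> /wlen_word wg /wlen_word wh; apply/wlen_le/wordM. Qed.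

Lemma wlenV (A : set G) g : (forall x, A x -> A (x^-1)%g) ->
  reachable A g -> wlen A (g^-1)%g = wlen A g.
Proof.
move=> AV rg; have lV x : reachable A x -> (wlen A (x^-1)%g <= wlen A x)%N.
  by move=> /wlen_word wx; apply/wlen_le/wordV.
apply/eqP; rewrite eqn_leq lV //= -{1}[g]invgK lV //.
by case: rg => n wn; exists n; exact: wordV.
Qed.

End Words.

Section Walk.
Variables (R : realType) (G : groupType) (st : seq (R * G)).
Implicit Types (F : G -> R) (g h x : G).

Definition letters : set G := [set x | x \in [seq b.2 | b <- st]].

Definition walk n F : R := mean (paths st n) (fun y => F (gprod y)).

Definition symmetric_steps := forall F, mean st F = mean st (fun x => F (x^-1)%g).

Lemma walk0 F : walk 0 F = F 1%g.
Proof. by rewrite /walk mean_paths0 gprod_nil. Qed.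

Lemma walkS n F : walk n.+1 F = mean st (fun g => walk n (fun x => F (g * x)%g)).
Proof.
rewrite /walk mean_pathsS; apply: eq_mean => g; apply: eq_mean => y.
by rewrite gprod_cons.
Qed.

Lemma walk1 F : walk 1 F = mean st F.
Proof. by rewrite walkS; apply: eq_mean => g; rewrite walk0 mulg1. Qed.

Lemma eq_walk n F H : F =1 H -> walk n F = walk n H.
Proof. by move=> e; apply: eq_mean => y. Qed.

Lemma walkD n m F : walk (n + m) F = walk n (fun x => walk m (fun y => F (x * y)%g)).
Proof.
rewrite /walk mean_paths_cat; apply: eq_mean => y; apply: eq_mean => z.
by rewrite gprod_cat.
Qed.

Lemma walk_swap n m (F : G -> G -> R) :
  walk n (fun x => walk m (F x)) = walk m (fun y => walk n (F ^~ y)).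
Proof. exact: mean_swap. Qed.

Hypothesis sym : symmetric_steps.

Lemma walkV n F : walk n F = walk n (fun x => F (x^-1)%g).
Proof.
elim: n F => [|n IH] F; first by rewrite !walk0 invg1.
rewrite [RHS]walkS -addn1 walkD.
transitivity (mean st (fun g => walk n (fun x => F (x * g^-1)%g))); last first.
  apply: eq_mean => g; rewrite IH; apply: eq_mean => y.
  by rewrite invgM.
rewrite -(sym (fun g => walk n (fun x => F (x * g)%g))) -walk1.
exact: walk_swap.
Qed.

Hypothesis pst : pdist st.

Lemma letters_inv x : letters x -> letters (x^-1)%g.
Proof.
have pos z : letters z -> 0 < mean st (fun y => (y == z)%:R).
  move=> /mapP[a ast ->]; apply: lt_le_trans (mean_point pst _ ast); last by [].
  by rewrite eqxx mulr1 pst.1.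
move=> /pos; rewrite sym; apply: contraPP => nx.
rewrite (_ : mean _ _ = 0) ?ltxx // -(mean_const pst 0); apply: eq_mean_in => a ast.
case: eqP => // e; case: nx; rewrite /letters/= -e invgK.
by apply/mapP; exists a.
Qed.

Lemma word_gprod n (a : R * seq G) : a \in paths st n ->
  word_of_length letters (gprod a.2) n.
Proof. by move=> /mem_paths[<- al]; exists a.2. Qed.

Lemma walk_const n c : walk n (fun=> c) = c.
Proof. exact: (mean_const (pdist_paths n pst)). Qed.

Lemma ler_walk_word n F H :
  (forall x, word_of_length letters x n -> F x <= H x) -> walk n F <= walk n H.
Proof.
move=> FH; apply: (ler_mean (pdist_paths n pst)) => a /word_gprod; exact: FH.
Qed.

Lemma eq_walk_word n F H :
  (forall x, word_of_length letters x n -> F x = H x) -> walk n F = walk n H.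
Proof. by move=> FH; apply: eq_mean_in => a /word_gprod; exact: FH. Qed.

Lemma ler_walk n F H : (forall x, F x <= H x) -> walk n F <= walk n H.
Proof. by move=> FH; apply: ler_walk_word. Qed.

Lemma walk_ge0 n F : (forall x, 0 <= F x) -> 0 <= walk n F.
Proof. by move=> F0; rewrite -(walk_const n 0); exact: ler_walk. Qed.

Lemma walkZ n c F : walk n (fun x => c * F x) = c * walk n F.
Proof. exact: meanZ. Qed.

Lemma walkDf n F H : walk n (fun x => F x + H x) = walk n F + walk n H.
Proof. exact: meanD. Qed.

Lemma walkBf n F H : walk n (fun x => F x - H x) = walk n F - walk n H.
Proof. exact: meanB. Qed.

(** The smallest weight of a letter bounds the probability of any given word
    from below. *)
Lemma min_weight : exists q, [/\ 0 < q, q <= 1 & forall a, a \in st -> q <= a.1].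
Proof.
have [_ s1] := pst; clear s1; have := pst.1.
elim: (st) => [_|a u IH ua]; first by exists 1; split.
have [|q [q0 q1 qu]] := IH; first by move=> b bu; apply: ua; rewrite inE bu orbT.
exists (Num.min a.1 q); split=> [||b].
- by rewrite lt_min q0 ua ?mem_head.
- by rewrite ge_min q1 orbT.
- by rewrite inE => /predU1P[->|/qu]; rewrite ge_min ?lexx // => ->; rewrite orbT.
Qed.

Lemma walk_point q n x F : 0 <= q -> (forall a, a \in st -> q <= a.1) ->
  (forall z, 0 <= F z) -> word_of_length letters x n ->
  q ^+ n * F x <= walk n F.
Proof.
move=> q0 qst F0 [s [<- sl <-]].
exact: (mean_paths_point (F := fun y => F (gprod y)) pst q0 qst sl).
Qed.

End Walk.

Section Bridge.
Variable R : realType.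

Lemma step_supportE (G : groupType) (Omega : finType) (P : Omega -> R)
    (step : Omega -> G) : (forall w, 0 < P w) ->
  step_support P step = letters [seq (P w, step w) | w <- enum Omega].
Proof.
move=> P0; apply/seteqP; split=> g /=; rewrite /letters/= -map_comp.
  move=> g0; apply: contraTT g0 => ng; rewrite -leNgt /prob big1 // => w /eqP wg.
  by case/negP: ng; apply/mapP; exists w; rewrite ?mem_enum.
move=> /mapP[w _ ->]; rewrite /step_support /prob /= (bigD1 w) //=; apply: ltr_pwDl => //.
by apply: sumr_ge0 => v _; exact: ltW.
Qed.

Lemma mean_displacementE (G : groupType) (Omega : finType) (P : Omega -> R)
    (step : Omega -> G) n :
  mean_displacement P step n =
  walk [seq (P w, step w) | w <- enum Omega] n
    (fun g => (wlen (step_support P step) g)%:R).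
Proof.
rewrite /mean_displacement /walk.
have -> : [seq (P w, step w) | w <- enum Omega] =
    [seq (a.1, step a.2) | a <- [seq (P w, w) | w <- enum Omega]].
  by rewrite -map_comp.
rewrite mean_paths_map -(expect_iid P n
  (fun w => (wlen (step_support P step) (gprod (map step w)))%:R)).
rewrite /expect; apply: eq_bigr => w _; congr (_ * (wlen _ _)%:R).
by rewrite /position take_oversize // size_tuple.
Qed.

Variables (G : groupType) (mu : step_dist R G).

Definition step_list : seq (R * G) :=
  [seq (step_weight w, step_val w) | w <- enum {: finsupp mu}].

Lemma mean_step_list F : mean step_list F = \sum_(g <- finsupp mu) mu g * F g.
Proof. by rewrite /mean big_map big_enum /= big_seq_fsetE. Qed.

Lemma step_weight_gt0 (w : finsupp mu) : 0 < step_weight w.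
Proof.
rewrite lt_def step_mass_ge0 andbT /step_weight.
by have := valP w; rewrite mem_finsupp.
Qed.

Lemma pdist_step_list : pdist step_list.
Proof.
split=> [_ /mapP[w _ ->]|]; first exact: step_weight_gt0.
rewrite -[RHS](step_mass_sum1 mu) -[RHS](eq_bigr _ (fun g _ => mulr1 _)).
rewrite -mean_step_list.
by apply: eq_bigr => a _; rewrite mulr1.
Qed.

Lemma symmetric_step_list : symmetric_steps step_list.
Proof.
move=> F; rewrite !mean_step_list.
transitivity (\sum_(g <- [seq (g^-1)%g | g <- finsupp mu]) mu g * F g).
  apply: perm_big; apply: uniq_perm; first exact: fset_uniq.
    by rewrite map_inj_uniq ?fset_uniq //; exact: invg_inj.
  move=> g; rewrite mem_finsupp; apply/idP/mapP => [g0|[h hs ->]].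
    by exists (g^-1)%g; rewrite ?invgK // mem_finsupp step_mass_sym.
  by rewrite step_mass_sym -mem_finsupp.
by rewrite big_map; apply: eq_bigr => g _; rewrite step_mass_sym.
Qed.

Lemma letters_step_list : letters step_list = [set g | g \in finsupp mu]%classic.
Proof.
apply/seteqP; rewrite /letters /step_list -map_comp; split=> g /=.
  by move=> /mapP[w _ ->]; exact: valP.
by move=> gs; apply/mapP; exists (FSetSub gs); rewrite ?mem_enum.
Qed.

Lemma speedE n :
  speed mu n = walk step_list n (fun g => (wlen (letters step_list) g)%:R).
Proof.
by rewrite /speed mean_displacementE step_supportE //; exact: step_weight_gt0.
Qed.

End Bridge.

(** * Displacement at comparable times *)

Section Displacement.
Variables (R : realType) (G : groupType) (st : seq (R * G)).
Hypotheses (pst : pdist st) (sst : symmetric_steps st).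
Hypothesis full : forall g, reachable (letters st) g.

Let len g : R := (wlen (letters st) g)%:R.

Definition displacement n : R := walk st n len.

Let lenM g h : len (g * h)%g <= len g + len h.
Proof. by rewrite /len -natrD ler_nat wlenM. Qed.

Let lenV g : len (g^-1)%g = len g.
Proof. by rewrite /len wlenV //; exact: letters_inv. Qed.

Let len_ge0 g : 0 <= len g. Proof. exact: ler0n. Qed.

Lemma displacement_ge0 n : 0 <= displacement n.
Proof. exact: walk_ge0. Qed.

Lemma displacement0 : displacement 0 = 0.
Proof. by rewrite /displacement walk0 /len wlen1. Qed.

Lemma displacement_le n : displacement n <= n%:R.
Proof.
rewrite -(walk_const pst n n%:R); apply: ler_walk_word => // x xn.
by rewrite ler_nat wlen_le.
Qed.

Lemma displacementD m n : displacement (m + n) <= displacement m + displacement n.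
Proof.
rewrite /displacement walkD.
rewrite -[X in _ <= _ + X](walk_const pst m) -walkDf; apply: ler_walk => // x.
by rewrite -[X in _ <= X + _](walk_const pst n) -walkDf; apply: ler_walk.
Qed.

Lemma displacementM k m : displacement (k * m) <= k%:R * displacement m.
Proof.
elim: k => [|k IH]; first by rewrite mul0n mul0r displacement0.
rewrite mulSn; apply: le_trans (displacementD _ _) _.
by rewrite -natr1 mulrDl mul1r addrC lerD2r.
Qed.

(** Two independent positions at time [k] are at distance distributed as the
    displacement at time [2k], and both can be compared with a third copy
    shifted by [a]; so no shift brings the walk closer than half of its
    displacement. *)
Lemma displacement_shift k a :
  displacement (k + k) <= 2 * walk st (k + k) (fun x => len (x * a)%g).
Proof.
pose D := walk st (k + k) (fun x => len (x * a)%g).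
have DE : D = walk st k (fun x => walk st k (fun z => len (x^-1 * (z * a))%g)).
  rewrite /D walkD (walkV sst); apply: eq_walk => x; apply: eq_walk => z.
  by rewrite mulgA.
have step x y z : len (x^-1 * y)%g <= len (x^-1 * (z * a))%g + len (y^-1 * (z * a))%g.
  rewrite -[X in _ <= _ + X]lenV invgM invgK; apply: le_trans (lenM _ _).
  by rewrite mulgA mulgK.
rewrite /displacement walkD (walkV sst) mulr_natl mulr2n.
apply: (@le_trans _ _ (walk st k (fun x => walk st k (fun y => walk st k (fun z =>
    len (x^-1 * (z * a))%g + len (y^-1 * (z * a))%g))))).
  apply: ler_walk => // x; apply: ler_walk => // y.
  rewrite -[leLHS](walk_const pst k); apply: ler_walk => // z; exact: step.
under eq_walk do under eq_walk do rewrite walkDf.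
under eq_walk do rewrite walkDf walk_const //.
by rewrite walkDf walk_const // -DE.
Qed.

(** The last [j] steps act as a random shift. *)
Lemma displacement_even k j : displacement (k + k) <= 2 * displacement (k + k + j).
Proof.
rewrite /displacement (walkD _ _ j) walk_swap -walkZ -[leLHS](walk_const pst j).
apply: ler_walk => // a; exact: displacement_shift.
Qed.

Lemma displacement_almost_mono i j : (i <= j)%N ->
  displacement i <= 2 * displacement j + 1.
Proof.
move=> ij; rewrite -(odd_double_half i) -addnn addnC.
apply: le_trans (displacementD _ _) _; apply: lerD.
  rewrite -(subnKC (_ : i./2 + i./2 <= j)%N); first exact: displacement_even.
  by rewrite addnn (leq_trans _ ij) // -[leqRHS]odd_double_half leq_addl.
by case: odd; rewrite ?displacement0 ?displacement_le ?ler01.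
Qed.

Hypothesis infG : infinite_set [set: G]%classic.

(** If any two letters cancel, there is only one letter and it is an
    involution, so the group has at most two elements. *)
Lemma displacement2_gt0 : 0 < displacement 2.
Proof.
rewrite lt_def displacement_ge0 andbT; apply/negP => /eqP d0.
have [q [q0 _ qst]] := min_weight pst.
have w2 x : word_of_length (letters st) x 2 -> x = 1%g.
  move=> xw; apply: (wlen_eq0 (full x)); apply/eqP; rewrite -(pnatr_eq0 R).
  have := walk_point pst (ltW q0) qst len_ge0 xw; rewrite -/(displacement 2) d0.
  by rewrite pmulr_rle0 ?exprn_gt0 // => l0; rewrite eq_le l0 len_ge0.
have [s sst'] := pdist_inhabited pst.
have ls : letters st s.2 by apply/mapP; exists s.
have l1 x : letters st x -> x = s.2.
  move=> lx; have := w2 _ (wordM (word_letter lx) (word_letter (letters_inv sst pst ls))).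
  exact: divg1_eq.
have ss : (s.2 * s.2)%g = 1%g by apply: w2; apply: wordM (word_letter ls) (word_letter ls).
apply: infG; apply: (@sub_finite_set _ _ [set 1%g; s.2]%classic) => [g _|].
  have [n [t [_ tl <-]]] := full g.
  elim: t tl => [|x t IH] tl; first by left; exact: gprod_nil.
  rewrite gprod_cons (l1 x (tl x (mem_head _ _))).
  case: IH => [y yt|->|->]; first by apply: tl; rewrite inE yt orbT.
    by right; rewrite mulg1.
  by left.
exact: finite_set2.
Qed.

Lemma displacement_lower j : (1 <= j)%N -> displacement 2 / 2 <= displacement j.
Proof.
case: j => [//|[|j] _]; rewrite ler_pdivrMr // mulrC.
  by have := displacementM 2 1; rewrite muln1.
by have := displacement_even 1 j; rewrite add2n.
Qed.

Lemma displacement_mono : exists2 C : R, 1 <= C & forall i j, (i <= j)%N ->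
  (1 <= j)%N -> displacement i <= C * displacement j.
Proof.
have d2 := displacement2_gt0; exists (2 + 2 / displacement 2) => [|i j ij j1].
  by rewrite (@le_trans _ _ 2) ?ler1n // lerDl divr_ge0 // ltW.
apply: le_trans (displacement_almost_mono ij) _; rewrite [leRHS]mulrDl lerD2l.
have := displacement_lower j1; rewrite ler_pdivrMr // => dj.
by rewrite mulrAC ler_pdivlMr // mul1r mulrC.
Qed.

Lemma displacement_ratio : exists2 C : R, 1 <= C & forall T m, (1 <= m)%N ->
  displacement T <= C * (1 + T%:R / m%:R) * displacement m.
Proof.
have [C C1 mono] := displacement_mono; exists C => // T m m1.
rewrite {1}(divn_eq T m); apply: le_trans (displacementD _ _) _.
have m0 : (0 : R) < m%:R by rewrite ltr0n.
rewrite mulrDr mulr1 mulrDl addrC; apply: lerD.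
  by apply: mono => //; rewrite ltnW // ltn_mod.
apply: le_trans (displacementM _ _) _; rewrite ler_wpM2r ?displacement_ge0 //.
apply: le_trans (_ : T%:R / m%:R <= _); last first.
  by rewrite ler_peMl // divr_ge0 // ltW.
by rewrite ler_pdivlMr // -natrM ler_nat leq_trunc_div.
Qed.

End Displacement.

(** * Positive definite functions *)

(** The form takes the values [c * (a * c - b ^+ 2)] at [(c, - b)] and
    [a * (a * c - b ^+ 2)] at [(b, - a)]. *)
Lemma form_discr (R : realFieldType) (a b c : R) :
  (forall s t, 0 <= s ^+ 2 * a + 2 * s * t * b + t ^+ 2 * c) -> b ^+ 2 <= a * c.
Proof.
move=> q; have a0 : 0 <= a by have := q 1 0; lra.
have c0 : 0 <= c by have := q 0 1; lra.
have [ac|] := ltrP 0 (a + c).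
  have := q c (- b); have := q b (- a) => qa qc.
  have : 0 <= (a + c) * (a * c - b ^+ 2) by nra.
  by rewrite pmulr_rge0 // subr_ge0.
move=> ac; have -> : a = 0 by lra.
have c00 : c = 0 by lra.
have a00 : a = 0 by lra.
by have := q 1 b; have := q 1 (- b); rewrite a00 c00 => *; nra.
Qed.

Section PosDef.
Variables (R : realType) (G : groupType).
Implicit Types (K H : G -> R) (u v : seq (R * G)).

Definition gram K u v : R := mean u (fun x => mean v (fun y => K (x^-1 * y)%g)).

Definition posdef K := forall u, 0 <= gram K u u.

(** Restricting the form to pairs of points that carry the same label splits it
    into one positive form for each label. *)
Lemma posdef_labelled (L : eqType) K (u : seq (R * (G * L))) : posdef K ->
  0 <= mean u (fun p => mean u (fun q =>
         (p.2 == q.2)%:R * K (p.1^-1 * q.1)%g)).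
Proof.
move=> pK; pose zs := undup [seq a.2.2 | a <- u].
pose v z := [seq (a.1 * (a.2.2 == z)%:R, a.2.1) | a <- u].
have mv z F : mean (v z) F = mean u (fun p => (p.2 == z)%:R * F p.1).
  by rewrite /mean big_map; apply: eq_bigr => a _; rewrite mulrA.
suff -> : mean u (fun p => mean u (fun q => (p.2 == q.2)%:R * K (p.1^-1 * q.1)%g))
    = \sum_(z <- zs) gram K (v z) (v z) by apply: sumr_ge0 => z _; exact: pK.
transitivity (\sum_(z <- zs) mean u (fun p => mean u (fun q =>
    (p.2 == z)%:R * ((q.2 == z)%:R * K (p.1^-1 * q.1)%g)))); last first.
  apply: eq_bigr => z _; rewrite /gram mv; apply: eq_mean => p.
  by rewrite mv meanZ.
rewrite -mean_sum; apply: eq_mean_in => a au.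
rewrite -mean_sum; apply: eq_mean => q.
rewrite (bigD1_seq a.2.2) ?undup_uniq //=; last first.
  by rewrite mem_undup; apply/mapP; exists a.
rewrite eqxx mul1r eq_sym big1 ?addr0 // => z.
by rewrite eq_sym => /negbTE ->; rewrite mul0r.
Qed.

Lemma posdef_one : posdef (fun=> 1).
Proof.
move=> u; rewrite /gram (_ : mean _ _ = mean u (fun=> 1) ^+ 2) ?sqr_ge0 //.
rewrite expr2 -meanZ.
by apply: eq_mean => x; rewrite mulr1.
Qed.

Lemma posdef_scale c K : 0 <= c -> posdef K -> posdef (fun x => c * K x).
Proof.
move=> c0 pK u; rewrite /gram (_ : mean _ _ = c * gram K u u) ?mulr_ge0 //.
rewrite /gram -meanZ.
by apply: eq_mean => x; rewrite meanZ.
Qed.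

Lemma posdef_dirac : posdef (fun x => (x == 1%g)%:R).
Proof.
move=> u; have := posdef_labelled [seq (a.1, (a.2, a.2)) | a <- u] posdef_one.
rewrite (mean_map (fun x : G => (x, x))) /gram; congr (_ <= _); apply: eq_mean => x.
rewrite (mean_map (fun x : G => (x, x))); apply: eq_mean => y.
by rewrite mulr1 mulg_eq1 (inj_eq invg_inj).
Qed.

Section Increment.
Variable K : G -> R.
Hypotheses (pK : posdef K) (symK : forall x, K (x^-1)%g = K x).

Let N x := K 1%g - K x.

Lemma posdef_max x : K x <= K 1%g.
Proof.
have := pK [:: (1, 1%g); (-1, x)].
rewrite /gram /mean !big_cons !big_nil /= !mulVg !invg1 !mul1g mulg1 symK; lra.
Qed.

(** The square root of the increment [K 1 - K x] is subadditive, being a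
    distance in the Hilbert space of the form. *)
Lemma posdef_increment s t x y :
  s * t * N (x * y)%g <= (s + t) * (s * N x + t * N y).
Proof.
have := pK [:: (s, 1%g); (- (s + t), x); (t, (x * y)%g)].
rewrite /gram /mean !big_cons !big_nil /= !mulVg !invg1 !mul1g !mulg1 symK.
rewrite mulKg -[K (_ * x)%g]symK !invgM !invgK mulgA mulVg mul1g.
have -> : K (y^-1 * x^-1)%g = K (x * y)%g by rewrite -symK invgM !invgK.
by rewrite /N; nra.
Qed.

(** The squared distance to the end of a path of [k] edges is at most [k ^+ 2]
    times the largest squared edge; the weights [k] and [1] in the previous
    inequality make the induction exact. *)
Lemma posdef_increment_word M w : 0 <= M -> (forall x, x \in w -> N x <= M) ->
  N (gprod w) <= (size w)%:R ^+ 2 * M.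
Proof.
move=> M0; elim: w => [_|x [|y w] IH xM].
- by rewrite gprod_nil /N subrr expr0n mul0r.
- by rewrite gprod_cons gprod_nil mulg1 expr1n mul1r xM ?mem_head.
have Nx : N x <= M by apply: xM; rewrite mem_head.
have {}IH : N (gprod (y :: w)) <= (size (y :: w))%:R ^+ 2 * M.
  by apply: IH => z zw; apply: xM; rewrite inE zw orbT.
have := posdef_increment (size (y :: w))%:R 1 x (gprod (y :: w)).
rewrite [gprod [:: x, y & w]]gprod_cons [size [:: x, y & w]]/= -[(size w).+2%:R]natr1.
set k : R := (size w).+1%:R in IH *.
have k0 : 0 < k by rewrite ltr0n.
rewrite mulr1 mul1r => h; rewrite -(ler_pM2l k0); apply: le_trans h _.
rewrite [leRHS](_ : _ = (k + 1) * (k * M + k ^+ 2 * M)); last by ring.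
by rewrite ler_pM2l ?addr_gt0 // lerD // ler_pM2l.
Qed.

End Increment.

Section WalkForms.
Variable st : seq (R * G).
Implicit Types (p q : {poly R}) (F : G -> R).
Hypotheses (pst : pdist st) (sst : symmetric_steps st).

Lemma walk_sum n (I : Type) (r : seq I) (F : I -> G -> R) :
  walk st n (fun x => \sum_(i <- r) F i x) = \sum_(i <- r) walk st n (F i).
Proof. exact: mean_sum. Qed.

Lemma mean_walk_swap (u : seq (R * G)) n (F : G -> G -> R) :
  mean u (fun x => walk st n (F x)) = walk st n (fun y => mean u (F ^~ y)).
Proof. exact: mean_swap. Qed.

(** The transition probabilities at even times form a Gram matrix, the
    midpoint serving as a label; hence multiplying by them keeps positivity. *)
Lemma posdef_mul_return m K : posdef K ->
  posdef (fun x => K x * walk st (m + m) (fun g => (g == x)%:R)).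
Proof.
move=> pK u.
pose U := [seq (a.1 * b.1, (a.2, (a.2 * gprod b.2)%g)) | a <- u, b <- paths st m].
have mU (F : G * G -> R) : mean U F = mean u (fun x => walk st m (fun g => F (x, (x * g)%g))).
  rewrite /mean big_allpairs_dep; apply: eq_bigr => a _ /=.
  by rewrite mulr_sumr; apply: eq_bigr => b _ /=; rewrite mulrA.
have := posdef_labelled U pK; rewrite mU; congr (_ <= _).
rewrite /gram; apply: eq_mean => x.
under eq_walk do rewrite mU /=.
rewrite -mean_walk_swap; apply: eq_mean => y; rewrite walkD -walkZ; apply: eq_walk => a.
rewrite (walkV sst) -walkZ; apply: eq_walk => b.
rewrite mulrC; congr (_ * (nat_of_bool _)%:R).
rewrite -[RHS](inj_eq (mulgI x)) mulVKg mulgA.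
by rewrite [LHS]eq_sym divg_eq eq_sym.
Qed.

(** [poly_walk p F] integrates [F] against [p] evaluated at the convolution
    operator of the walk, applied to the unit mass at the identity. *)
Definition poly_walk (p : {poly R}) (F : G -> R) : R :=
  \sum_(i < size p) p`_i * walk st i F.

Lemma poly_walk_wide n p F : (size p <= n)%N ->
  poly_walk p F = \sum_(i < n) p`_i * walk st i F.
Proof.
move=> pn; rewrite /poly_walk (big_ord_widen n (fun i => p`_i * walk st i F) pn).
rewrite big_mkcond; apply: eq_bigr => i _; case: ltnP => // /(nth_default 0) ->.
by rewrite mul0r.
Qed.

Lemma eq_poly_walk p F H : F =1 H -> poly_walk p F = poly_walk p H.
Proof. by move=> e; apply: eq_bigr => i _; rewrite (eq_walk _ _ e). Qed.

Lemma poly_walkD p q F : poly_walk (p + q) F = poly_walk p F + poly_walk q F.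
Proof.
pose n := maxn (size p) (size q).
rewrite (@poly_walk_wide n) ?size_polyD // (@poly_walk_wide n p) ?leq_maxl //.
rewrite (@poly_walk_wide n q) ?leq_maxr // -big_split; apply: eq_bigr => i _.
by rewrite coefD mulrDl.
Qed.

Lemma poly_walkZ c p F : poly_walk (c *: p) F = c * poly_walk p F.
Proof.
rewrite (poly_walk_wide _ (size_scale_leq c p)) /poly_walk mulr_sumr.
by apply: eq_bigr => i _; rewrite coefZ mulrA.
Qed.

Lemma poly_walkN p F : poly_walk (- p) F = - poly_walk p F.
Proof. by rewrite -scaleN1r poly_walkZ mulN1r. Qed.

Lemma poly_walkB p q F : poly_walk (p - q) F = poly_walk p F - poly_walk q F.
Proof. by rewrite poly_walkD poly_walkN. Qed.

Lemma poly_walkXn n F : poly_walk 'X^n F = walk st n F.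
Proof.
rewrite /poly_walk size_polyXn big_ord_recr /= coefXn eqxx mul1r big1 ?add0r // => i _.
by rewrite coefXn ltn_eqF ?mul0r.
Qed.

Lemma poly_walkC c F : poly_walk c%:P F = c * F 1%g.
Proof. by rewrite -alg_polyC poly_walkZ -(expr0 'X) poly_walkXn walk0. Qed.

Lemma poly_walkMX p F :
  poly_walk (p * 'X) F = poly_walk p (fun x => walk st 1 (fun y => F (x * y)%g)).
Proof.
rewrite (@poly_walk_wide (size p).+1).
  rewrite big_ord_recl coefMX /= mul0r add0r; apply: eq_bigr => i _.
  by rewrite coefMX /= -walkD addn1.
by rewrite (leq_trans (size_polyMleq _ _)) // size_polyX addn2.
Qed.

Lemma poly_walkXM p F :
  poly_walk ('X * p) F = walk st 1 (fun x => poly_walk p (fun y => F (x * y)%g)).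
Proof.
rewrite mulrC (@poly_walk_wide (size p).+1).
  rewrite big_ord_recl coefMX /= mul0r add0r walk_sum.
  by apply: eq_bigr => i _; rewrite coefMX /= walkZ -walkD.
by rewrite (leq_trans (size_polyMleq _ _)) // size_polyX addn2.
Qed.

Lemma poly_walkM p q F :
  poly_walk (p * q) F = poly_walk p (fun x => poly_walk q (fun y => F (x * y)%g)).
Proof.
elim/poly_ind: p q F => [|p c IH] q F.
  by rewrite mul0r /poly_walk size_poly0 !big_ord0.
rewrite mulrDl -mulrA !poly_walkD IH poly_walkMX mul_polyC poly_walkZ.
rewrite poly_walkC; congr (_ + c * _).
  apply: eq_poly_walk => x; rewrite poly_walkXM; apply: eq_walk => y.
  by apply: eq_poly_walk => z; rewrite mulgA.
by apply: eq_poly_walk => x; rewrite mul1g.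
Qed.

Lemma poly_walkV p F : poly_walk p F = poly_walk p (fun x => F (x^-1)%g).
Proof. by apply: eq_bigr => i _; rewrite (walkV sst). Qed.

(** A signed measure with the same integrals as [poly_walk p]. *)
Definition poly_law (p : {poly R}) : seq (R * G) :=
  [seq (p`_i * a.1, gprod a.2) | i <- iota 0 (size p), a <- paths st i].

Lemma mean_poly_law p F : mean (poly_law p) F = poly_walk p F.
Proof.
rewrite /mean big_allpairs_dep /poly_walk.
rewrite -(big_mkord xpredT (fun i => p`_i * walk st i F)) /index_iota subn0.
apply: eq_bigr => i _.
by rewrite /walk /mean mulr_sumr; apply: eq_bigr => a _; rewrite mulrA.
Qed.

Lemma gram_poly_law K p q :
  gram K (poly_law p) (poly_law q) = poly_walk (p * q) K.
Proof.
rewrite /gram mean_poly_law poly_walkM [RHS]poly_walkV.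
by apply: eq_poly_walk => x; rewrite mean_poly_law.
Qed.

Lemma poly_walk_sqr_ge0 K p : posdef K -> 0 <= poly_walk (p * p) K.
Proof. by move=> pK; rewrite -gram_poly_law; exact: pK. Qed.

Lemma poly_law_walk p q n F :
  mean (poly_law p) (fun x => walk st n (fun g => mean (poly_law q) (fun y =>
    F (x * (g * y))%g))) = poly_walk (p * ('X^n * q)) F.
Proof.
rewrite mean_poly_law poly_walkM; apply: eq_poly_walk => x.
rewrite poly_walkM poly_walkXn; apply: eq_walk => g.
exact: mean_poly_law.
Qed.

(** The convolution operator is a contraction, being an average of translations,
    which preserve the form. *)
Lemma poly_walk_contract K p : posdef K ->
  0 <= poly_walk ((1 - 'X^2) * (p * p)) K.
Proof.
move=> pK; pose f := poly_law p.
pose f_ g := [seq (1 * a.1, (g * a.2)%g) | a <- f].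
pose T g := gram K f (f_ g).
have mf g H : mean (f_ g) H = mean f (fun x => H (g * x)%g).
  by rewrite mean_scale mul1r.
have TE : walk st 2 T = poly_walk ('X^2 * (p * p)) K.
  rewrite mulrCA -poly_law_walk [RHS]mean_poly_law [RHS]poly_walkV.
  rewrite -[RHS]mean_poly_law mean_walk_swap; apply: eq_walk => g.
  rewrite /T /gram; apply: eq_mean => x; exact: mf.
have gT g : 0 <= 2 * gram K f f - T g - T (g^-1)%g.
  have := pK (f ++ [seq (-1 * a.1, (g * a.2)%g) | a <- f]).
  rewrite {1}/gram mean_cat mean_scale /=.
  under eq_mean do rewrite mean_cat mean_scale mulN1r.
  under [X in -1 * X]eq_mean do rewrite mean_cat mean_scale mulN1r.
  rewrite !meanB mulN1r opprB.
  have -> : mean f (fun x => mean f (fun y => K ((g * x)^-1 * (g * y))%g)) = gram K f f.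
    apply: eq_mean => x; apply: eq_mean => y.
    by rewrite invgM -mulgA mulKg.
  have -> : mean f (fun x => mean f (fun y => K ((g * x)^-1 * y)%g)) = T (g^-1)%g.
    apply: eq_mean => x; rewrite mf; apply: eq_mean => y.
    by rewrite invgM mulgA.
  have -> : mean f (fun x => mean f (fun y => K (x^-1 * (g * y))%g)) = T g.
    by apply: eq_mean => x; rewrite mf.
  by rewrite -/(gram K f f); congr (_ <= _); ring.
have := walk_ge0 pst 2 gT; rewrite !walkBf -(walkV sst) walk_const // TE.
by rewrite mulrBl mul1r poly_walkB gram_poly_law; lra.
Qed.

Section Convexity.
Variable K : G -> R.
Hypothesis pK : posdef K.

(** For a positive definite function, the means at even times are the moments
    of a measure on the unit interval, the spectral measure of two steps of the
    walk; [even_drop] gives the moments of that measure multiplied by one minus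
    the variable.  Log-convexity and monotonicity are all that is used of it. *)
Definition even_mean j : R := walk st (j + j) K.

Definition even_drop j : R := even_mean j - even_mean j.+1.

Lemma even_mean_logconvex j :
  even_mean j.+1 ^+ 2 <= even_mean j * even_mean j.+2.
Proof.
apply: form_discr => s t.
have := poly_walk_sqr_ge0 (s *: 'X^j + t *: 'X^(j.+2)) pK.
rewrite (_ : _ * _ = s ^+ 2 *: 'X^(j + j) + (2 * s * t) *: 'X^(j.+1 + j.+1)
  + t ^+ 2 *: 'X^(j.+2 + j.+2)); last first.
  by rewrite -!mul_polyC !exprD !exprS !polyCM; ring.
by rewrite !poly_walkD !poly_walkZ !poly_walkXn.
Qed.

Let dropE j : poly_walk ((1 - 'X^2) * ('X^j * 'X^j)) K = even_drop j.
Proof.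
rewrite mulrBl mul1r poly_walkB -!exprD !poly_walkXn /even_drop /even_mean.
by congr (_ - walk _ _ _); rewrite addnS addSn.
Qed.

Lemma even_drop_ge0 j : 0 <= even_drop j.
Proof. by rewrite -dropE; exact: poly_walk_contract. Qed.

Lemma even_drop_logconvex j :
  even_drop j.+1 ^+ 2 <= even_drop j * even_drop j.+2.
Proof.
apply: form_discr => s t.
have := poly_walk_contract (s *: 'X^j + t *: 'X^(j.+2)) pK.
rewrite -!dropE -!poly_walkZ -!poly_walkD; congr (0 <= poly_walk _ _).
by rewrite -!mul_polyC !exprS !polyCM; ring.
Qed.

Lemma even_drop_anti j : even_drop j.+1 <= even_drop j.
Proof.
have := poly_walk_sqr_ge0 ('X^j - 'X^(j.+2)) pK.
rewrite (_ : _ * _ = 'X^(j + j) - 2%:P * 'X^(j.+1 + j.+1) + 'X^(j.+2 + j.+2)).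
  rewrite poly_walkD poly_walkB mul_polyC poly_walkZ !poly_walkXn.
  by rewrite /even_drop /even_mean; lra.
by rewrite !exprD !exprS; ring.
Qed.

Lemma even_mean_anti i j : (i <= j)%N -> even_mean j <= even_mean i.
Proof.
move=> /subnKC <-; elim: (j - i)%N => [|k IH]; first by rewrite addn0.
by rewrite addnS (le_trans _ IH) // -subr_ge0 even_drop_ge0.
Qed.

Lemma even_mean_telescope i k :
  even_mean i - even_mean (i + k) = \sum_(j < k) even_drop (i + j).
Proof.
elim: k => [|k IH]; first by rewrite addn0 subrr big_ord0.
by rewrite big_ord_recr /= -IH addnS /even_drop; ring.
Qed.

End Convexity.
End WalkForms.
End PosDef.

(** * Words of even length *)

Section EvenWords.
Variables (G : groupType) (A : set G).

Definition even_word (x : G) := exists n, word_of_length A x (n + n).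

Lemma even_wordM x y : even_word x -> even_word y -> even_word (x * y)%g.
Proof.
by move=> [m wm] [n wn]; exists (m + n)%N; rewrite addnACA; exact: wordM.
Qed.

Lemma even_word1 : even_word 1%g.
Proof. by exists 0; exact: word1. Qed.

Lemma even_word2 x y : A x -> A y -> even_word (x * y)%g.
Proof. by move=> Ax Ay; exists 1; exact: (wordM (word_letter Ax) (word_letter Ay)). Qed.

Lemma even_word_pairs x n : word_of_length A x (n + n) ->
  exists w, [/\ size w = n, forall z, z \in w -> word_of_length A z 2 & gprod w = x].
Proof.
elim: n x => [|n IH] x.
  by move=> [s [/size0nil -> _ <-]]; exists [::]; split.
rewrite addSn addnS => -[s0 [ss sA <-]].
case: s0 ss sA => [|a [|b s]] //= [ss] sA.
have [|w [sw wA gw]] := IH (gprod s).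
  by exists s; split=> // z zs; apply: sA; rewrite !inE zs !orbT.
exists ((a * b)%g :: w); split=> [|z|]; first by rewrite /= sw.
  rewrite inE => /orP[/eqP ->|/wA //].
  by apply: (wordM (word_letter _) (word_letter _)); apply: sA; rewrite !inE eqxx ?orbT.
by rewrite !gprod_cons gw mulgA.
Qed.

Hypothesis AV : forall x, A x -> A (x^-1)%g.

Lemma even_wordV x : even_word x -> even_word (x^-1)%g.
Proof. by move=> [n wn]; exists n; exact: wordV. Qed.

(** If a shortest word of an element has odd length although the element is
    also an even word, then its first letter is an even word, and replacing it
    costs a bounded amount, as there are finitely many letters. *)
Lemma even_word_length (s : seq G) : (forall x, A x -> x \in s) ->
  exists2 K : nat, (1 <= K)%N & forall x, even_word x ->
    exists2 k, (k <= K * wlen A x)%N & word_of_length A x (k + k).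
Proof.
move=> As; suff [K sK] : exists K, forall x, x \in s -> even_word x ->
    exists2 k, (k <= K)%N & word_of_length A x (k + k).
  exists K.+1 => // x ex; have rx : reachable A x.
    by case: ex => n wn; exists (n + n)%N.
  have wx := wlen_word rx; have [odd_x|ev] := boolP (odd (wlen A x)); last first.
    exists (wlen A x)./2; last by rewrite addnn halfK (negbTE ev) subn0.
    by rewrite mulSn; apply: leq_trans (leq_addr _ _); rewrite -divn2 leq_div.
  have [t [st tA gt]] := wx.
  case: t st tA gt => [|a t] /= st tA gt; first by rewrite -st in odd_x.
  have st2 : size t = ((wlen A x)./2 + (wlen A x)./2)%N.
    by rewrite addnn halfK odd_x -st subn1.
  have wt : word_of_length A (gprod t) ((wlen A x)./2 + (wlen A x)./2).
    by exists t; split=> // z zt; apply: tA; rewrite inE zt orbT.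
  have ea : even_word a.
    have -> : a = (x * (gprod t)^-1)%g by rewrite -gt gprod_cons mulgK.
    by apply: even_wordM => //; apply: even_wordV; exists (wlen A x)./2.
  have [k kK wa] := sK a (As _ (tA _ (mem_head _ _))) ea.
  exists (k + (wlen A x)./2)%N; last first.
    by rewrite addnACA; have := wordM wa wt; rewrite -gprod_cons gt.
  rewrite mulSn addnC; apply: leq_add; first by rewrite -divn2 leq_div.
  by apply: leq_trans kK _; rewrite leq_pmulr // odd_gt0.
elim: {As} s => [|a s [K sK]]; first by exists 0.
have [[n wn]|na] := pselect (even_word a).
  exists (maxn n K) => x; rewrite inE => /predU1P[-> _|xs ex].
    by exists n => //; exact: leq_maxl.
  have [k kK wk] := sK x xs ex; exists k => //.
  exact: leq_trans kK (leq_maxr _ _).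
by exists K => x; rewrite inE => /predU1P[-> /na|xs ex] //; exact: sK.
Qed.

End EvenWords.

(** * Return probabilities *)

Section Return.
Variables (R : realType) (G : groupType) (st : seq (R * G)).
Hypotheses (pst : pdist st) (sst : symmetric_steps st).

Let A := letters st.
Let AV := letters_inv sst pst.

Lemma even_word_bound : exists2 K : nat, (1 <= K)%N & forall x, even_word A x ->
  exists2 k, (k <= K * wlen A x)%N & word_of_length A x (k + k).
Proof. exact: (even_word_length AV (s := [seq b.2 | b <- st])). Qed.

Definition hit m x : R := walk st (m + m) (fun g => (g == x)%:R).

Definition return_prob m := even_mean st (fun x => (x == 1%g)%:R) m.
Definition return_drop m := even_drop st (fun x => (x == 1%g)%:R) m.
Local Notation ret := return_prob.
Local Notation drop := return_drop.

Lemma hit1 m : hit m 1%g = ret m. Proof. by []. Qed.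

Lemma hit_ge0 m x : 0 <= hit m x.
Proof. by apply: walk_ge0 => // g; exact: ler0n. Qed.

Lemma hitV m x : hit m (x^-1)%g = hit m x.
Proof.
rewrite /hit (walkV sst); apply: eq_walk => g.
by rewrite (inj_eq invg_inj).
Qed.

Lemma posdef_hit m : posdef (hit m).
Proof.
have := posdef_mul_return sst m (@posdef_one R G); congr posdef.
by apply/funext => x; rewrite mul1r.
Qed.

Lemma even_mean_hit m j : even_mean st (hit m) j = ret (m + j).
Proof.
rewrite /return_prob /even_mean addnACA [in RHS]addnC [RHS]walkD [RHS](walkV sst).
apply: eq_walk => x; apply: eq_walk => g.
by rewrite mulg_eq1 (inj_eq invg_inj) eq_sym.
Qed.

Lemma word_one m : word_of_length A 1%g (m + m).
Proof.
have [a ast] := pdist_inhabited pst.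
have la : A a.2 by apply/mapP; exists a.
elim: m => [|m IH]; first exact: word1.
rewrite addSn addnS -[1%g](mulgV a.2) -[(a.2 / a.2)%g]mulg1.
apply: (@wordM _ _ _ _ 2) => //; apply: (@wordM _ _ _ _ 1 1); apply: word_letter => //.
exact: AV.
Qed.

Lemma ret_gt0 m : 0 < ret m.
Proof.
have [q [q0 _ qst]] := min_weight pst.
apply: lt_le_trans (walk_point pst (ltW q0) qst _ (word_one m)) => [|g]; last first.
  exact: ler0n.
by rewrite eqxx mulr1 exprn_gt0.
Qed.

Lemma return_prob0 : ret 0 = 1.
Proof. by rewrite /return_prob /even_mean walk0 eqxx. Qed.

Lemma drop_ge0 m : 0 <= drop m.
Proof. by apply: even_drop_ge0 => //; exact: posdef_dirac. Qed.

Lemma ret_anti i j : (i <= j)%N -> ret j <= ret i.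
Proof. by apply: even_mean_anti => //; exact: posdef_dirac. Qed.

Lemma hit_le_ret m x : hit m x <= ret m.
Proof. by rewrite -hit1; apply: posdef_max; [exact: posdef_hit|exact: hitV]. Qed.

(** The increment of [hit m] over a pair of letters is controlled by its mean
    over all pairs, which is [drop m]. *)
Lemma hit_increment2 q m x : 0 < q -> (forall a, a \in st -> q <= a.1) ->
  word_of_length A x 2 -> ret m - hit m x <= q ^- 2 * drop m.
Proof.
move=> q0 qst x2; have N0 z : 0 <= ret m - hit m z by rewrite subr_ge0 hit_le_ret.
have := walk_point pst (ltW q0) qst N0 x2; rewrite walkBf walk_const //.
have -> : walk st 2 (hit m) = ret m.+1.
  by have := even_mean_hit m 1; rewrite addn1.
by rewrite mulrC -ler_pdivlMr ?exprn_gt0 // mulrC.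
Qed.

Lemma even_hit_increment q : 0 < q -> (forall a, a \in st -> q <= a.1) ->
  exists2 K : nat, (1 <= K)%N & forall m x, even_word A x ->
    ret m - hit m x <= (K * wlen A x)%:R ^+ 2 * (q ^- 2 * drop m).
Proof.
move=> q0 qst; have [K K1 KA] := even_word_bound; exists K => // m x /KA[k kK].
move=> /even_word_pairs[w [sw wA gw]].
have M0 : 0 <= q ^- 2 * drop m.
  by rewrite mulr_ge0 ?drop_ge0 // invr_ge0 exprn_ge0 // ltW.
have wM z : z \in w -> hit m 1%g - hit m z <= q ^- 2 * drop m.
  by rewrite hit1 => /wA; exact: hit_increment2.
have := posdef_increment_word (posdef_hit m) (hitV m) M0 wM.
rewrite gw sw => h; apply: le_trans h _; apply: ler_wpM2r => //.
by rewrite ler_pXn2r ?nnegrE ?ler0n // ler_nat.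
Qed.

Lemma ret_telescope i k : ret i - ret (i + k) = \sum_(j < k) drop (i + j).
Proof. exact: even_mean_telescope. Qed.

Lemma small_drop e : 0 < e -> exists m, drop m <= e.
Proof.
move=> e0; apply: contrapT => /forallNP nd.
pose k := (Num.truncn e^-1).+1.
have := ret_telescope 0 k; rewrite return_prob0 add0n => tel.
have : \sum_(j < k) e <= \sum_(j < k) drop (0 + j).
  by apply: ler_sum => j _; rewrite ltW // ltNge; apply/negP/nd.
rewrite -tel sumr_const card_ord -[leLHS]mulr_natl.
apply/negP; rewrite -ltNge (lt_trans (y := 1)) //.
  by rewrite ltrBlDr ltrDl ret_gt0.
by rewrite -ltr_pdivrMr // mul1r truncnS_gt.
Qed.

Hypothesis full : forall g, reachable A g.
Hypothesis infG : infinite_set [set: G]%classic.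

Lemma infinite_even : infinite_set [set x | even_word A x]%classic.
Proof.
move=> fE; have [a ast] := pdist_inhabited pst.
have la : A a.2 by apply/mapP; exists a.
apply: infG; apply: (@sub_finite_set _ _ ([set x | even_word A x] `|`
    (fun x => x * a.2)%g @` [set x | even_word A x])%classic).
  move=> x _; have [n wn] := full x.
  have h : (odd n + (n./2 + n./2))%N = n by rewrite addnn odd_double_half.
  case: (odd n) h => h; last by left; exists n./2; rewrite -h in wn.
  right; exists (x * (a.2)^-1)%g; last by rewrite mulgVK.
  exists (n./2).+1; rewrite addSn addnS -addn1 -add1n h.
  by apply: wordM wn _; apply/word_letter/AV.
by rewrite finite_setU; split=> //; exact: finite_image.
Qed.

(** As the drops vanish, the transition probabilities at many points become
    equal to the return probability, which is then small. *)
Lemma small_ret e : 0 < e -> exists m, ret m <= e.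
Proof.
move=> e0; pose n := (Num.truncn (2 / e)).+1.
have [B BE nB] := infinite_set_fset n infinite_even.
have [q [q0 _ qst]] := min_weight pst.
have [K K1 KA] := even_hit_increment q0 qst.
pose C : R := \sum_(x <- B) ((K * wlen A x)%:R ^+ 2 * q ^- 2).
have C0 : 0 <= C.
  by apply: sumr_ge0 => x _; rewrite mulr_ge0 ?exprn_ge0 // invr_ge0 exprn_ge0 // ltW.
have C1 : 0 < C + 1 by rewrite ltr_wpDl.
have [m dm] : exists m, drop m <= (C + 1)^-1 by apply: small_drop; rewrite invr_gt0.
exists m.
have h1 : \sum_(x <- B) hit m x <= 1.
  have := mean_uniq_le1 (pdist_map (pdist_paths (m + m) pst) (@gprod G)) (fset_uniq B).
  by under eq_bigr do rewrite mean_map.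
have h2 : \sum_(x <- B) (ret m - hit m x) <= C * drop m.
  rewrite /C mulr_suml big_seq [leRHS]big_seq; apply: ler_sum => x xB.
  by rewrite -mulrA KA //; exact: BE.
have h3 : C * drop m <= 1.
  apply: le_trans (_ : C * (C + 1)^-1 <= _); first exact: ler_wpM2l.
  by rewrite ler_pdivrMr // mul1r lerDl.
have : n%:R * ret m <= 2.
  apply: le_trans (_ : #|` B|%:R * ret m <= _).
    by rewrite ler_wpM2r ?ler_nat // ltW // ret_gt0.
  have -> : #|` B|%:R * ret m = \sum_(x <- B) ret m.
    by rewrite big_const_seq count_predT iter_addr addr0 mulr_natl.
  rewrite (_ : \sum_(x <- B) ret m = \sum_(x <- B) hit m x
    + \sum_(x <- B) (ret m - hit m x)); first by lra.
  by rewrite -big_split; apply: eq_bigr => x _ /=; ring.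
apply: contraTT; rewrite -!ltNge => er.
apply: lt_trans (_ : n%:R * e < _); last by rewrite ltr_pM2l // ltr0n.
by rewrite -ltr_pdivrMr // truncnS_gt.
Qed.

Lemma drop_gt0 m : 0 < drop m.
Proof.
rewrite lt_def drop_ge0 andbT; apply/negP => /eqP d0.
have dj j : drop (m + j) = 0.
  elim: j => [|j IH]; first by rewrite addn0.
  have := even_drop_logconvex pst sst (@posdef_dirac R G) (m + j).
  rewrite -/(drop _) -/(drop _) IH mul0r addnS => h; apply/eqP.
  by rewrite -[_ == 0](expf_eq0 _ 2) eq_le h sqr_ge0.
have rj j : ret (m + j) = ret m.
  apply/esym/eqP; rewrite -subr_eq0 ret_telescope big1 // => i _; exact: dj.
have [k rk] := small_ret (divr_gt0 (ret_gt0 m) (ltr0n R 2)).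
have := ret_anti (leq_addl m k); rewrite rj => rmk.
have := ret_gt0 m; lra.
Qed.

Lemma drop_ret_anti i k c : c * drop i <= ret i -> c * drop (i + k) <= ret (i + k).
Proof.
move=> h; elim: k => [|k IH]; first by rewrite addn0.
rewrite addnS; set m := (i + k)%N in IH *.
have := even_mean_logconvex sst (@posdef_dirac R G) m.
rewrite -!/(return_prob _) => lc; have := ret_gt0 m; have := ret_gt0 m.+1.
have e1 : drop m = ret m - ret m.+1 by [].
have e2 : drop m.+1 = ret m.+1 - ret m.+2 by [].
have d0 := drop_ge0 m; have d1 := drop_ge0 m.+1 => r1 r0.
have key : drop m.+1 * ret m <= drop m * ret m.+1 by rewrite e1 e2; nra.
have [c0|c0] := lerP 0 c; last first.
  by apply: le_trans (ltW r1); rewrite mulr_le0_ge0 // ltW.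
rewrite -(ler_pM2r r0) -mulrA.
apply: le_trans (ler_wpM2l c0 key) _; rewrite mulrA [leRHS]mulrC.
by rewrite ler_pM2r.
Qed.

(** When the return probabilities decay subexponentially, some scale [m] has
    both [drop m] much smaller than [ret m] and two consecutive drops almost
    equal; otherwise the drops after [m] would sum to less than half of
    [ret m], and the return probabilities could not tend to zero. *)
Lemma good_scale (t : R) : 1 <= t -> (exists m, 2 * t * drop m <= ret m) ->
  exists m, t * drop m <= ret m /\ (1 - t^-1) * drop m <= drop m.+1.
Proof.
move=> t1 [m0 hm0]; apply: contrapT => /forallNP nm.
have t0 : 0 < t by apply: lt_le_trans t1.
have dec k : drop (m0 + k).+1 < (1 - t^-1) * drop (m0 + k).
  rewrite ltNge; apply/negP => h; apply: (nm (m0 + k)%N); split=> //.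
  apply: drop_ret_anti; apply: le_trans hm0; rewrite -mulrA mulr_natl mulr2n.
  by rewrite lerDl mulr_ge0 ?drop_ge0 // ltW.
have sum k : t * drop (m0 + k) + \sum_(j < k) drop (m0 + j) <= t * drop m0.
  elim: k => [|k IH]; first by rewrite addn0 big_ord0 addr0.
  rewrite addnS big_ord_recr /=; apply: le_trans IH.
  rewrite [X in X <= _]addrA [X in X <= _]addrAC lerD2r.
  have e z : t * ((1 - t^-1) * z) = t * z - z by field; rewrite gt_eqF.
  by have := ltW (dec k); rewrite -(ler_pM2l t0) e; lra.
have [k rk] := small_ret (divr_gt0 (ret_gt0 m0) (ltr0n R 4)).
have := ret_anti (leq_addl m0 k); have := sum k; rewrite -ret_telescope.
have := drop_ge0 (m0 + k); have := ret_gt0 m0; nra.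
Qed.

End Return.

(** * The diffusive lower bound *)

Section Elementary.
Variable R : realFieldType.

Lemma bernoulli_lower (x : R) n : 0 <= x <= 1 -> 1 - n%:R * x <= (1 - x) ^+ n.
Proof.
move=> /andP[x0 x1]; elim: n => [|n IH]; first by rewrite mul0r subr0 expr0.
rewrite exprS; have n0 : 0 <= n%:R :> R by exact: ler0n.
have : (1 - x) * (1 - n%:R * x) <= (1 - x) * (1 - x) ^+ n.
  by apply: ler_wpM2l => //; lra.
by apply: le_trans; rewrite -natr1; nra.
Qed.

Lemma bernoulli_upper (x : R) n : 0 <= x <= 1 ->
  (1 - x) ^+ n <= 1 - n%:R * x + n%:R ^+ 2 * x ^+ 2 / 2.
Proof.
move=> /andP[x0 x1]; elim: n => [|n IH].
  by rewrite mul0r subr0 expr0 expr0n mul0r mul0r addr0.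
rewrite exprS; have n0 : 0 <= n%:R :> R by exact: ler0n.
have : (1 - x) * (1 - x) ^+ n <= (1 - x) * (1 - n%:R * x + n%:R ^+ 2 * x ^+ 2 / 2).
  by apply: ler_wpM2l => //; lra.
move/le_trans; apply; rewrite -natr1.
rewrite -subr_ge0 (_ : _ - _ = (x ^+ 2 + n%:R ^+ 2 * x ^+ 3) / 2); last by field.
by rewrite divr_ge0 // addr_ge0 ?mulr_ge0 ?exprn_ge0.
Qed.

(** The successive ratios of a log-convex sequence increase. *)
Lemma logconvex_geometric (a : nat -> R) r : 0 < r -> 0 < a 0%N ->
  (forall i, a i.+1 ^+ 2 <= a i * a i.+2) -> r * a 0%N <= a 1%N ->
  forall i, r ^+ i * a 0%N <= a i.
Proof.
move=> r0 a0 lc a1; suff h i : 0 < a i /\ r * a i <= a i.+1.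
  elim=> [|i IH]; first by rewrite mul1r.
  have [_] := h i; apply: le_trans; rewrite exprS -mulrA.
  by rewrite ler_pM2l.
elim: i => [//|i [ai rai]]; have ai1 : 0 < a i.+1.
  by apply: lt_le_trans rai; exact: mulr_gt0.
split=> //; rewrite -(ler_pM2l ai); apply: le_trans (lc i).
by rewrite mulrCA expr2 mulrA ler_pM2r.
Qed.

(** To first order both drops of the sequence [1, c1, c2] equal [v], and the
    errors are of relative order [B / t]; the factor [36] in [t] makes the
    relative error at most [1 / (2 j)], so that it cannot build up to more than
    one half in [j] steps. *)
Lemma almost_equal_drops (B j t v c1 c2 : R) :
  1 <= B -> 1 <= j -> t = 36 * B * j -> 0 < v -> v <= 2 * t^-1 ->
  1 - v <= c1 -> c1 <= 1 - v + B * v ^+ 2 / 2 ->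
  c2 <= 1 - (2 - t^-1) * v + 4 * B * v ^+ 2 ->
  v / 2 <= 1 - c1 /\ (1 - (2 * j)^-1) * (1 - c1) <= c1 - c2.
Proof.
move=> B1 j1 tE v0 vt c1l c1u c2u.
have B0 : 0 < B by lra.
have j0 : 0 < j by lra.
have t0 : 0 < t by rewrite tE !mulr_gt0.
have tV0 : 0 < t^-1 by rewrite invr_gt0.
have BtV : B * t^-1 = 36^-1 * j^-1 by rewrite tE; field; rewrite !gt_eqF.
have jV : j^-1 <= 1 by rewrite invf_le1.
have jV0 : 0 < j^-1 by rewrite invr_gt0.
have Bv : B * v ^+ 2 <= 2 * (B * t^-1) * v.
  rewrite -subr_ge0 (_ : _ - _ = B * v * (2 * t^-1 - v)); last by ring.
  by rewrite !mulr_ge0 ?subr_ge0 // ltW.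
rewrite BtV in Bv; have jv : j^-1 * v <= v by rewrite ler_piMl // ltW.
have tv : t^-1 * v <= 36^-1 * (j^-1 * v).
  rewrite mulrA -BtV; apply: ler_wpM2r; first exact: ltW.
  by rewrite ler_peMl // ltW.
have D0 : v / 2 <= 1 - c1 by lra.
split=> //; rewrite invfM.
have : j^-1 * (v / 2) <= j^-1 * (1 - c1) by rewrite ler_pM2l.
lra.
Qed.

End Elementary.

Section Diffusive.
Variables (R : realType) (G : groupType) (st : seq (R * G)).
Hypotheses (pst : pdist st) (sst : symmetric_steps st).
Let A := letters st.

Local Notation ret := (return_prob st).
Local Notation drop := (return_drop st).
Local Notation disp := (displacement st).

Section PowerDecay.
Variable eta : G -> R.
Hypothesis eta01 : forall x, 0 <= eta x <= 1.

Lemma mean_power_lower n i :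
  1 - n%:R * walk st i eta <= walk st i (fun x => (1 - eta x) ^+ n).
Proof.
rewrite -{1}(walk_const pst i 1) -walkZ -walkBf; apply: ler_walk => // x.
exact: bernoulli_lower.
Qed.

Lemma mean_power_upper n i M : 0 <= M ->
  (forall x, word_of_length A x i -> eta x <= M) ->
  walk st i (fun x => (1 - eta x) ^+ n) <=
  1 - n%:R * walk st i eta + n%:R ^+ 2 / 2 * (M * walk st i eta).
Proof.
move=> M0 hM; rewrite -[X in _ <= X - _ + _](walk_const pst i) -!walkZ -walkBf -walkDf.
apply: ler_walk_word => // x /hM xM.
apply: le_trans (bernoulli_upper n (eta01 x)) _; rewrite lerD2l mulrAC.
apply: ler_wpM2l; first by rewrite divr_ge0 ?exprn_ge0.
rewrite expr2 ler_wpM2r //; by case/andP: (eta01 x).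
Qed.

(** Suppose that the defect [eta] is of order [d] after two steps and grows
    linearly in the number of steps at first.  When [n] is of order [1 / (t d)],
    the two first drops of the means of [(1 - eta) ^+ n] are almost equal, and
    log-convexity keeps all drops up to a time of order [t] at the order
    [1 / t]. *)
Lemma power_decay n (B d t : R) j : 1 <= B -> (1 <= j)%N -> t = 36 * B * j%:R ->
  0 < d -> t^-1 <= n%:R * d <= 2 * t^-1 ->
  posdef (fun x => (1 - eta x) ^+ n) -> eta 1%g = 0 ->
  (forall x, word_of_length A x 2 -> eta x <= B * d) ->
  (forall x, word_of_length A x 4 -> eta x <= 4 * B * d) ->
  walk st 2 eta = d -> (2 - t^-1) * d <= walk st 4 eta <= 2 * d ->
  (144 * B)^-1 <= 1 - walk st (j + j) (fun x => (1 - eta x) ^+ n).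
Proof.
move=> B1 j1 tE d0 /andP[] + + pK eta1 pt2 pt4 eta2 /andP[eta4_ge eta4_le].
set v := n%:R * d => v_ge v_le.
have B0 : 0 < B by lra.
have j0 : 1 <= j%:R :> R by rewrite ler1n.
have t0 : 0 < t by rewrite tE !mulr_gt0 //; lra.
have v0 : 0 < v by apply: lt_le_trans v_ge; rewrite invr_gt0.
pose K x := (1 - eta x) ^+ n.
pose c i := even_mean st K i; pose D i := even_drop st K i.
have c0 : c 0%N = 1 by rewrite /c /even_mean walk0 /K eta1 subr0 expr1n.
have c1l : 1 - v <= c 1%N by have := mean_power_lower n 2; rewrite eta2.
have c1u : c 1%N <= 1 - v + B * v ^+ 2 / 2.
  apply: le_trans (mean_power_upper n _ pt2) _; first by rewrite mulr_ge0 // ltW.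
  by rewrite eta2 le_eqVlt; apply/orP; left; apply/eqP; rewrite /v; ring.
have c2u : c 2%N <= 1 - (2 - t^-1) * v + 4 * B * v ^+ 2.
  have Bd0 : 0 <= 4 * B * d by rewrite !mulr_ge0 // ltW.
  apply: le_trans (mean_power_upper n Bd0 pt4) _.
  have h1 : n%:R * ((2 - t^-1) * d) <= n%:R * walk st 4 eta by rewrite ler_wpM2l.
  have h2 : n%:R ^+ 2 / 2 * (4 * B * d * walk st 4 eta)
      <= n%:R ^+ 2 / 2 * (4 * B * d * (2 * d)).
    by rewrite !ler_wpM2l // divr_ge0 ?exprn_ge0.
  have e3 : n%:R ^+ 2 / 2 * (4 * B * d * (2 * d)) = 4 * B * v ^+ 2 by rewrite /v; field.
  have e4 : n%:R * ((2 - t^-1) * d) = (2 - t^-1) * v by rewrite /v; ring.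
  by rewrite e3 in h2; rewrite e4 in h1; apply: lerD => //; rewrite lerD2l lerN2.
have [D0 D1] := almost_equal_drops B1 j0 tE v0 v_le c1l c1u c2u.
have D0E : D 0%N = 1 - c 1%N by rewrite -c0.
have D1E : D 1%N = c 1%N - c 2%N by [].
rewrite -D0E -?D1E in D0 D1.
have jV2 : (2 * j%:R)^-1 <= 2^-1 :> R by rewrite lef_pV2 ?posrE; lra.
have jV0 : 0 < (2 * j%:R)^-1 :> R by rewrite invr_gt0; lra.
have r0 : 0 < 1 - (2 * j%:R)^-1 :> R by lra.
have DD0 : 0 < D 0%N by lra.
have Di i : (i < j)%N -> v / 4 <= D i.
  move=> ij; apply: le_trans (logconvex_geometric r0 DD0 (even_drop_logconvex pst sst pK) D1 i).
  have h2 : 1 - i%:R * (2 * j%:R)^-1 <= (1 - (2 * j%:R)^-1) ^+ i :> R.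
    by apply: bernoulli_lower; apply/andP; split; lra.
  have h1 : i%:R * (2 * j%:R)^-1 <= 2^-1 :> R.
    rewrite ler_pdivrMr; last by lra.
    by rewrite mulrA mulVf ?mul1r ?ler_nat ?(ltnW ij) // gt_eqF.
  apply: le_trans (_ : 2^-1 * D 0%N <= _); first by lra.
  by rewrite ler_pM2r //; lra.
have <- : \sum_(i < j) D (0 + i)%N = 1 - c j.
  by have := even_mean_telescope st K 0 j; rewrite -/(c 0%N) c0.
apply: le_trans (_ : \sum_(i < j) v / 4 <= _); last first.
  by apply: ler_sum => i _; exact: (Di i (ltn_ord i)).
rewrite sumr_const card_ord -[leRHS]mulr_natl.
apply: le_trans (_ : j%:R * (t^-1 / 4) <= _); last by rewrite ler_pM2l; lra.
rewrite le_eqVlt; apply/orP; left; apply/eqP.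
by rewrite tE; field; rewrite !gt_eqF //; lra.
Qed.

End PowerDecay.

Definition defect m (x : G) : R := (ret m - hit st m x) / ret m.

Lemma ratio_defect m x : 1 - defect m x = hit st m x / ret m.
Proof. by rewrite /defect mulrBl mulfV ?gt_eqF ?ret_gt0 // opprB addrC subrK. Qed.

Lemma defect01 m x : 0 <= defect m x <= 1.
Proof.
have b0 := ret_gt0 pst sst m.
rewrite /defect divr_ge0 ?subr_ge0 ?hit_le_ret ?(ltW b0) //=.
by rewrite ler_pdivrMr // mul1r gerBl hit_ge0.
Qed.

Lemma defect_le m x M : ret m - hit st m x <= M * drop m ->
  defect m x <= M * (drop m / ret m).
Proof. by move=> h; rewrite /defect mulrA ler_pM2r // invr_gt0 ret_gt0. Qed.

Lemma walk_defect m i : walk st (i + i) (defect m) = (ret m - ret (m + i)) / ret m.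
Proof.
rewrite /defect; under eq_walk do rewrite mulrC.
by rewrite walkZ walkBf walk_const // -(even_mean_hit sst) mulrC.
Qed.

Lemma posdef_defect m n : posdef (fun x => (1 - defect m x) ^+ n).
Proof.
elim: n => [|n IH].
  by have := @posdef_one R G; congr posdef; apply/funext => x; rewrite expr0.
have r0 : 0 <= (ret m)^-1 by rewrite invr_ge0 ltW // ret_gt0.
have := posdef_scale r0 (posdef_mul_return sst m IH); congr posdef.
by apply/funext => x; rewrite exprSr ratio_defect mulrCA (mulrC _^-1).
Qed.

Hypothesis full : forall g, reachable A g.
Hypothesis infG : infinite_set [set: G]%classic.

(** The walk leaves the set where the powers of transition probabilities are
    close to their maximum within a time of order [t]; the bound on increments
    by squared word length then says that it is at a distance of order
    [sqrt t]. *)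
Lemma displacement_subexponential :
  (forall t : R, 1 <= t -> exists m, 2 * t * drop m <= ret m) ->
  exists2 c : R, 0 < c & forall j, (1 <= j)%N -> c * Num.sqrt j%:R <= disp (j + j).
Proof.
move=> sub; have [q [q0 q1 qst]] := min_weight pst.
have [K K1 KA] := even_hit_increment pst sst q0 qst.
have [B BE] : exists B, B = q ^- 2 by eexists.
have B1 : 1 <= B by rewrite BE invf_ge1 ?exprn_gt0 // exprn_ile1 // ltW.
have B0 : 0 < B by lra.
have K0 : 0 < K%:R :> R by rewrite ltr0n.
exists (144 * B * K%:R)^-1 => [|j j1]; first by rewrite invr_gt0 !mulr_gt0.
have j0 : 1 <= j%:R :> R by rewrite ler1n.
have [t tE] : exists t, t = 36 * B * j%:R by eexists.
have t1 : 1 <= t by rewrite tE; nra.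
have t0 : 0 < t by lra.
have tV0 : 0 < t^-1 by rewrite invr_gt0.
have [m [tm dm]] := good_scale pst sst full infG t1 (sub t t1).
have b0 := ret_gt0 pst sst m; have d0 := drop_gt0 pst sst full infG m.
have [d dE] : exists d, d = drop m / ret m by eexists.
have dgt : 0 < d by rewrite dE; exact: divr_gt0.
have td : t * d <= 1 by rewrite dE mulrA ler_pdivrMr // mul1r.
have hit2 x : word_of_length A x 2 -> ret m - hit st m x <= B * drop m.
  by rewrite BE; exact: hit_increment2.
have pt2 x : word_of_length A x 2 -> defect m x <= B * d.
  by rewrite dE => /hit2/defect_le.
have pt4 x : word_of_length A x 4 -> defect m x <= 4 * B * d.
  move=> /(@even_word_pairs _ _ x 2)[w [sw wA gw]]; rewrite dE; apply: defect_le.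
  have M0 : 0 <= B * drop m by rewrite mulr_ge0 ?(ltW d0) // ltW.
  have := posdef_increment_word (posdef_hit sst m) (hitV sst m) M0 (fun z zw => hit2 z (wA z zw)).
  by rewrite gw sw hit1 expr2 mulrA -natrM.
have eta2 : walk st 2 (defect m) = d by rewrite (walk_defect m 1) addn1 dE.
have eta4 : (2 - t^-1) * d <= walk st 4 (defect m) <= 2 * d.
  have dd : drop m.+1 <= drop m := even_drop_anti sst (@posdef_dirac R G) m.
  have -> : walk st 4 (defect m) = d + drop m.+1 / ret m.
    rewrite (walk_defect m 2) addn2 dE -mulrDl; congr (_ / _).
    by rewrite /return_drop /even_drop /return_prob; ring.
  have h1 : drop m.+1 / ret m <= d by rewrite dE ler_pM2r ?invr_gt0.
  have h2 : (1 - t^-1) * d <= drop m.+1 / ret m by rewrite dE mulrA ler_pM2r ?invr_gt0.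
  by apply/andP; split; lra.
(* The power for which the mean defect of two steps becomes about [1 / t]. *)
have [n nE] : exists n, n = (Num.truncn (t * d)^-1).+1 by eexists.
have n0 : 0 < n%:R :> R by rewrite nE ltr0n.
have nd : t^-1 <= n%:R * d <= 2 * t^-1.
  have td0 : 0 < t * d by exact: mulr_gt0.
  have cancel : (t * d)^-1 * d = t^-1 by rewrite invfM mulrVK ?unitfE ?gt_eqF.
  apply/andP; split.
    by rewrite -cancel ler_pM2r // nE ltW // truncnS_gt.
  have h : n%:R <= (t * d)^-1 + 1.
    by rewrite nE -natr1 lerD2r truncn_le invr_ge0 ltW.
  have h2 : d <= t^-1 by rewrite -[t^-1]mul1r ler_pdivlMr // mulrC.
  by move: h; rewrite -(ler_pM2r dgt) mulrDl cancel mul1r; lra.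
have cj := power_decay (defect01 m) B1 j1 tE dgt nd (posdef_defect m n)
  (_ : defect m 1%g = 0) pt2 pt4 eta2 eta4.
have {}cj : (144 * B)^-1 <= 1 - walk st (j + j) (fun x => (1 - defect m x) ^+ n).
  by apply: cj; rewrite /defect hit1 subrr mul0r.
have sj0 : 0 < Num.sqrt j%:R :> R by rewrite sqrtr_gt0; lra.
have pt x : word_of_length A x (j + j) ->
    1 - (1 - defect m x) ^+ n <= K%:R / Num.sqrt j%:R * (wlen A x)%:R.
  move=> xj; have [y yE] : exists y, y = K%:R / Num.sqrt j%:R * (wlen A x)%:R :> R.
    by eexists.
  rewrite -yE; have y0 : 0 <= y by rewrite yE mulr_ge0 // divr_ge0 // ltW.
  have [e0 e1] := andP (defect01 m x).
  have [y1|y1] := lerP 1 y.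
    by apply: le_trans y1; rewrite gerBl exprn_ge0 // subr_ge0.
  apply: le_trans (_ : y ^+ 2 <= _); last by rewrite expr2 ler_piMl // ltW.
  have h := bernoulli_lower n (defect01 m x).
  apply: (@le_trans _ _ (n%:R * defect m x)); first by lra.
  have kx : ret m - hit st m x <= ((K * wlen A x)%:R ^+ 2 * B) * drop m.
    by rewrite -mulrA BE; apply: KA; exists j.
  have := defect_le kx; rewrite -dE -(ler_pM2l n0) => /le_trans; apply.
  have y2 : y ^+ 2 = (K * wlen A x)%:R ^+ 2 / j%:R.
    by rewrite yE natrM !exprMn exprVn sqr_sqrtr ?ler0n // mulrAC.
  rewrite y2 mulrCA -mulrA; apply: ler_wpM2l; first exact: exprn_ge0.
  have jV : j%:R^-1 = 36 * (B * t^-1) by rewrite tE; field; rewrite !gt_eqF //; lra.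
  have [_ nd2] := andP nd.
  have : B * (n%:R * d) <= B * (2 * t^-1) by rewrite ler_pM2l.
  have : 0 <= B * t^-1 by rewrite mulr_ge0 // ltW.
  by rewrite jV; lra.
have : 1 - walk st (j + j) (fun x => (1 - defect m x) ^+ n) <=
    K%:R / Num.sqrt j%:R * disp (j + j).
  rewrite -{1}(walk_const pst (j + j) 1) -walkBf /displacement -walkZ.
  exact: ler_walk_word.
move/(le_trans cj); rewrite mulrAC ler_pdivlMr // => h.
by rewrite invfM mulrAC ler_pdivrMr // [leRHS]mulrC.
Qed.

End Diffusive.

Section DiffusiveEnd.
Variables (R : realType) (G : groupType) (st : seq (R * G)).
Hypotheses (pst : pdist st) (sst : symmetric_steps st).
Let A := letters st.
Hypothesis full : forall g, reachable A g.
Hypothesis infG : infinite_set [set: G]%classic.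

Local Notation ret := (return_prob st).
Local Notation drop := (return_drop st).
Local Notation disp := (displacement st).

(** A ball of radius [r] has at most exponentially many points, since each of
    them carries an exponentially small mass at some time at most [r]; no point
    carries more than the return probability. *)
Lemma ball_probability q m r : 0 < q -> q <= 1 -> (forall a, a \in st -> q <= a.1) ->
  walk st (m + m) (fun x => (wlen A x <= r)%N%:R) <= ret m * (2 / q) ^+ r.
Proof.
move=> q0 q1 qst.
rewrite /walk -(mean_map (@gprod G) _ (fun x => (wlen A x <= r)%N%:R)) mean_points.
set s := undup _; have us : uniq s by exact: undup_uniq.
apply: le_trans (_ : \sum_(x <- s) ret m * (wlen A x <= r)%N%:R <= _).
  apply: ler_sum => x _; apply: ler_wpM2r; first exact: ler0n.
  by rewrite mean_map; exact: hit_le_ret.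
rewrite -mulr_sumr ler_pM2l ?ret_gt0 //.
have qr : 0 < q ^+ r by exact: exprn_gt0.
rewrite exprMn exprVn ler_pdivlMr // mulr_suml.
apply: le_trans (_ : \sum_(x <- s) \sum_(k < r.+1) walk st k (fun y => (y == x)%:R) <= _).
  apply: ler_sum => x _; case: leqP => xr; last first.
    by rewrite mul0r sumr_ge0 // => k _; apply: walk_ge0 => // y; exact: ler0n.
  rewrite mul1r (bigD1 (Ordinal (xr : (wlen A x < r.+1)%N))) //=.
  apply: ler_wpDr; first by apply: sumr_ge0 => k _; apply: walk_ge0 => // y; exact: ler0n.
  have := walk_point pst (F := fun y => (y == x)%:R) (ltW q0) qst
    (fun y => ler0n _ _) (wlen_word (full x)).
  rewrite eqxx mulr1; apply: le_trans; apply: ler_wiXn2l => //; exact: ltW.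
rewrite exchange_big /=; apply: le_trans (_ : \sum_(k < r.+1) 1 <= _).
  apply: ler_sum => k _.
  apply: le_trans (mean_uniq_le1 (pdist_map (pdist_paths k pst) (@gprod G)) us).
  by apply: ler_sum => x _; rewrite mean_map.
rewrite sumr_const card_ord -natrX ler_nat; exact: ltn_expl.
Qed.

(** If the return probability decays exponentially, the walk is unlikely to be
    in a ball whose radius is a small multiple of the time. *)
Lemma displacement_exponential (t : R) : 1 <= t ->
  (forall m, ret m < 2 * t * drop m) ->
  exists Q : nat, (1 <= Q)%N /\
    forall j, (1 <= j)%N -> 2^-1 * j%:R <= disp (Q * j + Q * j).
Proof.
move=> t1 rd; have [q [q0 q1 qst]] := min_weight pst.
have t0 : 0 < 2 * t by lra.
have [rho rhoE] : exists rho : R, rho = 1 - (2 * t)^-1 by eexists.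
have tV : 0 < (2 * t)^-1 by rewrite invr_gt0.
have tV1 : (2 * t)^-1 <= 2^-1 by rewrite lef_pV2 ?posrE; lra.
have rho01 : 0 < rho < 1 by apply/andP; lra.
have rho0 : 0 < rho by lra.
have decay m : ret m <= rho ^+ m.
  elim: m => [|m IH]; first by rewrite return_prob0 expr0.
  rewrite exprS; apply: le_trans (_ : rho * ret m <= _); last by rewrite ler_pM2l.
  have : (2 * t)^-1 * ret m <= drop m.
    by rewrite mulrC ler_pdivrMr // mulrC ltW.
  have : drop m = ret m - ret m.+1 by [].
  by rewrite rhoE mulrBl mul1r; lra.
have [Q [Q1 hQ]] : exists Q : nat, (1 <= Q)%N /\ rho ^+ Q * (2 / q) <= 2^-1.
  have u0 : 0 < rho^-1 - 1 by rewrite subr_gt0 invf_gt1 //; lra.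
  have grow n : 1 + n%:R * (rho^-1 - 1) <= rho^-1 ^+ n.
    elim: n => [|n IH]; first by rewrite mul0r addr0 expr0.
    rewrite exprS; apply: le_trans (_ : rho^-1 * (1 + n%:R * (rho^-1 - 1)) <= _).
      rewrite -subr_ge0 -natr1 (_ : _ - _ = n%:R * (rho^-1 - 1) ^+ 2); last by ring.
      by rewrite mulr_ge0 ?sqr_ge0.
    by rewrite ler_pM2l ?invr_gt0.
  exists (Num.truncn (4 / q / (rho^-1 - 1))).+1; split=> //.
  set N := _.+1; have := grow N; rewrite exprVn => gN.
  have : 4 / q / (rho^-1 - 1) < N%:R by rewrite truncnS_gt.
  rewrite ltr_pdivrMr // => hN.
  have hq : 4 / q <= (rho ^+ N)^-1 by lra.
  have : rho ^+ N * (4 / q) <= 1.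
    by rewrite mulrC -ler_pdivlMr ?exprn_gt0 // div1r.
  by rewrite (_ : 4 / q = 2 * (2 / q)); [lra|ring].
exists Q; split=> // j j1.
have := ball_probability (Q * j) j q0 q1 qst.
set P := walk _ _ _ => hP.
have P2 : P <= 2^-1.
  apply: le_trans hP _; apply: le_trans (_ : rho ^+ (Q * j) * (2 / q) ^+ j <= _).
    by rewrite ler_pM2r ?exprn_gt0 ?divr_gt0.
  rewrite exprM -exprMn; apply: le_trans (_ : (2^-1) ^+ j <= _).
    by rewrite ler_pXn2r // nnegrE ?invr_ge0 // mulr_ge0 ?exprn_ge0 ?divr_ge0 // ltW.
  rewrite -[leRHS]expr1; apply: ler_wiXn2l => //; lra.
apply: (@le_trans _ _ (j%:R * (1 - P))).
  by rewrite mulrC ler_wpM2l ?ler0n //; lra.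
rewrite /P -[X in X - _](walk_const pst (Q * j + Q * j) 1) -walkBf -walkZ.
apply: ler_walk => // x; case: leqP => h; first by rewrite subrr mulr0.
by rewrite subr0 mulr1 ler_nat ltnW.
Qed.

(** In both regimes of the return probability the bound holds at the multiples
    of some fixed time, and near monotonicity of the displacement extends it to
    all times. *)
Theorem displacement_diffusive :
  exists2 c : R, 0 < c & forall n, (1 <= n)%N -> c * Num.sqrt n%:R <= disp n.
Proof.
suff [Q [c [Q1 c0 Qc]]] : exists (Q : nat) (c : R), [/\ (1 <= Q)%N, 0 < c &
    forall j, (1 <= j)%N -> c * Num.sqrt j%:R <= disp (Q * j + Q * j)].
  have d2 := displacement2_gt0 pst sst full infG.
  have QR : 1 <= Q%:R :> R by rewrite ler1n.
  pose s : R := Num.sqrt (4 * Q%:R).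
  have s0 : 0 < s by rewrite sqrtr_gt0; lra.
  have s1 : 1 <= s by rewrite -sqrtr1 ler_sqrt; lra.
  exists (Num.min (c / 2) (disp 2 / 2) / s) => [|n n1].
    by rewrite divr_gt0 // lt_min !divr_gt0.
  rewrite mulrAC ler_pdivrMr //.
  have [nQ|Qn] := ltnP n (Q + Q).
    apply: le_trans (_ : disp 2 / 2 * s <= _); last first.
      by rewrite ler_pM2r // displacement_lower.
    apply: ler_pM => //; first by rewrite le_min !divr_ge0 // ltW.
      by rewrite ge_min lexx orbT.
    rewrite ler_sqrt; last by lra.
    by rewrite -natrM ler_nat; lia.
  pose j := (n %/ (Q + Q))%N.
  have j1 : (1 <= j)%N by rewrite divn_gt0 // addn_gt0 Q1.
  have jn : (Q * j + Q * j <= n)%N by rewrite -mulnDl mulnC leq_trunc_div.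
  have nj : (n <= 4 * Q * j)%N.
    have := ltn_ceil n (_ : (0 < Q + Q)%N); rewrite -/j; nia.
  have h1 := Qc j j1; have := displacement_even pst sst full (Q * j) (n - (Q * j + Q * j)).
  rewrite subnKC // => h2.
  apply: le_trans (_ : c / 2 * (Num.sqrt j%:R * s) <= _).
    apply: ler_pM => //; first by rewrite le_min !divr_ge0 // ltW.
      by rewrite ge_min lexx.
    rewrite -sqrtrM ?ler0n // ler_sqrt; last by rewrite mulr_ge0 ?ler0n //; lra.
    by rewrite -!natrM ler_nat; lia.
  rewrite mulrA ler_pM2r //; lra.
have [sub|/existsNP[t /not_implyP[t1 /forallNP nt]]] :=
    pselect (forall t : R, 1 <= t -> exists m, 2 * t * drop m <= ret m).
  have [c c0 h] := displacement_subexponential pst sst full infG sub.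
  by exists 1%N, c; split=> // j j1; rewrite mul1n; exact: h.
have [|Q [Q1 hQ]] := @displacement_exponential t t1.
  by move=> m; rewrite ltNge; apply/negP/nt.
exists Q, 2^-1; split=> // j j1; apply: le_trans (hQ j j1).
rewrite ler_pM2l; last by lra.
have j0 : 1 <= j%:R :> R by rewrite ler1n.
have sj : 1 <= Num.sqrt j%:R :> R by have := ler_wsqrtr j0; rewrite sqrtr1.
have e : j%:R = Num.sqrt j%:R ^+ 2 :> R by rewrite sqr_sqrtr ?ler0n.
by rewrite [leRHS]e expr2 ler_peMl ?sqrtr_ge0.
Qed.

End DiffusiveEnd.

(** * The Varopoulos-Carne bound *)

Section Chebyshev.
Variable R : realType.

(** Chebyshev polynomials of the first and second kind, the latter shifted by
    one; the recursion is the addition formula for an angle whose cosine is the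
    indeterminate. *)
Fixpoint chebyshev (n : nat) : {poly R} * {poly R} :=
  if n is m.+1 then
    let: (t, u) := chebyshev m in ('X * t - (1 - 'X^2) * u, 'X * u + t)
  else (1, 0).

Lemma chebyshevS n : chebyshev n.+1 =
  ('X * (chebyshev n).1 - (1 - 'X^2) * (chebyshev n).2,
   'X * (chebyshev n).2 + (chebyshev n).1).
Proof. by rewrite /=; case: chebyshev. Qed.

Lemma chebyshev_pell n : (chebyshev n).1 * (chebyshev n).1
  + (1 - 'X^2) * ((chebyshev n).2 * (chebyshev n).2) = 1.
Proof.
elim: n => [|n IH]; first by rewrite /= !mulr0 addr0 mulr1.
rewrite chebyshevS /= -[RHS]IH.
by set t := (chebyshev n).1; set u := (chebyshev n).2; ring.
Qed.

Lemma chebyshev_rec n : (2 : R) *: ('X * (chebyshev n.+1).1) =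
  (chebyshev n.+2).1 + (chebyshev n).1.
Proof.
rewrite !chebyshevS /= -mul_polyC.
rewrite (_ : 2%:P = 2); last by rewrite rmorph_nat.
by set t := (chebyshev n).1; set u := (chebyshev n).2; ring.
Qed.

Lemma size_chebyshev n : (size (chebyshev n).1 <= n.+1)%N.
Proof.
suff: (size (chebyshev n).1 <= n.+1)%N /\ (size (chebyshev n.+1).1 <= n.+2)%N by case.
elim: n => [|n [IH1 IH2]].
  by rewrite /= mulr0 subr0 mulr1 size_poly1 size_polyX.
split=> //; have -> : (chebyshev n.+2).1 =
    (2 : R) *: ('X * (chebyshev n.+1).1) - (chebyshev n).1.
  by rewrite chebyshev_rec addrK.
rewrite (leq_trans (size_polyD _ _)) // geq_max size_polyN; apply/andP; split.
  apply: leq_trans (size_scale_leq _ _) _; apply: leq_trans (size_polyMleq _ _) _.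
  by rewrite size_polyX add2n.
by apply: leq_trans IH1 _; rewrite ltnS leqW.
Qed.

Lemma expR_cosh_le (s : R) : 0 <= s <= 2^-1 ->
  (expR s + (expR s)^-1) / 2 <= expR (2 * s ^+ 2).
Proof.
move=> /andP[s0 s1]; apply: le_trans (expR_ge1Dx _).
have [y yE] : exists y, y = expR s by eexists.
have y1 : 1 <= y by rewrite yE -expR0 ler_expR.
have y0 : 0 < y by lra.
have yV : 1 - s <= y^-1 by rewrite yE -expRN; have := expR_ge1Dx (- s); lra.
have ys : y * (1 - s) <= 1.
  by move: yV; rewrite -(ler_pM2l y0) mulfV // gt_eqF.
have ys2 : y - 1 <= 2 * s by nra.
rewrite -yE ler_pdivrMr // -(ler_pM2l y0) mulrDr mulfV ?gt_eqF //.
have h : (y - 1) ^+ 2 <= (2 * s) ^+ 2 by rewrite ler_pXn2r // nnegrE; lra.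
have : (2 * s) ^+ 2 <= y * (2 * s) ^+ 2 by rewrite ler_peMl // exprn_ge0 //; lra.
nra.
Qed.

End Chebyshev.

Section VaropoulosCarne.
Variables (R : realType) (G : groupType) (st : seq (R * G)).
Hypotheses (pst : pdist st) (sst : symmetric_steps st).
Local Notation A := (letters st).
Local Notation "'T_ k" := (chebyshev R k).1 (at level 8, k at level 2).

Lemma gram_rcons (K : G -> R) u a x :
  gram K (u ++ [:: (a, x)]) (u ++ [:: (a, x)]) = gram K u u
    + a * mean u (fun y => K (y^-1 * x)%g) + a * mean u (fun y => K (x^-1 * y)%g)
    + a ^+ 2 * K 1%g.
Proof.
rewrite {1}/gram mean_cat mean_cons mean_nil /= mean_cat mean_cons mean_nil /=.
rewrite mulVg -meanZ -meanD !addr0 mulrDr addrA expr2 mulrA; congr (_ + _ + _).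
apply: eq_mean => y; by rewrite mean_cat mean_cons mean_nil addr0.
Qed.

Lemma poly_walk1 F : poly_walk st 1 F = F 1%g.
Proof. by rewrite -[1]/(1%:P) poly_walkC mul1r. Qed.

Let at_ x : G -> R := fun g => (g == x)%:R.

(** By the identity [T^2 + (1 - X^2) U^2 = 1], a Chebyshev polynomial of the
    convolution operator maps the unit mass at the identity to a vector of norm
    at most one. *)
Lemma chebyshev_coef_le k x : `|poly_walk st 'T_k (at_ x)| <= 1.
Proof.
have pd := @posdef_dirac R G.
have n1 : poly_walk st ('T_k * 'T_k) (fun g => (g == 1%g)%:R) <= 1.
  have := poly_walk_contract pst sst (chebyshev R k).2 pd.
  have : poly_walk st ('T_k * 'T_k + (1 - 'X^2) *
      ((chebyshev R k).2 * (chebyshev R k).2)) (fun g => (g == 1%g)%:R) = 1.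
    by rewrite chebyshev_pell poly_walk1 eqxx.
  by rewrite poly_walkD; lra.
set a := poly_walk _ _ _; rewrite -(expr_le1 (n := 2)) // real_normK ?num_real //.
apply: le_trans n1.
have := pd (poly_law st 'T_k ++ [:: (- a, x)]).
rewrite gram_rcons gram_poly_law // eqxx mulr1.
have -> : mean (poly_law st 'T_k) (fun y => ((x^-1 * y)%g == 1%g)%:R) = a.
  rewrite mean_poly_law; apply: eq_poly_walk => y.
  by rewrite mulg_eq1 (inj_eq invg_inj) eq_sym.
have -> : mean (poly_law st 'T_k) (fun y => ((y^-1 * x)%g == 1%g)%:R) = a.
  rewrite mean_poly_law; apply: eq_poly_walk => y.
  by rewrite mulg_eq1 (inj_eq invg_inj).
lra.
Qed.

Lemma walk_at_short n x : (n < wlen A x)%N -> walk st n (at_ x) = 0.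
Proof.
move=> nx; rewrite -(walk_const pst n 0); apply: eq_walk_word => y yn.
by rewrite /at_; case: eqP => // e; rewrite e in yn; have := wlen_le yn; rewrite leqNgt nx.
Qed.

Lemma chebyshev_coef0 k x : (k < wlen A x)%N -> poly_walk st 'T_k (at_ x) = 0.
Proof.
move=> kx; rewrite /poly_walk big1 // => i _; rewrite walk_at_short ?mulr0 //.
apply: leq_ltn_trans kx; rewrite -ltnS; exact: leq_trans (ltn_ord i) (size_chebyshev R k).
Qed.

(** Multiplying a Chebyshev polynomial by the indeterminate moves its index by
    one in a uniform direction, so ['X^n] is the average of the polynomials over
    the simple random walk on the line; its exponential moments are tracked
    here, [z] being the exponential of the dual variable. *)
Lemma chebyshev_power (z : R) n k x : 1 <= z ->
  `|poly_walk st ('X^n * 'T_k) (at_ x)| <=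
  ((z + z^-1) / 2) ^+ n * (z ^- wlen A x * (z ^+ k + z ^- k)).
Proof.
move=> z1; have z0 : 0 < z by lra.
elim: n k => [|n IH] k.
  rewrite expr0 !mul1r; have [kx|kx] := ltnP k (wlen A x).
    by rewrite chebyshev_coef0 // normr0 mulr_ge0 ?addr_ge0 ?invr_ge0 ?exprn_ge0 // ltW.
  apply: le_trans (chebyshev_coef_le k x) _.
  apply: le_trans (_ : z ^- wlen A x * z ^+ k <= _).
    by rewrite mulrC ler_pdivlMr ?exprn_gt0 // mul1r ler_weXn2l.
  by rewrite ler_wpM2l ?lerDl ?invr_ge0 ?exprn_ge0 // ltW.
case: k => [|k].
  rewrite /= mulr1 exprSr; have := IH 1%N.
  rewrite (_ : 'T_1 = 'X); last by rewrite /= mulr0 subr0 mulr1.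
  move/le_trans; apply; rewrite le_eqVlt; apply/orP; left; apply/eqP.
  rewrite !expr1 expr0 invr1 exprSr; field.
  by rewrite ?expf_neq0 ?gt_eqF.
have -> : 'X^(n.+1) * 'T_(k.+1) = 2^-1 *: ('X^n * 'T_(k.+2) + 'X^n * 'T_k) :> {poly R}.
  rewrite -mulrDr -chebyshev_rec -scalerAr scalerA mulVf ?gt_eqF //.
  by rewrite scale1r exprSr mulrA.
rewrite poly_walkZ poly_walkD normrM ger0_norm ?invr_ge0 //.
apply: le_trans (_ : 2^-1 * (`|poly_walk st ('X^n * 'T_(k.+2)) (at_ x)|
    + `|poly_walk st ('X^n * 'T_k) (at_ x)|) <= _).
  by rewrite ler_wpM2l ?invr_ge0 ?ler_normD.
apply: le_trans (_ : 2^-1 * (_ + _) <= _).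
  by apply: ler_wpM2l; [rewrite invr_ge0|exact: lerD (IH _) (IH _)].
rewrite le_eqVlt; apply/orP; left; apply/eqP; rewrite !exprS; field.
by rewrite ?expf_neq0 ?gt_eqF.
Qed.

Theorem varopoulos_carne n x : (1 <= n)%N ->
  walk st n (fun g => (g == x)%:R) <=
  2 * expR (- ((wlen A x)%:R ^+ 2 / (8 * n%:R))).
Proof.
move=> n1; have [xn|nx] := leqP (wlen A x) n; last first.
  by rewrite walk_at_short // mulr_ge0 ?expR_ge0.
have nR : 1 <= n%:R :> R by rewrite ler1n.
pose r : R := (wlen A x)%:R; have rn : r <= n%:R by rewrite ler_nat.
have r0 : 0 <= r by exact: ler0n.
have [s sE] : exists s, s = r / (4 * n%:R) by eexists.
have s0 : 0 <= s by rewrite sE divr_ge0 //; lra.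
have s1 : s <= 2^-1 by rewrite sE ler_pdivrMr; lra.
have z1 : 1 <= expR s by rewrite -expR0 ler_expR.
have := chebyshev_power n 0 x z1; rewrite /= mulr1 poly_walkXn expr0 invr1.
move=> h; apply: le_trans (ler_norm _) _; apply: le_trans h _.
have : ((expR s + (expR s)^-1) / 2) ^+ n <= expR (2 * s ^+ 2) ^+ n.
  apply: lerXn2r; last by apply: expR_cosh_le; rewrite s0 s1.
    by rewrite nnegrE divr_ge0 ?addr_ge0 ?invr_ge0 ?expR_ge0.
  by rewrite nnegrE expR_ge0.
rewrite -expRM_natl -exprVn -expRN -expRM_natl => h.
apply: le_trans (_ : expR (n%:R * (2 * s ^+ 2)) * (expR (r * - s) * (1 + 1)) <= _).
  by apply: ler_wpM2r h; rewrite mulr_ge0 ?expR_ge0.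
rewrite mulrA -expRD mulrC ler_pM2l // ler_expR le_eqVlt; apply/orP; left; apply/eqP.
by rewrite sE; field; rewrite gt_eqF //; lra.
Qed.

End VaropoulosCarne.

(** * The inverted orbit of a word *)

Section Sites.
Variables (R : realType) (Gam : groupType) (S : choiceType).
Variables (act : right_action Gam S) (o : S).
Implicit Types (s t : S) (g : Gam) (y z : seq Gam).

Lemma ractK s g : act (act s g) (g^-1)%g = s.
Proof. by rewrite -ractM mulgV ract1. Qed.

Lemma ractKV s g : act (act s (g^-1)%g) g = s.
Proof. by rewrite -ractM mulVg ract1. Qed.

Lemma ract_inj g : injective (fun s => act s g).
Proof. by apply: (can_inj (g := fun s => act s (g^-1)%g)) => s; exact: ractK. Qed.

(** The sites [o.h^-1] for the prefix products [h] of the word; this is where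
    the lamps touched by the walk are. *)
Fixpoint sites y : seq S :=
  o :: (if y is g :: z then [seq act s (g^-1)%g | s <- sites z] else [::]).

Fixpoint avoids s y :=
  if y is g :: z then (act s g != o) && avoids (act s g) z else true.

(** The number of lamp factors that a switch-walk-switch walk following the word
    multiplies at [s]: one before and one after each move. *)
Fixpoint switches s y : nat :=
  if y is g :: z then ((s == o) + (act s g == o) + switches (act s g) z)%N else 0.

Local Notation visits s y := (count_mem s (sites y)).

Lemma mem_shift s g (l : seq S) :
  (s \in [seq act t (g^-1)%g | t <- l]) = (act s g \in l).
Proof.
apply/mapP/idP => [[t tl ->]|sl]; first by rewrite ractKV.
by exists (act s g); rewrite ?ractK.
Qed.

Lemma mem_sites_cons s g y :
  (s \in sites (g :: y)) = (s == o) || (act s g \in sites y).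
Proof. by rewrite /= inE mem_shift. Qed.

Lemma sites_o y : o \in sites y.
Proof. by case: y => *; rewrite mem_head. Qed.

Lemma avoids_cons s g y : avoids s (g :: y) = (act s g \notin sites y).
Proof.
elim: y s g => [|h y IH] s g; first by rewrite /= andbT inE.
change ((act s g != o) && avoids (act s g) (h :: y) = (act s g \notin sites (h :: y))).
by rewrite IH mem_sites_cons negb_or.
Qed.

Lemma avoids_cat s y z : avoids s (y ++ z) -> avoids s y.
Proof. by elim: y s => [//|g y IH] s /= /andP[-> /IH]. Qed.

Lemma visits_nil s : visits s [::] = (s == o).
Proof. by rewrite /= addn0 eq_sym. Qed.

Lemma visits_cons s g y : visits s (g :: y) = ((s == o) + visits (act s g) y)%N.
Proof.
rewrite /= eq_sym count_map; congr addn; apply: eq_count => t /=.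
by apply/eqP/eqP => [<-|->]; rewrite ?ractKV ?ractK.
Qed.

Lemma size_sites y : size (sites y) = (size y).+1.
Proof. by elim: y => [|g y IH] //=; rewrite size_map IH. Qed.

Lemma switches_visits s y :
  (switches s y + (s == o) + (act s (gprod y) == o) = 2 * visits s y)%N.
Proof.
elim: y s => [|g y IH] s; first by rewrite visits_nil gprod_nil ract1 /=; lia.
have := IH (act s g); rewrite visits_cons gprod_cons ractM /=; lia.
Qed.

Lemma visits_le_switches s y : (0 < size y)%N -> (visits s y <= switches s y)%N.
Proof.
elim: y s => [//|g [|h y] IH] s _; rewrite visits_cons.
  by rewrite visits_nil /= addn0.
apply: leq_trans (_ : (s == o) + switches (act s g) (h :: y) <= _)%N.
  by rewrite leq_add2l IH.
by rewrite -[switches s _]/((s == o) + (act s g == o) + switches (act s g) (h :: y))%N; lia.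
Qed.

Lemma sum_undup_sites (F : S -> R) g y :
  \sum_(s <- undup (sites (g :: y))) F s =
  (if act o g \in sites y then 0 else F o) +
  \sum_(s <- undup (sites y)) F (act s (g^-1)%g).
Proof.
have -> : undup (sites (g :: y)) =
    if act o g \in sites y then undup [seq act s (g^-1)%g | s <- sites y]
    else o :: undup [seq act s (g^-1)%g | s <- sites y].
  by rewrite [sites _]/= [undup _]/= mem_shift.
rewrite undup_map_inj; last exact: ract_inj.
by case: ifP => _; rewrite ?big_cons big_map ?add0r.
Qed.

Lemma size_undup_sites_cons g y :
  size (undup (sites (g :: y))) = (avoids o (g :: y) + size (undup (sites y)))%N.
Proof.
rewrite avoids_cons [sites _]/= [undup _]/= mem_shift.
rewrite undup_map_inj; last exact: ract_inj.
by case: ifP => _; rewrite /= size_map.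
Qed.

Lemma sum_visits (F : S -> R) y :
  \sum_(s <- undup (sites y)) (visits s y)%:R * F s = \sum_(s <- sites y) F s.
Proof.
rewrite -[RHS]big_undup_iterop_count; apply: eq_bigr => s _.
by rewrite Monoid.iteropE iter_addr addr0 mulr_natl.
Qed.

Lemma sum_visits_sites_cons g y :
  (\sum_(s <- sites (g :: y)) visits s (g :: y) <=
   2 * visits o (g :: y) + \sum_(s <- sites y) visits s y)%N.
Proof.
have -> : sites (g :: y) = o :: [seq act s (g^-1)%g | s <- sites y] by [].
rewrite big_cons big_map mulSn mul1n -addnA leq_add2l.
under eq_bigr => s _ do rewrite -/(sites (g :: y)) visits_cons ractKV.
rewrite big_split leq_add2r -/(sites (g :: y)) visits_cons eqxx.
apply: leq_trans (leq_addl _ _).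
rewrite -sum1_count [leqRHS]big_mkcond; apply: leq_sum => s _.
case: ifP => [_|/negbT ns]; first by case: (_ == o).
case: eqP => // e; move: ns; rewrite /= -e ractKV eqxx.
done.
Qed.

Variable st : seq (R * Gam).
Hypothesis pst : pdist st.
Local Notation E n F := (mean (paths st n) F).

Definition escape n : R := E n (fun y => (avoids o y)%:R).

Lemma escape0 : escape 0 = 1. Proof. by rewrite /escape mean_paths0. Qed.

Lemma escape_anti m n : (m <= n)%N -> escape n <= escape m.
Proof.
move=> /subnKC <-; rewrite /escape mean_paths_cat; have p i := pdist_paths i pst.
apply: (ler_mean (p m)) => a _.
apply: mean_le_const => // b _; rewrite ler_nat.
by case: (boolP (avoids o (_ ++ _))) => // /avoids_cat ->.
Qed.

Lemma escape_le1 n : escape n <= 1.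
Proof. by rewrite -escape0 escape_anti. Qed.

(** A site is counted at its last visit, after which the walk escapes. *)
Lemma mean_size_sites n :
  E n (fun y => (size (undup (sites y)))%:R) = \sum_(k < n.+1) escape k.
Proof.
elim: n => [|n IH]; first by rewrite mean_paths0 big_ord1 escape0.
rewrite big_ord_recr /= -IH addrC /escape !mean_pathsS.
have p := pdist_paths n pst.
rewrite -[X in _ = _ + X](mean_const pst) -meanD.
apply: eq_mean => g; rewrite -meanD; apply: eq_mean => y.
by rewrite -natrD -size_undup_sites_cons.
Qed.

(** Decomposing at the last visit bounds the expected number of visits by the
    inverse of the escape probability. *)
Lemma escape_visits N n s : (n <= N)%N ->
  escape N * E n (fun y => (visits s y)%:R) <= E n (fun y => (s \in sites y)%:R).
Proof.
elim: n s => [|n IH] s nN.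
  rewrite !mean_paths0 visits_nil inE ler_piMl ?ler0n //; exact: escape_le1.
have p i := pdist_paths i pst.
have step : escape N * mean st (fun g => E n (fun y => (visits (act s g) y)%:R)) <=
    mean st (fun g => E n (fun y => (act s g \in sites y)%:R)).
  by rewrite -meanZ; apply: ler_mean => // a _; apply: IH; exact: ltnW.
have -> : E n.+1 (fun y => (visits s y)%:R) =
    (s == o)%:R + mean st (fun g => E n (fun y => (visits (act s g) y)%:R)).
  rewrite mean_pathsS -{1}(mean_const pst (s == o)%:R) -meanD; apply: eq_mean => g.
  rewrite -{1}(mean_const (p n) (s == o)%:R) -meanD; apply: eq_mean => y.
  by rewrite visits_cons natrD.
rewrite mulrDr; have [so|so] := eqVneq s o; last first.
  rewrite mulr0 add0r; apply: le_trans step _; rewrite mean_pathsS.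
  apply: ler_mean => // a _; apply: ler_mean => // b _.
  by rewrite mem_sites_cons (negbTE so).
rewrite so in step *; rewrite mulr1; apply: le_trans (lerD (escape_anti nN) step) _.
rewrite /escape !mean_pathsS -meanD; apply: ler_mean => // a _.
rewrite -meanD; apply: ler_mean => // b _.
by rewrite avoids_cons mem_sites_cons eqxx; case: (_ \in _); rewrite ?add0r ?addr0.
Qed.

Lemma escape_sum_visits N n : (n <= N)%N ->
  escape N * E n (fun y => (\sum_(s <- sites y) visits s y)%N%:R) <= 2 * n.+1%:R.
Proof.
have p i := pdist_paths i pst.
have e0 k : 0 <= escape k by apply: mean_ge0 => // y; exact: ler0n.
elim: n => [|n IH] nN.
  rewrite mean_paths0 big_seq1 visits_nil eqxx mulr1 mulr1.
  by apply: le_trans (escape_le1 N) _; rewrite ler1n.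
apply: le_trans (_ : escape N * (2 * E n.+1 (fun y => (visits o y)%:R) +
    E n (fun y => (\sum_(s <- sites y) visits s y)%N%:R)) <= _).
  apply: ler_wpM2l => //; rewrite -meanZ !mean_pathsS.
  rewrite -[X in _ <= _ + X](mean_const pst) -meanD; apply: ler_mean => // a _.
  rewrite -meanD; apply: ler_mean => // b _.
  by rewrite -natrM -natrD ler_nat; exact: sum_visits_sites_cons.
rewrite mulrDr -[n.+2%:R]natr1 mulrDr addrC; apply: lerD; first by apply: IH; exact: ltnW.
rewrite mulrCA ler_pM2l //; apply: le_trans (escape_visits o nN) _.
by apply: mean_le_const => // a _; rewrite lern1; case: (_ \in _).
Qed.

End Sites.

Section OrbitBridge.
Variables (R : realType) (Gam : groupType) (S : choiceType).
Variables (act : right_action Gam S) (mu : step_dist R Gam) (o : S).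
Local Notation sites := (sites act o).
Local Notation E n F := (mean (paths (step_list mu) n) F).

Lemma expect_paths n (F : seq Gam -> R) :
  expect (iid (@step_weight R Gam mu) (n := n))
    (fun w => F [seq step_val x | x <- w]) = E n F.
Proof.
rewrite (expect_iid _ n (fun w => F [seq step_val x | x <- w])).
rewrite -(mean_paths_map (@step_val R Gam mu)) -map_comp.
by [].
Qed.

Lemma avoidsP s y :
  reflect (forall k, (k < size y)%N -> act s (gprod (take k.+1 y)) != o)
          (avoids act o s y).
Proof.
elim: y s => [|g y IH] s; first by apply: ReflectT => k.
apply: (iffP andP) => [[sg /IH ay] [|k] /= ky|ay].
- by rewrite take0 gprod_cons gprod_nil mulg1.
- by rewrite gprod_cons ractM; exact: ay.
split; first by have := ay 0 isT; rewrite /= take0 gprod_cons gprod_nil mulg1.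
by apply/IH => k ky; have := ay k.+1 ky; rewrite /= gprod_cons ractM.
Qed.

Lemma walk_posE n (w : n.-tuple (finsupp mu)) k :
  walk_pos w k = gprod (take k [seq step_val x | x <- w]).
Proof. by rewrite /walk_pos /position map_take. Qed.

Lemma no_return_probE n : no_return_prob act mu o n = escape act o (step_list mu) n.
Proof.
rewrite /no_return_prob prob_expect /escape -expect_paths; apply: eq_bigr => w _.
congr (_ * (nat_of_bool _)%:R); rewrite inE; apply/forallP/avoidsP => h k.
  by rewrite size_map size_tuple => kn; have := h (Ordinal kn); rewrite walk_posE.
by rewrite walk_posE; apply: h; rewrite size_map size_tuple.
Qed.

Lemma sitesE y :
  [seq act o ((gprod (take k y))^-1)%g | k <- iota 0 (size y).+1] = sites y.
Proof.
elim: y => [|g y IH]; first by rewrite /= gprod_nil invg1 ract1.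
transitivity (o :: [seq act s (g^-1)%g | s <- sites y]); last by [].
rewrite -IH -[iota 0 (size (g :: y)).+1]/(0%N :: iota (1 + 0) (size y).+1) map_cons.
congr (_ :: _); first by rewrite take0 gprod_nil invg1 ract1.
rewrite iotaDl -!map_comp; apply: eq_map => k /=.
by rewrite gprod_cons invgM ractM.
Qed.

Definition site_set y : {fset S} := [fset x in sites y]%fset.

Lemma inverted_rangeE n (w : n.-tuple (finsupp mu)) :
  inverted_range act o w = site_set [seq step_val x | x <- w].
Proof.
rewrite /inverted_range (_ : [seq _ | k <- _] = sites [seq step_val x | x <- w]) //.
rewrite -sitesE size_map size_tuple; apply: eq_map => k.
by rewrite walk_posE.
Qed.

Definition range_law n y : R := E n (fun z => (site_set z == site_set y)%:R).

Lemma range_entropyE n :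
  range_entropy act mu o n = E n (fun y => - ln (range_law n y)).
Proof.
rewrite -expect_paths /range_entropy /entropy.
pose u := [seq (iid (@step_weight R Gam mu) w, inverted_range act o w) |
  w <- enum {: n.-tuple (finsupp mu)}].
have mu_ F : mean u F =
    expect (iid (@step_weight R Gam mu) (n := n)) (fun w => F (inverted_range act o w)).
  by rewrite /mean big_map big_enum.
have us : [seq a.2 | a <- u] = [seq inverted_range act o w | w : n.-tuple (finsupp mu)].
  by rewrite /u -map_comp.
have pE x : prob (iid (@step_weight R Gam mu) (n := n))
    [pred w | inverted_range act o w == x] = mean u (fun y => (y == x)%:R).
  by rewrite mu_ prob_expect.
under eq_bigr do rewrite pE.
rewrite -us -(mean_points u (fun x => ln (mean u (fun y => (y == x)%:R)))) mu_.
rewrite /expect -sumrN; apply: eq_bigr => w _; rewrite mulrN; congr (- (_ * ln _)).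
rewrite mu_ /range_law -expect_paths; apply: eq_bigr => v _.
by rewrite !inverted_rangeE.
Qed.

End OrbitBridge.

(** * Geometry of the permutation wreath product *)

Section Wreath.
Variables (Lam Gam : groupType) (S : choiceType) (act : right_action Gam S) (o : S).
Variables (AL : set Lam) (AG : set Gam).
Local Notation W := (wreath Lam act).
Local Notation sites := (sites act o).
Local Notation lamp l := (@lamp_at Lam Gam S act o l).
Local Notation move g := (@walk_by Lam Gam S act g).

Definition switch_move_switch (t : Lam * Gam * Lam) : W :=
  (lamp t.1.1 * move t.1.2 * lamp t.2)%g.

Definition switch_moves : set W :=
  [set x | exists t, [/\ AL t.1.1, AG t.1.2, AL t.2 & x = switch_move_switch t]]%classic.

Lemma wreathP (x y : W) : (forall s, lamps x s = lamps y s) -> cursor x = cursor y -> x = y.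
Proof. by case: x y => [f g] [f' g'] /= /funext -> ->. Qed.

Lemma lampsM (x y : W) s :
  lamps (x * y)%g s = (lamps x s * lamps y (act s (cursor x)))%g.
Proof. by []. Qed.

Lemma cursorM (x y : W) : cursor (x * y)%g = (cursor x * cursor y)%g.
Proof. by []. Qed.

Definition lamp_if (b : bool) (l : Lam) : Lam := if b then l else 1%g.

Lemma lamps_step t (x : W) s :
  lamps (switch_move_switch t * x)%g s =
  (lamp_if (s == o) t.1.1 * lamp_if (act s t.1.2 == o) t.2 * lamps x (act s t.1.2))%g.
Proof. by rewrite !lampsM /= !(mul1g, mulg1). Qed.

Lemma cursor_step t (x : W) : cursor (switch_move_switch t * x)%g = (t.1.2 * cursor x)%g.
Proof. by rewrite !cursorM /= !(mul1g, mulg1). Qed.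

Lemma lampM l l' : (lamp l * lamp l')%g = lamp (l * l')%g.
Proof.
apply: wreathP => [s|]; last by rewrite cursorM mul1g.
by rewrite lampsM /= ract1; case: ifP; rewrite ?mulg1.
Qed.

Lemma lamp1 : lamp 1%g = 1%g.
Proof. by apply: wreathP => // s /=; case: ifP. Qed.

Lemma moveM g g' : (move g * move g')%g = move (g * g')%g.
Proof. by apply: wreathP => [s|] //; rewrite lampsM /= mulg1. Qed.

Lemma move1 : move 1%g = 1%g.
Proof. by []. Qed.

(** A generator changes lamps only at the sites of the cursor before and after
    its move. *)
Lemma word_tour x m : word_of_length switch_moves x m ->
  exists z, [/\ size z = m, forall g, g \in z -> AG g, gprod z = cursor x &
    forall s, lamps x s <> 1%g -> s \in sites z].
Proof.
elim: m x => [|m IH] x [w [sw wA <-]].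
  rewrite (size0nil sw) gprod_nil; exists [::]; split=> //; exact: gprod_nil.
case: w sw wA => [//|a w] [sw] wA; have [t [_ Ag _ ->]] := wA a (mem_head _ _).
have [|z [sz zA gz lz]] := IH (gprod w).
  by exists w; split=> // b bw; apply: wA; rewrite inE bw orbT.
exists (t.1.2 :: z); split=> [|g||s]; first by rewrite /= sz.
- by rewrite inE => /predU1P[->|/zA].
- by rewrite !gprod_cons cursor_step gz.
rewrite gprod_cons lamps_step mem_sites_cons; case: eqP => //= _.
rewrite mul1g; case: (eqVneq (act s t.1.2) o) => [->|_]; first by rewrite sites_o.
by rewrite mul1g => /lz.
Qed.

Lemma mem_sites_catl s y z : s \in sites y -> s \in sites (y ++ z).
Proof.
elim: y s => [|g y IH] s; first by rewrite inE => /eqP ->; exact: sites_o.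
by rewrite cat_cons !mem_sites_cons => /orP[->//|/IH ->]; rewrite orbT.
Qed.

Lemma mem_sites_catr s y z : act s (gprod y) \in sites z -> s \in sites (y ++ z).
Proof.
elim: y s => [|g y IH] s; first by rewrite gprod_nil ract1.
by rewrite cat_cons gprod_cons mem_sites_cons ractM => /IH ->; rewrite orbT.
Qed.

(** Two tours with the same endpoint combine into one: go along the first, come
    back, and go along the second. *)
Lemma join_tours x1 x2 m1 m2 : (forall g, AG g -> AG (g^-1)%g) ->
  word_of_length switch_moves x1 m1 -> word_of_length switch_moves x2 m2 ->
  cursor x1 = cursor x2 ->
  exists z, [/\ size z = (2 * m1 + m2)%N, forall g, g \in z -> AG g,
    gprod z = cursor x1 &
    forall s, lamps x1 s <> 1%g \/ lamps x2 s <> 1%g -> s \in sites z].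
Proof.
move=> AV /word_tour[z1 [s1 A1 g1 l1]] /word_tour[z2 [s2 A2 g2 l2]] e.
exists (z1 ++ rev [seq (g^-1)%g | g <- z1] ++ z2); split.
- by rewrite !size_cat size_rev size_map s1 s2; lia.
- move=> g; rewrite !mem_cat mem_rev => /or3P[/A1//|/mapP[h /A1 hA ->]|/A2//].
  exact: AV.
- by rewrite !gprod_cat gprod_rev_inv mulVKg g2 e.
move=> s [/l1|/l2] h; first exact: mem_sites_catl.
apply: mem_sites_catr; apply: mem_sites_catr.
by rewrite gprod_rev_inv -ractM mulgV ract1.
Qed.

Hypothesis AGV : forall g, AG g -> AG (g^-1)%g.
Hypothesis ALV : forall l, AL l -> AL (l^-1)%g.
Hypothesis fullL : forall l, reachable AL l.

Lemma wlen_lamp_if b l : AL l -> (wlen AL (lamp_if b l) <= b)%N.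
Proof.
by case: b => /= [Al|_]; rewrite ?wlen1 //; exact: (wlen_le (word_letter Al)).
Qed.

Lemma sum_eq_le1 (l : seq S) (s0 : S) : uniq l -> (\sum_(s <- l) (s == s0) <= 1)%N.
Proof.
move=> ul; rewrite (_ : \sum_(s <- l) _ = count_mem s0 l)%N.
  by rewrite count_uniq_mem //; case: (_ \in _).
by rewrite -sum1_count [RHS]big_mkcond; apply: eq_bigr => s _ /=; case: (_ == _).
Qed.

(** One generator changes two lamp factors, each by one letter. *)
Lemma sum_wlen_lamps x m (l : seq S) : word_of_length switch_moves x m -> uniq l ->
  (\sum_(s <- l) wlen AL (lamps x s) <= 2 * m)%N.
Proof.
move=> [w [<- wA <-]]; elim: w wA l => [|a w IH] wA l ul.
  by rewrite gprod_nil big1 // => s _; rewrite wlen1.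
have [t [Al _ Al' at_]] := wA a (mem_head _ _).
rewrite gprod_cons at_ [size _]/= mulnS; pose g := t.1.2.
apply: leq_trans (_ : \sum_(s <- l) ((s == o) + (act s g == o) +
    wlen AL (lamps (gprod w) (act s g))) <= _)%N.
  apply: leq_sum => s _; rewrite lamps_step; apply: leq_trans (wlenM _ _) _ => //.
  rewrite leq_add2r; apply: leq_trans (wlenM _ _) _ => //.
  by apply: leq_add; exact: wlen_lamp_if.
have ug : uniq [seq act s g | s <- l] by rewrite map_inj_uniq //; exact: ract_inj.
rewrite !big_split /= -[2%N]/(1 + 1)%N; apply: leq_add.
  apply: leq_add; first exact: sum_eq_le1.
  by have := sum_eq_le1 o ug; rewrite big_map.
have := IH _ _ ug; rewrite big_map; apply.
by move=> b bw; apply: wA; rewrite inE bw orbT.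
Qed.

Variables (a0 : Lam) (g0 : Gam).
Hypotheses (Aa0 : AL a0) (Ag0 : AG g0).

Definition lamp_conj (u : W) : W := (lamp a0 * u * lamp (a0^-1)%g)%g.

Lemma lamp_conjM u v : lamp_conj (u * v)%g = (lamp_conj u * lamp_conj v)%g.
Proof.
have e : (lamp (a0^-1)%g * lamp a0)%g = 1%g by rewrite lampM mulVg lamp1.
by rewrite /lamp_conj !mulgA -[(_ * lamp (a0^-1)%g * lamp a0)%g]mulgA e mulg1.
Qed.

Lemma switch_moves_gen l g l' : AL l -> AG g -> AL l' ->
  switch_moves (lamp l * move g * lamp l')%g.
Proof. by move=> Al Ag Al'; exists (l, g, l'); split. Qed.

(** Conjugation by a fixed lamp turns moves of the cursor into generators. *)
Lemma word_conj_move g : AG g -> word_of_length switch_moves (lamp_conj (move g)) 1.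
Proof. by move=> Ag; apply/word_letter/switch_moves_gen => //; exact: ALV. Qed.

(** Stepping to a neighbour and back multiplies the lamp by two letters. *)
Lemma word_lamp_pair l l' : AL l -> AL l' ->
  word_of_length switch_moves (lamp (l * l')%g) 2.
Proof.
move=> Al Al'; have -> : lamp (l * l')%g =
    ((lamp l * move g0 * lamp (a0^-1)%g) * (lamp a0 * move (g0^-1)%g * lamp l'))%g.
  have e : (lamp (a0^-1)%g * lamp a0)%g = 1%g by rewrite lampM mulVg lamp1.
  have e' : (move g0 * move (g0^-1)%g)%g = 1%g by rewrite moveM mulgV.
  rewrite !mulgA -[(_ * lamp (a0^-1)%g * lamp a0)%g]mulgA e mulg1.
  by rewrite -[(_ * move g0 * _)%g]mulgA e' mulg1 lampM.
apply: (@wordM _ _ _ _ 1 1); apply/word_letter/switch_moves_gen => //;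
  [exact: ALV|exact: AGV].
Qed.

Lemma word_lamp_even x k : word_of_length AL x (k + k) ->
  word_of_length switch_moves (lamp x) (k + k).
Proof.
move=> /even_word_pairs[w [<- wA <-]]; elim: w wA => [|y w IH] wA.
  by rewrite gprod_nil lamp1; exact: word1.
rewrite gprod_cons -lampM /= addSn addnS -add2n; apply: wordM.
  have [s [ss sA <-]] := wA y (mem_head _ _).
  case: s ss sA => [|l [|l' [|]]] //= _ sA; rewrite !gprod_cons gprod_nil mulg1.
  by apply: word_lamp_pair; apply: sA; rewrite !inE eqxx ?orbT.
by apply: IH => z zw; apply: wA; rewrite inE zw orbT.
Qed.

Variable K : nat.
Hypothesis evenK : forall x, even_word AL x ->
  exists2 k, (k <= K * wlen AL x)%N & word_of_length AL x (k + k).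

Lemma word_conj_lamp x : even_word AL x ->
  exists2 k, (k <= (2 * K + 2) * wlen AL x)%N &
    word_of_length switch_moves (lamp_conj (lamp x)) k.
Proof.
move=> ex; rewrite /lamp_conj !lampM; have [->|x1] := eqVneq x 1%g.
  by exists 0; rewrite // mulg1 mulgV lamp1; exact: word1.
have [k kK wx] := evenK ex; exists (k.+1 + k.+1)%N; last first.
  apply: word_lamp_even; rewrite addSn addnS -addn1 -add1n.
  apply: wordM (word_letter (ALV Aa0)); exact: wordM (word_letter Aa0) wx.
have : (0 < wlen AL x)%N.
  by rewrite lt0n; apply: contraNneq x1 => /(wlen_eq0 (fullL x)) ->.
by nia.
Qed.

Section Cost.
Variable R : realType.

Let len x : R := (wlen AL x)%:R.

(** A configuration of even lamps on the sites of a tour is written while the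
    tour is run, each lamp at the last visit of its site. *)
Lemma word_tour_lamps z (f : S -> Lam) : (forall g, g \in z -> AG g) ->
  (forall s, even_word AL (f s)) -> (forall s, f s <> 1%g -> s \in sites z) ->
  exists2 k, (k%:R <= (size z)%:R + (2 * K + 2)%:R *
      \sum_(s <- undup (sites z)) len (f s)) &
    word_of_length switch_moves (lamp_conj (Wreath f (gprod z))) k.
Proof.
elim: z f => [|g z IH] f zA ef fz.
  have [k kK wk] := word_conj_lamp (ef o); exists k.
    by rewrite /= big_seq1 add0r -natrM ler_nat.
  rewrite gprod_nil (_ : Wreath f 1%g = lamp (f o)) //; apply: wreathP => // s /=.
  case: eqP => [->//|so]; apply: contrapT => /fz.
  by rewrite inE => /eqP.
pose seen := act o g \in sites z.
pose x := lamp_if (~~ seen) (f o).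
pose f' t := if ~~ seen && (t == act o g) then 1%g else f (act t (g^-1)%g).
have fE : Wreath f (gprod (g :: z)) = (lamp x * move g * Wreath f' (gprod z))%g.
  apply: wreathP => [s|]; last by rewrite gprod_cons !cursorM mul1g.
  rewrite !lampsM /= !mul1g mulg1 /f' ractK (inj_eq (@ract_inj _ _ act g)) /x.
  by case: eqP => [->|_]; case: (seen); rewrite /= ?mul1g ?mulg1.
have ex : even_word AL x by rewrite /x; case: (seen) => //=; exact: even_word1.
have ef' t : even_word AL (f' t) by rewrite /f'; case: ifP => // _; exact: even_word1.
have f'z t : f' t <> 1%g -> t \in sites z.
  rewrite /f'; case: ifP => // h /fz; rewrite mem_sites_cons ractKV.
  case/orP => // /eqP e; move: h; rewrite -e ractKV eqxx andbT => /negbFE.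
  by rewrite /seen -e ractKV.
have [k' kk' wk'] := IH f' (fun h hz => zA h (mem_behead (hz : h \in behead (g :: z)))) ef' f'z.
have [kx kkx wkx] := word_conj_lamp ex.
exists (kx + 1 + k')%N; last first.
  rewrite fE !lamp_conjM; apply: wordM wk'; apply: wordM wkx _.
  by apply: word_conj_move; apply: zA; exact: mem_head.
rewrite (sum_undup_sites act o (fun s => len (f s))).
have -> : \sum_(s <- undup (sites z)) len (f (act s (g^-1)%g)) =
    \sum_(s <- undup (sites z)) len (f' s).
  rewrite big_seq [RHS]big_seq; apply: eq_bigr => s; rewrite mem_undup => sz.
  rewrite /f'; case: ifP => // /andP[ns /eqP e].
  by move: ns; rewrite /seen -e sz.
have : kx%:R <= (2 * K + 2)%:R * (if act o g \in sites z then 0 else len (f o)) :> R.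
  apply: le_trans (_ : ((2 * K + 2) * wlen AL x)%:R <= _); first by rewrite ler_nat.
  by rewrite natrM ler_wpM2l // /x /seen /len; case: (_ \in _); rewrite /= ?wlen1.
rewrite !natrD [size _]/= -natr1 mulrDr; lra.
Qed.

Definition moves (w : seq (Lam * Gam * Lam)) : seq Gam := [seq t.1.2 | t <- w].

Definition position_of (w : seq (Lam * Gam * Lam)) : W :=
  gprod [seq switch_move_switch t | t <- w].

Lemma cursor_position w : cursor (position_of w) = gprod (moves w).
Proof.
elim: w => [|t w IH]; first by rewrite /position_of !gprod_nil.
by rewrite /position_of /= !gprod_cons cursor_step IH.
Qed.

Definition good_word (w : seq (Lam * Gam * Lam)) := forall t, t \in w -> [/\ AL t.1.1, AG t.1.2 & AL t.2].

(** Every site receives an even number of letters except for the two ends of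
    the path; conjugation by [a0] corrects both ends. *)
Lemma lamps_conj_position w : good_word w ->
  let f s := (lamp_if (s == o) (a0^-1)%g * lamps (position_of w) s *
              lamp_if (act s (gprod (moves w)) == o) a0)%g in
  (forall s, even_word AL (f s)) /\ (forall s, f s <> 1%g -> s \in sites (moves w)).
Proof.
elim: w => [_|t w IH gw] /=.
  rewrite gprod_nil /position_of gprod_nil.
  suff e s : (lamp_if (s == o) a0^-1 * lamps (1 : W) s * lamp_if (act s 1 == o) a0)%g = 1%g.
    by split=> s; rewrite e //; exact: even_word1.
  by rewrite ract1 mulg1; case: (s == o); rewrite /= ?mulVg ?mulg1.
have [Al _ Al'] := gw t (mem_head _ _).
have [|ew sw] := IH; first by move=> u uw; apply: gw; rewrite inE uw orbT.
pose g := t.1.2; rewrite /position_of /= !gprod_cons -/(position_of w) -/g.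
set P := position_of w in ew sw *; set Q := gprod (moves w) in ew sw *.
have fE s : (lamp_if (s == o) a0^-1 * lamps (switch_move_switch t * P) s *
      lamp_if (act s (g * Q) == o) a0)%g =
    (lamp_if (s == o) (a0^-1 * t.1.1) * (lamp_if (act s g == o) (t.2 * a0) *
      (lamp_if (act s g == o) a0^-1 * lamps P (act s g) *
       lamp_if (act (act s g) Q == o) a0)))%g.
  rewrite lamps_step -/g ractM.
  by case: (s == o); case: (act s g == o); rewrite /= ?mulg1 ?mul1g ?mulgA ?mulgK.
split=> s.
  rewrite fE; apply: even_wordM.
    by case: (s == o) => /=; [apply: even_word2 => //; exact: ALV|exact: even_word1].
  apply: even_wordM => //.
  by case: (act s g == o) => /=; [exact: even_word2|exact: even_word1].
rewrite fE mem_sites_cons; case: (eqVneq s o) => //= _; rewrite mul1g -/g.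
case: (eqVneq (act s g) o) => [->|sg]; first by rewrite sites_o.
by move=> h; apply: sw; move: h; rewrite (negbTE sg) /= mul1g.
Qed.

Lemma sum_undup_sub (f : S -> R) (l l' : seq S) :
  (forall s, f s != 0 -> s \in l) -> {subset l <= l'} ->
  \sum_(s <- undup l') f s = \sum_(s <- undup l) f s.
Proof.
move=> fl ll'; rewrite (bigID (fun s => s \in l)) /= [X in _ + X]big1 ?addr0.
  rewrite -big_filter; apply: perm_big; apply: uniq_perm.
  - exact/filter_uniq/undup_uniq.
  - exact: undup_uniq.
  by move=> s; rewrite mem_filter !mem_undup; case: (boolP (s \in l)) => //= /ll' ->.
by move=> s; apply: contraNeq => /fl.
Qed.

(** Conjugation by [a0] makes all lamps even, so that they can be written along
    the tour; correcting the two ends costs a constant. *)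
Lemma wlen_position_le w z : good_word w -> (forall g, g \in z -> AG g) ->
  gprod z = gprod (moves w) -> {subset sites (moves w) <= sites z} ->
  (wlen switch_moves (position_of w))%:R <= (size z)%:R + (2 * K + 2)%:R *
    (\sum_(s <- undup (sites (moves w))) len (lamps (position_of w) s) + 2).
Proof.
move=> gw zA gz sz.
pose f s := (lamp_if (s == o) (a0^-1)%g * lamps (position_of w) s *
              lamp_if (act s (gprod (moves w)) == o) a0)%g.
have [ef fw] : (forall s, even_word AL (f s)) /\
    (forall s, f s <> 1%g -> s \in sites (moves w)) := lamps_conj_position gw.
have [k kk wk] := word_tour_lamps zA ef (fun s h => sz s (fw s h)).
have cE : lamp_conj (Wreath f (gprod z)) = position_of w.
  rewrite gz -cursor_position; set P := position_of w.
  have -> : Wreath f (cursor P) = (lamp (a0^-1)%g * P * lamp a0)%g.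
    apply: wreathP => [s|]; last by rewrite !cursorM mulg1 mul1g.
    by rewrite !lampsM !cursorM /= !mul1g ract1 /f -cursor_position.
  by rewrite /lamp_conj !mulgA lampM mulgV lamp1 mul1g -mulgA lampM mulgV lamp1 mulg1.
rewrite cE in wk; apply: le_trans (_ : k%:R <= _).
  by rewrite ler_nat; exact: wlen_le wk.
apply: le_trans kk _; rewrite lerD2l; apply: ler_wpM2l => //.
rewrite (sum_undup_sub (l := sites (moves w))) //; last first.
  move=> s; rewrite /len pnatr_eq0 => h; apply: fw => f1.
  by rewrite f1 wlen1 in h.
apply: le_trans (_ : \sum_(s <- undup (sites (moves w)))
    (len (lamps (position_of w) s) + ((s == o)%:R + (act s (gprod (moves w)) == o)%:R)) <= _).
  apply: ler_sum => s _; rewrite /len -!natrD ler_nat /f.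
  apply: leq_trans (wlenM _ _) _ => //; apply: leq_trans (leq_add (wlenM _ _) (leqnn _)) _ => //.
  have := wlen_lamp_if (s == o) (ALV Aa0).
  by have := wlen_lamp_if (act s (gprod (moves w)) == o) Aa0; lia.
have us := undup_uniq (sites (moves w)).
rewrite big_split lerD2l big_split /= -!natr_sum -natrD ler_nat -[2%N]/(1 + 1)%N.
apply: leq_add; first exact: sum_eq_le1.
have ug : uniq [seq act s (gprod (moves w)) | s <- undup (sites (moves w))].
  by rewrite map_inj_uniq //; exact: ract_inj.
by have := sum_eq_le1 o ug; rewrite big_map.
Qed.

End Cost.
End Wreath.

(** * The lamplighter with random bits *)

(** The group of order two; lamps in it record which sites are lit. *)
Definition bit := bool.

HB.instance Definition _ := Choice.on bit.

Lemma bit_addA : associative (addb : bit -> bit -> bit).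
Proof. exact: addbA. Qed.
Lemma bit_add0 : left_id (false : bit) (addb : bit -> bit -> bit).
Proof. exact: addFb. Qed.
Lemma bit_addr0 : right_id (false : bit) (addb : bit -> bit -> bit).
Proof. exact: addbF. Qed.
Lemma bit_addN : left_inverse (false : bit) (id : bit -> bit) (addb : bit -> bit -> bit).
Proof. exact: addbb. Qed.

HB.instance Definition _ := isGroup.Build bit
  bit_addA bit_add0 bit_addr0 bit_addN bit_addN.

Lemma bit_mulE (b c : bit) : (b * c)%g = addb b c :> bool. Proof. by []. Qed.
Lemma bit_oneE : (1%g : bit) = false. Proof. by []. Qed.

Section BitWalk.
Variables (R : realType) (Gam : groupType) (S : choiceType).
Variables (act : right_action Gam S) (o : S) (st : seq (R * Gam)).
Hypotheses (pst : pdist st) (sst : symmetric_steps st).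
Local Notation W := (wreath bit act).
Local Notation sites := (sites act o).
Local Notation lamp b := (@lamp_at bit Gam S act o b).
Local Notation move g := (@walk_by bit Gam S act g).
Local Notation gens := (@switch_moves bit Gam S act o [set: bit]%classic (letters st)).

Definition bits : seq (R * bit) := [:: (2^-1, false : bit); (2^-1, true : bit)].

Lemma mean_bits F : mean bits F = 2^-1 * F false + 2^-1 * F true.
Proof. by rewrite !mean_cons mean_nil addr0. Qed.

Lemma mean_bits_shift b F : mean bits (fun c : bit => F (b * c)%g) = mean bits F.
Proof. by rewrite !mean_bits !bit_mulE; case: b; rewrite /= ?addFb ?addTb // addrC. Qed.

Lemma pdist_bits : pdist bits.
Proof.
split=> [a|]; last by rewrite /bits !big_cons big_nil /=; field.
by rewrite !inE => /orP[] /eqP -> /=; rewrite invr_gt0.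
Qed.

(** One step: fair bits are added at the cursor before and after the move. *)
Definition bit_steps : seq (R * W) :=
  product_law (fun a x => (lamp a * x)%g) bits
    (product_law (fun g c => (move g * lamp c)%g) st bits).

Lemma mean_bit_steps F : mean bit_steps F =
  mean bits (fun a => mean st (fun g => mean bits (fun c =>
    F (lamp a * (move g * lamp c))%g))).
Proof. by rewrite mean_product; apply: eq_mean => a; rewrite mean_product. Qed.

Lemma pdist_bit_steps : pdist bit_steps.
Proof. by apply: pdist_product; [|apply: pdist_product]; try exact: pdist_bits. Qed.

Lemma lampV (b : bit) : ((lamp b)^-1)%g = lamp b.
Proof. by apply: mulg1_eq; rewrite lampM bit_mulE addbb lamp1. Qed.

Lemma moveV g : ((move g)^-1)%g = move (g^-1)%g.
Proof. by apply: mulg1_eq; rewrite moveM mulgV move1. Qed.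

Lemma symmetric_bit_steps : symmetric_steps bit_steps.
Proof.
move=> F; rewrite !mean_bit_steps.
pose H g := mean bits (fun a => mean bits (fun c => F (lamp a * (move g * lamp c))%g)).
transitivity (mean st H); first exact: mean_swap.
rewrite sst; transitivity (mean st (fun g => mean bits (fun a => mean bits (fun c =>
    F ((lamp a * (move g * lamp c))^-1)%g)))); last exact: mean_swap.
apply: eq_mean => g; rewrite /H mean_swap; apply: eq_mean => a; apply: eq_mean => c.
by rewrite !invgM !lampV moveV mulgA.
Qed.

Lemma letters_bit_steps x : letters bit_steps x -> gens x.
Proof.
move=> /mapP[d /mem_product[a [e [_ /mem_product[b [c [bst _ ->]]] ->]]] ->].
exists (a.2, b.2, c.2); split=> //; last by rewrite /switch_move_switch /= mulgA.
by apply/mapP; exists b.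
Qed.

Lemma letters_bit_stepsE : letters bit_steps = gens.
Proof.
apply/seteqP; split=> x; first exact: letters_bit_steps.
move=> [[[a g] c] [/= _ /mapP[b bst ->] _ ->]].
have ib (d : bit) : (2^-1, d) \in bits by case: d; rewrite !inE ?eqxx ?orbT.
apply/mapP; exists (2^-1 * (b.1 * 2^-1), (lamp a * (move b.2 * lamp c))%g); last first.
  by rewrite /switch_move_switch /= mulgA.
apply/(@allpairsP _ _ _ _ bits).
exists ((2^-1, a), (b.1 * 2^-1, (move b.2 * lamp c)%g)); split; [exact: ib| |by []].
by apply/(@allpairsP _ _ _ _ st bits); exists (b, (2^-1, c)); split; [|exact: ib|].
Qed.

(** The law of the position after a given path of the cursor.  A single bit per
    visited site and time is enough, as two fair bits add up to a fair bit. *)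
Fixpoint bit_law (y : seq Gam) : seq (R * W) :=
  product_law (fun b x => (lamp b * x)%g) bits
    (if y is g :: z then [seq (a.1, (move g * a.2)%g) | a <- bit_law z]
     else [:: (1, 1%g)]).

Lemma mean_bit_law0 F : mean (bit_law [::]) F = mean bits (fun b => F (lamp b)).
Proof.
rewrite /= mean_product; apply: eq_mean => b.
by rewrite mean_cons mean_nil addr0 mul1r mulg1.
Qed.

Lemma mean_bit_lawS g y F : mean (bit_law (g :: y)) F =
  mean bits (fun b => mean (bit_law y) (fun x => F (lamp b * (move g * x))%g)).
Proof. by rewrite [bit_law _]/= mean_product; apply: eq_mean => b; rewrite mean_map. Qed.

Lemma pdist_bit_law y : pdist (bit_law y).
Proof.
elim: y => [|g y IH]; apply: pdist_product pdist_bits _; last exact: pdist_map.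
by split; [move=> a; rewrite inE => /eqP -> /= | rewrite big_seq1].
Qed.

Lemma mean_bit_law_shift y F (a : bit) :
  mean (bit_law y) (fun x => F (lamp a * x)%g) = mean (bit_law y) F.
Proof.
case: y => [|g y]; rewrite ?mean_bit_law0 ?mean_bit_lawS -[RHS](mean_bits_shift a);
  apply: eq_mean => b; rewrite -lampM //.
by apply: eq_mean => x; rewrite mulgA.
Qed.

Lemma walk_bit_steps n F :
  walk bit_steps n.+1 F = mean (paths st n.+1) (fun y => mean (bit_law y) F).
Proof.
elim: n F => [|n IH] F.
  rewrite walk1 mean_bit_steps mean_pathsS mean_swap; apply: eq_mean => g.
  rewrite mean_paths0 mean_bit_lawS; apply: eq_mean => a.
  by rewrite mean_bit_law0.
rewrite walkS mean_bit_steps mean_pathsS mean_swap; apply: eq_mean => g.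
transitivity (mean bits (fun a => mean (paths st n.+1) (fun y =>
    mean (bit_law y) (fun x => F (lamp a * (move g * x))%g)))); last first.
  rewrite mean_swap; apply: eq_mean => y.
  by rewrite mean_bit_lawS.
apply: eq_mean => a.
rewrite -[RHS](mean_const pdist_bits); apply: eq_mean => c.
rewrite IH; apply: eq_mean => y.
rewrite -[RHS](mean_bit_law_shift _ _ c).
by apply: eq_mean => x; rewrite !mulgA.
Qed.

Lemma mem_bit_law y a : a \in bit_law y ->
  cursor a.2 = gprod y /\ forall s, lamps a.2 s <> 1%g -> s \in sites y.
Proof.
elim: y a => [|g y IH] a /mem_product[b [c [_ + ->]]].
  rewrite inE => /eqP -> /=; rewrite gprod_nil mulg1; split=> // s.
  by rewrite inE; case: eqP.
move=> /mapP[d /IH[cd ld] ->] /=; rewrite gprod_cons cd mul1g; split=> // s.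
rewrite ract1 -/(sites (g :: y)) mem_sites_cons; case: eqP => //= _.
by rewrite !mul1g => /ld.
Qed.

Lemma word_bit_law y a : (forall g, g \in y -> letters st g) -> (0 < size y)%N ->
  a \in bit_law y ->
  word_of_length (gens) a.2 (size y).
Proof.
have gen (b c : bit) g : letters st g ->
    gens (lamp b * move g * lamp c)%g.
  by move=> lg; exists (b, g, c); split.
elim: y a => [//|g [|h y] IH] a yA _.
  move=> /mem_product[b [c [_ /mapP[d /mem_product[e [f [_ + ->]]] ->] ->]]].
  rewrite inE => /eqP -> /=; rewrite mulg1 mulgA; apply: word_letter; apply: gen.
  exact: yA (mem_head _ _).
move=> /mem_product[b [c [_ /mapP[d dy ->] ->]]].
rewrite -[size _]add1n; have -> : (lamp b.2 * (move g * d.2) =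
    (lamp b.2 * move g * lamp 1) * d.2)%g by rewrite lamp1 mulg1 mulgA.
apply: wordM; first by apply/word_letter/gen/yA/mem_head.
by apply: IH => // k ky; apply: yA; rewrite inE ky orbT.
Qed.

(** Switching the lamps at all visited sites preserves the law: at each site
    the last bit that was added there is switched. *)
Definition flip (y : seq Gam) (x : W) : W :=
  Wreath (fun s => (lamps x s * lamp_if (s \in sites y) (true : bit))%g) (cursor x).

Lemma lamps_flip y x s :
  lamps (flip y x) s = (lamps x s * lamp_if (s \in sites y) (true : bit))%g.
Proof. by []. Qed.

Lemma flipK y : involutive (flip y).
Proof.
move=> x; apply: wreathP => // s; rewrite !lamps_flip !bit_mulE -addbA addbb.
exact: addbF.
Qed.

Lemma mean_bit_law_flip y F :
  mean (bit_law y) (fun x => F (flip y x)) = mean (bit_law y) F.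
Proof.
elim: y F => [|g y IH] F.
  rewrite !mean_bit_law0 -[RHS](mean_bits_shift true); apply: eq_mean => b; congr F.
  apply: wreathP => // s /=; rewrite inE.
  by case: (s == o); case: b.
rewrite !mean_bit_lawS.
pose d : bit := act o g \notin sites y.
rewrite -[RHS](mean_bits_shift d); apply: eq_mean => b; rewrite -[RHS]IH.
apply: eq_mean => x; congr F; apply: wreathP => // s.
rewrite lamps_flip !lampsM lamps_flip mem_sites_cons /= !mul1g !ract1 /d.
case: (eqVneq s o) => [->|_] /=; last by rewrite !mul1g.
by rewrite !bit_mulE; case: b; case: (lamps x _); case: (_ \in sites y).
Qed.

Local Notation lamps_are A := (fun x : W => `[< forall s, lamps x s = A s >]%:R : R).

(** Every new site brings a fresh fair bit, so the configuration is uniform on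
    the visited sites. *)
Lemma bit_law_uniform y (A : S -> bit) : (forall s, A s <> 1%g -> s \in sites y) ->
  2^-1 ^+ size (undup (sites y)) <= mean (bit_law y) (lamps_are A).
Proof.
have nn (B : S -> bit) x : 0 <= lamps_are B x by exact: ler0n.
elim: y A => [|g y IH] A Ay.
  rewrite mean_bit_law0 /= expr1.
  have ib : (2^-1, A o) \in bits by case: (A o); rewrite !inE ?eqxx ?orbT.
  have := mean_point pdist_bits (fun b => nn A (lamp b)) ib.
  rewrite /= (_ : `[< _ >] = true) ?mulr1 //; apply/asboolP => s.
  case: eqP => [->//|so]; apply/esym; apply: contrapT => /Ay.
  by rewrite inE => /eqP.
pose A_ (c : bit) t := (A (act t (g^-1)%g) * lamp_if (t == act o g) c)%g.
have lampsE c x : (forall t, lamps x t = A_ c t) ->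
    forall s, lamps (lamp c * (move g * x))%g s = A s.
  move=> xA s; rewrite !lampsM /= mul1g !ract1 xA /A_ ractK.
  rewrite (inj_eq (@ract_inj _ _ act g)) !bit_mulE.
  by case: (s == o) => /=; case: (A s); case: (c).
have lower c : (forall t, A_ c t <> 1%g -> t \in sites y) ->
    2^-1 ^+ size (undup (sites y)) <=
    mean (bit_law y) (fun x => lamps_are A (lamp c * (move g * x))%g).
  move=> /IH/le_trans; apply; apply: (ler_mean (pdist_bit_law y)) => a _.
  rewrite ler_nat; case: asboolP => // /lampsE h.
  by rewrite (_ : `[< _ >] = true) //; apply/asboolP.
rewrite mean_bit_lawS size_undup_sites_cons avoids_cons.
have supp c t : t != act o g -> A_ c t <> 1%g -> t \in sites y.
  move=> tg; rewrite /A_ (negbTE tg) mulg1 => /Ay; rewrite mem_sites_cons ractKV.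
  case/orP => // /eqP e; move: tg; rewrite -e ractKV eqxx.
  done.
case: (boolP (act o g \in sites y)) => og /=.
  rewrite add0n -[leLHS](mean_const pdist_bits); apply: (ler_mean pdist_bits) => c _.
  by apply: lower => t; have [->//|/supp] := eqVneq t (act o g); apply.
have ib : (2^-1, A o) \in bits by case: (A o); rewrite !inE ?eqxx ?orbT.
rewrite exprS; apply: le_trans _ (mean_point pdist_bits _ ib) => [|b]; last first.
  by apply: (mean_ge0 (pdist_bit_law y)) => x; exact: ler0n.
rewrite ler_pM2l ?invr_gt0 //; apply: lower => t.
have [->|/supp] := eqVneq t (act o g); last by apply.
by rewrite /A_ ractK eqxx /= bit_mulE addbb.
Qed.

End BitWalk.

(** * Entropy bounds the cost of a tour *)

Section Gibbs.
Variables (R : realType) (T : eqType) (u : seq (R * T)).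
Hypothesis pu : pdist u.

Let p x := mean u (fun y => (y == x)%:R).

Lemma point_mass_gt0 a : a \in u -> 0 < p a.2.
Proof.
move=> au; apply: lt_le_trans (mean_point pu (fun x => ler0n _ _) au).
by rewrite eqxx mulr1 pu.1.
Qed.

(** Gibbs' inequality, from [ln z <= z - 1]. *)
Lemma gibbs (Q : T -> R) : (forall a, a \in u -> 0 < Q a.2) ->
  (forall s, uniq s -> \sum_(x <- s) Q x <= 1) ->
  mean u (fun x => - ln (p x)) <= mean u (fun x => - ln (Q x)).
Proof.
move=> Q0 Q1; rewrite -subr_ge0 -meanB.
have : mean u (fun x => 1 - Q x / p x) <= mean u (fun x => - ln (Q x) - - ln (p x)).
  apply: ler_mean => // a au; have pa := point_mass_gt0 au; have Qa := Q0 a au.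
  have qp : 0 < Q a.2 / p a.2 by exact: divr_gt0.
  have := @le_ln1Dx R (Q a.2 / p a.2 - 1).
  rewrite (_ : 1 + (Q a.2 / p a.2 - 1) = Q a.2 / p a.2); last by ring.
  rewrite lnM ?posrE ?invr_gt0 // lnV ?posrE // => h.
  have : -1 < Q a.2 / p a.2 - 1 by lra.
  by move/h; lra.
apply: le_trans; rewrite meanB mean_const // subr_ge0 mean_points.
rewrite big_seq (eq_bigr Q) => [|x]; first by rewrite -big_seq Q1 // undup_uniq.
rewrite mem_undup => /mapP[a au ->]; rewrite mulrC divfK //.
by rewrite gt_eqF //; exact: point_mass_gt0.
Qed.

End Gibbs.

Section Bind.
Variable R : realType.

(** The law of the second stage of a two-stage experiment. *)
Definition bind_law (T U : Type) (u : seq (R * T)) (v : T -> seq (R * U)) :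
  seq (R * U) := [seq (a.1 * b.1, b.2) | a <- u, b <- v a.2].

Lemma mean_bind (T U : Type) (u : seq (R * T)) (v : T -> seq (R * U)) F :
  mean (bind_law u v) F = mean u (fun x => mean (v x) F).
Proof.
rewrite /mean big_allpairs_dep; apply: eq_bigr => a _; rewrite mulr_sumr.
by apply: eq_bigr => b _; rewrite mulrA.
Qed.

Lemma pdist_bind (T U : eqType) (u : seq (R * T)) (v : T -> seq (R * U)) :
  pdist u -> (forall x, pdist (v x)) -> pdist (bind_law u v).
Proof.
move=> pu pv; split=> [_ /allpairsPdep[a [b [/pu.1 a0 /(pv _).1 b0 ->]]]|].
  exact: mulr_gt0.
rewrite big_allpairs_dep -[RHS]pu.2; apply: eq_bigr => a _.
by rewrite -mulr_sumr (pv _).2 mulr1.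
Qed.

Lemma mem_bind (T U : eqType) (u : seq (R * T)) (v : T -> seq (R * U)) c :
  c \in bind_law u v -> exists a b, [/\ a \in u, b \in v a.2 & c.2 = b.2].
Proof. by move=> /allpairsPdep[a [b [au bv ->]]]; exists a, b. Qed.

End Bind.

Section TourCost.
Variables (R : realType) (Gam : groupType) (S : choiceType).
Variables (act : right_action Gam S) (o : S) (mu : step_dist R Gam).
Local Notation st := (step_list mu).
Local Notation W := (wreath bit act).
Local Notation sites := (sites act o).
Local Notation bit_law := (@bit_law R Gam S act o).
Local Notation gens := (@switch_moves bit Gam S act o [set: bit]%classic (letters st)).
Local Notation E n F := (mean (paths st n) F).

Let pst : pdist st := pdist_step_list mu.
Let sst : symmetric_steps st := @symmetric_step_list R Gam mu.

(** The comparison law makes the lamps and the cursor independent: the lamps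
    are those of the walk itself, and the cursor is run for a geometric time. *)
Definition decoupled n (x : W) : R :=
  \sum_(k < n.+1) 2^-1 ^+ k.+1 * walk st k (fun h => E n (fun y =>
    mean (bit_law y) (fun x' => (Wreath (lamps x') h == x)%:R))).

Lemma sum_geometric_le1 n : \sum_(k < n) 2^-1 ^+ k.+1 <= 1 :> R.
Proof.
rewrite (_ : \sum_(k < n) _ = 1 - 2^-1 ^+ n) ?gerBl ?exprn_ge0 ?invr_ge0 //.
elim: n => [|n IH]; first by rewrite big_ord0 subrr.
by rewrite big_ord_recr /= IH exprS; field.
Qed.

Lemma sum_decoupled_le1 n s : uniq s -> \sum_(x <- s) decoupled n x <= 1.
Proof.
move=> us; rewrite exchange_big /=; apply: le_trans (sum_geometric_le1 n.+1).
apply: ler_sum => k _; rewrite -mulr_sumr ler_piMr ?exprn_ge0 ?invr_ge0 //.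
rewrite -walk_sum -[leRHS](walk_const pst k); apply: ler_walk => // h.
rewrite -mean_sum; apply: mean_le_const => [|a _]; first exact: pdist_paths.
rewrite -mean_sum; apply: mean_le_const => [|b _]; first exact: pdist_bit_law.
exact: sum_uniq_eq_le1.
Qed.

Lemma size_site_set y : #|` site_set act o y| = size (undup (sites y)).
Proof.
rewrite /site_set; apply: perm_size; apply: uniq_perm; rewrite ?fset_uniq ?undup_uniq //.
by move=> s; rewrite mem_undup inE.
Qed.

Lemma decoupled_lower q n y x : 0 < q -> (forall a, a \in st -> q <= a.1) ->
  (forall s, lamps x s <> 1%g -> s \in sites y) ->
  word_of_length (letters st) (cursor x) n ->
  2^-1 ^+ (wlen (letters st) (cursor x)).+1 * (q ^+ wlen (letters st) (cursor x) *
    (range_law act mu o n y * 2^-1 ^+ size (undup (sites y)))) <= decoupled n x.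
Proof.
move=> q0 qst xy xn; have [wx wn] := wlenP xn; set k := wlen _ _ in wx wn *.
have nn h : 0 <= E n (fun y => mean (bit_law y) (fun x' =>
    (Wreath (lamps x') h == x)%:R)) :> R.
  apply: mean_ge0 => [|z]; first exact: pdist_paths.
  by apply: mean_ge0 => [|x']; [exact: pdist_bit_law|exact: ler0n].
rewrite /decoupled (bigD1 (Ordinal (wn : (k < n.+1)%N))) //=; apply: ler_wpDr.
  apply: sumr_ge0 => j _; rewrite mulr_ge0 ?exprn_ge0 ?invr_ge0 //.
  by apply: walk_ge0 => // h; exact: nn.
apply: ler_wpM2l; first by rewrite exprn_ge0 ?invr_ge0.
apply: le_trans (walk_point pst (ltW q0) qst nn wx).
apply: ler_wpM2l; first by rewrite exprn_ge0 ?ltW.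
rewrite mulrC -meanZ; apply: (ler_mean (pdist_paths n pst)) => a _.
have bn z : 0 <= mean (bit_law z) (fun x' => (Wreath (lamps x') (cursor x) == x)%:R) :> R.
  by apply: mean_ge0 => [|x']; [exact: pdist_bit_law|exact: ler0n].
case: eqP => [e|_]; last by rewrite mulr0.
rewrite mulr1 -size_site_set -e size_site_set.
have sup s : lamps x s <> 1%g -> s \in sites a.2.
  move=> /xy sy; have : s \in site_set act o a.2 by rewrite e inE.
  by rewrite inE.
apply: le_trans (bit_law_uniform R sup) _.
apply: (ler_mean (pdist_bit_law _ _ _ _)) => b _.
rewrite ler_nat; case: asboolP => // h.
by rewrite (_ : Wreath (lamps b.2) (cursor x) = x) ?eqxx //; exact: wreathP.
Qed.

Lemma range_law_gt0 n a : a \in paths st n -> 0 < range_law act mu o n a.2.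
Proof.
move=> ap; have pn := pdist_paths n pst.
apply: lt_le_trans (mean_point pn (fun z => ler0n _ _) ap).
by rewrite eqxx mulr1; exact: pn.1.
Qed.

Lemma ln_decoupled q n y x : 0 < q -> q <= 1 -> (forall a, a \in st -> q <= a.1) ->
  (exists2 a, a \in paths st n & a.2 = y) ->
  (forall s, lamps x s <> 1%g -> s \in sites y) -> cursor x = gprod y ->
  0 < decoupled n x /\
  - ln (decoupled n x) <= ln 2 + (ln 2 - ln q) * (wlen (letters st) (gprod y))%:R
     - ln (range_law act mu o n y) + ln 2 * (size (undup (sites y)))%:R.
Proof.
move=> q0 q1 qst [a ap ay] xy cx; have r0 := range_law_gt0 ap; rewrite ay in r0.
have yn : word_of_length (letters st) (cursor x) n.
  by rewrite cx -ay; exact: word_gprod.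
have := decoupled_lower q0 qst xy yn; rewrite cx.
set k := wlen _ _; set r := range_law _ _ _ _ _; set m := size _.
have h0 i : 0 < 2^-1 ^+ i :> R by rewrite exprn_gt0 ?invr_gt0.
have qk : 0 < q ^+ k by exact: exprn_gt0.
have rm : 0 < r * 2^-1 ^+ m by rewrite mulr_gt0.
have b0 : 0 < 2^-1 ^+ k.+1 * (q ^+ k * (r * 2^-1 ^+ m)) by rewrite !mulr_gt0.
move=> le; have d0 : 0 < decoupled n x := lt_le_trans b0 le; split=> //.
have lnh i : ln (2^-1 ^+ i) = - (i%:R * ln 2) :> R.
  by rewrite lnXn ?invr_gt0 // lnV ?posrE // mulNrn mulr_natl.
have lq : ln (q ^+ k) = k%:R * ln q by rewrite lnXn // mulr_natl.
have lb : ln (2^-1 ^+ k.+1 * (q ^+ k * (r * 2^-1 ^+ m))) =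
    - (k.+1%:R * ln 2) + (k%:R * ln q + (ln r - m%:R * ln 2)).
  rewrite lnM ?posrE ?mulr_gt0 // (lnh k.+1) lnM ?posrE // lq.
  by rewrite lnM ?posrE // (lnh m).
have : ln (2^-1 ^+ k.+1 * (q ^+ k * (r * 2^-1 ^+ m))) <= ln (decoupled n x).
  by rewrite ler_ln ?posrE.
rewrite lb -(natr1 k); clearbody k r m; clear; lra.
Qed.

Lemma range_entropy_ge0 n : 0 <= range_entropy act mu o n.
Proof.
have pn := pdist_paths n pst.
rewrite range_entropyE; apply: (le_trans _ (ler_mean pn (F := fun=> 0) _)).
  by rewrite mean_const.
move=> b bp; rewrite oppr_ge0 ln_le0 //; apply: mean_le_const => // z _.
by rewrite lern1; case: (_ == _).
Qed.

Lemma speed_ge0 n : 0 <= speed mu n.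
Proof. by rewrite speedE; apply: walk_ge0 => // g; exact: ler0n. Qed.

(** The Varopoulos-Carne bound turns the entropy of the lamplighter into a bound
    on its displacement, and that entropy is at most the sum of the entropy of
    the range, of one bit for each visited site, and of the length of the
    cursor. *)
Theorem bit_walk_second_moment : exists2 C : R, 0 < C & forall n, (1 <= n)%N ->
  walk (bit_steps act o st) n (fun x => (wlen gens x)%:R ^+ 2) <=
  C * n%:R * (1 + speed mu n + range_entropy act mu o n
              + \sum_(k < n.+1) escape act o st k).
Proof.
have [q [q0 q1 qst]] := min_weight pst.
have l2 : 0 < ln 2 :> R by rewrite ln_gt0 // ltr1n.
have lq : ln q <= 0 by rewrite ln_le0.
pose C0 : R := 1 + 2 * ln 2 - ln q.
have C00 : 0 < C0 by rewrite /C0; lra.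
exists (8 * C0) => [|[//|n] _]; first by rewrite mulr_gt0.
set N := n.+1; have NR : 0 < N%:R :> R by rewrite ltr0n.
pose u := bind_law (paths st N) bit_law.
have pN := pdist_paths N pst.
have pu : pdist u by apply: pdist_bind => // y; exact: pdist_bit_law.
have mu_ F : mean u F = walk (bit_steps act o st) N F.
  by rewrite mean_bind walk_bit_steps.
have bound a : a \in u -> (8 * N%:R)^-1 * (wlen gens a.2)%:R ^+ 2 <=
    ln 2 - ln (mean u (fun y => (y == a.2)%:R)).
  move=> au; have p0 := point_mass_gt0 pu au.
  have := varopoulos_carne (@pdist_bit_steps R Gam S act o st pst) (@symmetric_bit_steps R Gam S act o st sst) a.2 (isT : (0 < N)%N).
  rewrite -mu_ (@letters_bit_stepsE R Gam S act o st) -ler_ln ?posrE ?mulr_gt0 ?expR_gt0 //.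
  by rewrite lnM ?posrE ?expR_gt0 // expRK mulrC; lra.
have gb : mean u (fun x => - ln (mean u (fun y => (y == x)%:R))) <=
    mean u (fun x => - ln (decoupled N x)).
  apply: gibbs => //; last exact: sum_decoupled_le1.
  move=> a /mem_bind[b [c [bp /mem_bit_law[cc cl] ->]]].
  have eb : exists2 a, a \in paths st N & a.2 = b.2 by exists b.
  by have [] := ln_decoupled q0 q1 qst eb cl cc.
have dec : mean u (fun x => - ln (decoupled N x)) <=
    ln 2 + (ln 2 - ln q) * speed mu N + range_entropy act mu o N
      + ln 2 * \sum_(k < N.+1) escape act o st k.
  rewrite mean_bind speedE range_entropyE -mean_size_sites // -!meanZ.
  rewrite -[X in X + _ + _ + _](mean_const pN) -!meanD.
  apply: ler_mean => // b bp; apply: mean_le_const; first exact: pdist_bit_law.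
  move=> c /mem_bit_law[cc cl].
  have eb : exists2 a, a \in paths st N & a.2 = b.2 by exists b.
  by have [_] := ln_decoupled q0 q1 qst eb cl cc; lra.
have : (8 * N%:R)^-1 * walk (bit_steps act o st) N (fun x => (wlen gens x)%:R ^+ 2) <=
    ln 2 + mean u (fun x => - ln (mean u (fun y => (y == x)%:R))).
  rewrite -mu_ -meanZ -[X in _ <= X + _](mean_const pu) -meanD.
  exact: ler_mean.
move=> h; have H0 := range_entropy_ge0 N; have s0 := speed_ge0 N.
have e0 : 0 <= \sum_(k < N.+1) escape act o st k.
  by apply: sumr_ge0 => k _; apply: mean_ge0 => [|y]; [exact: pdist_paths|exact: ler0n].
have N8 : 0 < 8 * N%:R :> R by rewrite mulr_gt0.
rewrite -(ler_pM2l (_ : 0 < (8 * N%:R)^-1)) ?invr_gt0 //; apply: le_trans h _.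
rewrite [leRHS](_ : _ = C0 * (1 + speed mu N + range_entropy act mu o N
  + \sum_(k < N.+1) escape act o st k)); last by field; rewrite gt_eqF.
rewrite /C0; set H := range_entropy _ _ _ _ in H0 gb dec *.
set s := speed _ _ in s0 dec *; set e := \sum_(k < _) _ in e0 dec *.
have := mulr_ge0 (ltW l2) H0; have := mulr_ge0 (ltW l2) s0; have := mulr_ge0 (ltW l2) e0.
have lq0 : 0 <= - ln q by lra.
have := mulr_ge0 lq0 H0; have := mulr_ge0 lq0 s0; have := mulr_ge0 lq0 e0.
lra.
Qed.

End TourCost.

(** * The switch-walk-switch walk *)

Section SwitchWalk.
Variables (R : realType) (Gam Lam : groupType) (S : choiceType).
Variables (act : right_action Gam S) (o : S).
Variables (mu : step_dist R Gam) (nu : step_dist R Lam).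
Local Notation st := (step_list mu).
Local Notation sl := (step_list nu).
Local Notation sites := (sites act o).
Local Notation gens := (@switch_moves Lam Gam S act o (letters sl) (letters st)).
Local Notation position := (@position_of Lam Gam S act o).
Local Notation len l := ((wlen (letters sl) l)%:R : R).

Let pst : pdist st := pdist_step_list mu.
Let psl : pdist sl := pdist_step_list nu.

Definition switch_steps : seq (R * (Lam * Gam * Lam)) :=
  product_law pair (product_law pair sl st) sl.

Local Notation E n F := (mean (paths st n) F).
Local Notation Es n F := (mean (paths switch_steps n) F).

Lemma mean_switch_steps F : mean switch_steps F =
  mean sl (fun l => mean st (fun g => mean sl (fun l' => F (l, g, l')))).
Proof. by rewrite mean_product mean_product. Qed.

Lemma pdist_switch_steps : pdist switch_steps.
Proof. by apply: pdist_product => //; exact: pdist_product. Qed.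

Lemma eq_mean_paths (T : Type) (u v : seq (R * T)) n F :
  (forall H, mean u H = mean v H) -> mean (paths u n) F = mean (paths v n) F.
Proof.
move=> uv; elim: n F => [|n IH] F; first by rewrite !mean_paths0.
by rewrite !mean_pathsS uv; apply: eq_mean => x; exact: IH.
Qed.

Lemma sws_weight_gt0 (w : sws_space nu mu) : 0 < sws_weight w.
Proof. by rewrite !mulr_gt0 // step_weight_gt0. Qed.

Lemma letters_finsupp (G : groupType) (m : step_dist R G) g :
  letters (step_list m) g <-> g \in finsupp m.
Proof. by rewrite letters_step_list. Qed.

Lemma sws_support :
  step_support (@sws_weight R Lam Gam nu mu) (@sws_step R Lam Gam S act o nu mu) = gens.
Proof.
rewrite step_supportE; last exact: sws_weight_gt0.
apply/seteqP; rewrite /letters -map_comp; split=> x /=.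
  move=> /mapP[[[l g] l'] _ ->]; exists (val l, val g, val l').
  by split=> //; apply/letters_finsupp; exact: valP.
move=> [[[l g] l'] [/= /letters_finsupp hl /letters_finsupp hg /letters_finsupp hl' ->]].
by apply/mapP; exists (FSetSub hl, FSetSub hg, FSetSub hl'); rewrite ?mem_enum.
Qed.

Lemma sws_speedE n : sws_speed act o nu mu n = Es n (fun w => (wlen gens (position w))%:R).
Proof.
rewrite /sws_speed mean_displacementE sws_support.
pose v := [seq (a.1, switch_move_switch act o a.2) | a <- switch_steps].
transitivity (mean (paths v n) (fun y => (wlen gens (gprod y))%:R)).
  apply: eq_mean_paths => H; rewrite mean_map mean_switch_steps.
  rewrite [LHS]/mean big_map big_enum /= -(pair_bigA _ (fun x l' =>
    sws_weight (x, l') * H (sws_step act o (x, l')))) /=.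
  rewrite -(pair_bigA _ (fun l g => \sum_l'
    sws_weight (l, g, l') * H (sws_step act o (l, g, l')))) /=.
  rewrite [RHS]/mean big_map big_enum /=; apply: eq_bigr => l _.
  rewrite [X in _ = _ * X]/mean big_map big_enum mulr_sumr /=; apply: eq_bigr => g _.
  rewrite [X in _ = _ * (_ * X)]/mean big_map big_enum !mulr_sumr /=.
  by apply: eq_bigr => l' _; rewrite /sws_weight /= !mulrA.
by rewrite mean_paths_map.
Qed.

(** Given the path of the cursor, the lamp at [s] is a random walk run for
    [switches s] steps. *)
Lemma mean_lamp n s (Phi : seq Gam -> Lam -> R) :
  Es n (fun w => Phi (moves w) (lamps (position w) s)) =
  E n (fun y => walk sl (switches act o s y) (Phi y)).
Proof.
elim: n s Phi => [|n IH] s Phi; first by rewrite !mean_paths0 /= walk0 /position_of gprod_nil.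
have wb (b : bool) F : walk sl b F = mean sl (fun l => F (lamp_if b l)).
  by case: b; rewrite ?walk1 ?walk0 //= mean_const.
rewrite !mean_pathsS mean_switch_steps mean_swap; apply: eq_mean => g.
pose G y l l' := walk sl (switches act o (act s g) y) (fun x =>
  Phi (g :: y) (lamp_if (s == o) l * lamp_if (act s g == o) l' * x)%g).
transitivity (mean sl (fun l => mean sl (fun l' => E n (fun y => G y l l')))).
  apply: eq_mean => l; apply: eq_mean => l'.
  rewrite -(IH _ (fun y x => Phi (g :: y)
    (lamp_if (s == o) l * lamp_if (act s g == o) l' * x)%g)).
  by apply: eq_mean => w; rewrite /position_of /= gprod_cons lamps_step.
under eq_mean do rewrite mean_swap.
rewrite mean_swap; apply: eq_mean => y.
rewrite [switches act o s _]/= walkD walkD wb; apply: eq_mean => l.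
by rewrite wb.
Qed.

Lemma mean_moves n (Phi : seq Gam -> R) : Es n (fun w => Phi (moves w)) = E n Phi.
Proof.
rewrite (mean_lamp n o (fun y _ => Phi y)); apply: eq_mean => y.
by rewrite walk_const.
Qed.

Fixpoint all_sites n : seq S :=
  o :: (if n is m.+1 then [seq act s (g^-1)%g | s <- all_sites m, g <- [seq b.2 | b <- st]]
        else [::]).

Lemma sites_all y : (forall g, g \in y -> letters st g) ->
  {subset sites y <= all_sites (size y)}.
Proof.
elim: y => [_ s|g y IH yA s]; first by rewrite /= !inE.
rewrite mem_sites_cons /= in_cons => /orP[/eqP ->|sy]; first by rewrite eqxx.
apply/orP; right; apply/allpairsP; exists (act s g, g); split.
- by apply: IH sy => h hy; apply: yA; rewrite inE hy orbT.
- exact: yA (mem_head _ _).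
- by rewrite ractK.
Qed.

Lemma good_word_paths n a : a \in paths switch_steps n ->
  size a.2 = n /\ good_word (letters sl) (letters st) a.2.
Proof.
move=> /mem_paths[<- al]; split=> // t /al /mapP[b].
move=> /mem_product[c [d [/mem_product[e [f [es ft ce]]] dl be]]] ->.
rewrite be ce /=; split; apply/mapP; [by exists e|by exists f|by exists d].
Qed.

Lemma letters_moves w : good_word (letters sl) (letters st) w ->
  forall g, g \in moves w -> letters st g.
Proof. by move=> gw g /mapP[t /gw[_ ? _] ->]. Qed.

Lemma word_position w : good_word (letters sl) (letters st) w ->
  word_of_length gens (position w) (size w).
Proof.
move=> gw; exists [seq switch_move_switch act o t | t <- w]; split=> [|x|//].
  by rewrite size_map.
by move=> /mapP[t /gw[? ? ?] ->]; exists t.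
Qed.

Lemma mean_lamps n :
  Es n (fun w => \sum_(s <- undup (sites (moves w))) len (lamps (position w) s)) =
  E n (fun y => \sum_(s <- undup (sites y)) displacement sl (switches act o s y)).
Proof.
pose Z := all_sites n.
have onZ y (F : S -> R) : (forall g, g \in y -> letters st g) -> size y = n ->
    \sum_(s <- undup (sites y)) F s = \sum_(s <- undup Z) (s \in sites y)%:R * F s.
  move=> yA yn; rewrite (@sum_undup_sub S R _ (sites y)) => [|s|].
  - rewrite big_seq [RHS]big_seq; apply: eq_bigr => s; rewrite mem_undup => ->.
    by rewrite mul1r.
  - by case: (s \in sites y) => //; rewrite mul0r eqxx.
  - by rewrite /Z -yn; exact: sites_all.
transitivity (Es n (fun w => \sum_(s <- undup Z) (s \in sites (moves w))%:R *
    len (lamps (position w) s))).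
  apply: eq_mean_in => a /good_word_paths[an ga]; apply: onZ.
    exact: letters_moves.
  by rewrite size_map.
transitivity (E n (fun y => \sum_(s <- undup Z) (s \in sites y)%:R *
    displacement sl (switches act o s y))); last first.
  apply: eq_mean_in => a /mem_paths[an al]; apply/esym/onZ => // g; exact: al.
rewrite !mean_sum; apply: eq_bigr => s _.
rewrite (mean_lamp n s (fun y l => (s \in sites y)%:R * len l)); apply: eq_mean => y.
by rewrite walkZ.
Qed.

End SwitchWalk.

(** * Comparison with the displacement of a lamp *)

Section Comparison.
Variables (R : realType) (Gam Lam : groupType) (S : choiceType).
Variables (act : right_action Gam S) (o : S).
Variables (mu : step_dist R Gam) (nu : step_dist R Lam).
Local Notation st := (step_list mu).
Local Notation sl := (step_list nu).
Local Notation sites := (sites act o).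
Local Notation visits s y := (count_mem s (sites y)).
Local Notation gens := (@switch_moves Lam Gam S act o (letters sl) (letters st)).
Local Notation position := (@position_of Lam Gam S act o).
Local Notation len l := ((wlen (letters sl) l)%:R : R).
Local Notation disp := (displacement sl).
Local Notation E n F := (mean (paths st n) F).
Local Notation Es n F := (mean (paths (switch_steps mu nu) n) F).
Local Notation esc n := (escape act o st n).

Hypothesis fullL : forall l, reachable (letters sl) l.
Hypothesis infL : infinite_set [set: Lam]%classic.

Let pst : pdist st := pdist_step_list mu.
Let psl : pdist sl := pdist_step_list nu.
Let ssl : symmetric_steps sl := @symmetric_step_list R Lam nu.

(** The expected sum of the displacements of the lamps, each of them being
    a walk run for the local time of the cursor at its site. *)
Definition lamp_sum n : R :=
  E n (fun y => \sum_(s <- undup (sites y)) disp (switches act o s y)).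

Lemma lamp_sum_le_speed n : lamp_sum n <= 2 * sws_speed act o nu mu n.
Proof.
rewrite /lamp_sum -mean_lamps sws_speedE -meanZ.
apply: ler_mean => [|a /good_word_paths[_ ga]].
  by apply: pdist_paths; exact: pdist_switch_steps.
have wa := wlen_word (ex_intro _ _ (word_position act o ga)).
rewrite -natr_sum -natrM ler_nat.
exact: (sum_wlen_lamps fullL wa (undup_uniq _)).
Qed.

Lemma truncn_inv_scale (p : R) : 0 < p -> p <= 1 ->
  [/\ (1 <= Num.truncn (1 / p))%N, (Num.truncn (1 / p))%:R * p <= 1 &
      1 <= 2 * (Num.truncn (1 / p))%:R * p].
Proof.
move=> p0 p1; have ip : 1 <= 1 / p by rewrite ler_pdivlMr // mul1r.
have /truncn_itv/andP[lo hi] : 0 <= 1 / p by lra.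
have m1 : (1 <= Num.truncn (1 / p))%N by rewrite truncn_gt_nat.
move: lo hi; rewrite ler_pdivlMr // ltr_pdivrMr // -natr1 => lo hi; split=> //.
have : 1 <= (Num.truncn (1 / p))%:R :> R by rewrite ler1n.
nra.
Qed.

(** The truncated visit counts are bounded below by their first two moments,
    and the escape probability controls the second one. *)
Lemma lamp_sum_lower : exists2 a : R, 0 < a & forall n, (1 <= n)%N -> 0 < esc n ->
  a * (n%:R * esc n * disp (Num.truncn (1 / esc n))) <= lamp_sum n.
Proof.
have [C C1 ratio] := displacement_ratio psl ssl fullL infL.
exists (3 / 8 / (2 * C)) => [|n n1 p0]; first by rewrite !divr_gt0 // mulr_gt0 //; lra.
have pn := pdist_paths n pst.
set p := esc n in p0 *; have p1 : p <= 1 by exact: escape_le1.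
have [m1 mp _] := truncn_inv_scale p0 p1; set m := Num.truncn _ in m1 mp *.
have m0 : 0 < m%:R :> R by rewrite ltr0n.
pose D := disp m / (2 * C).
have D0 : 0 <= D by rewrite divr_ge0 ?displacement_ge0 //; lra.
have lower T V : (1 <= V <= T)%N -> D * (p / 2 * V%:R - p ^+ 2 / 16 * V%:R ^+ 2) <= disp T.
  move=> /andP[V1 VT]; have T1 := leq_trans V1 VT.
  have T0 : 0 < T%:R :> R by rewrite ltr0n.
  have [x xE] : exists x, x = p / 2 * V%:R by eexists.
  (* The parabola [x - x ^+ 2 / 4] lies below both [x] and [1]. *)
  have -> : p / 2 * V%:R - p ^+ 2 / 16 * V%:R ^+ 2 = x - x ^+ 2 / 4 by rewrite xE; field.
  have := ratio m T T1; rewrite -/m => hr.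
  have dT := displacement_ge0 psl T.
  have DE : disp m = 2 * C * D by rewrite /D mulrC divfK // gt_eqF //; lra.
  have [Tm|mT] := leqP m T.
    have mT1 : m%:R / T%:R <= 1 :> R by rewrite ler_pdivrMr // mul1r ler_nat.
    have h : disp m <= C * 2 * disp T.
      apply: le_trans hr _; rewrite ler_wpM2r // ler_pM2l; lra.
    have hD : D <= disp T.
      by rewrite DE in h; rewrite -(ler_pM2l (_ : 0 < 2 * C)); lra.
    apply: le_trans hD; rewrite ler_piMr //.
    by have := sqr_ge0 (x / 2 - 1); lra.
  have Tm1 : 1 <= m%:R / T%:R :> R by rewrite ler_pdivlMr // mul1r ler_nat ltnW.
  have h : disp m <= C * (2 * (m%:R / T%:R)) * disp T.
    by apply: le_trans hr _; rewrite ler_wpM2r // ler_pM2l; lra.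
  have h2 : D * (T%:R / m%:R) <= disp T.
    rewrite DE in h; rewrite mulrA ler_pdivrMr //.
    have : 2 * C * D * T%:R <= 2 * C * (disp T * m%:R).
      apply: le_trans (ler_wpM2r (ltW T0) h) _.
      by rewrite le_eqVlt; apply/orP; left; apply/eqP; field; rewrite gt_eqF.
    by rewrite -mulrA ler_pM2l //; lra.
  apply: le_trans h2; apply: ler_wpM2l => //.
  apply: le_trans (_ : x <= _); first by have := sqr_ge0 x; lra.
  have VTR : V%:R <= T%:R :> R by rewrite ler_nat.
  have V0 : 0 <= V%:R :> R by exact: ler0n.
  rewrite xE ler_pdivlMr //; apply: le_trans VTR.
  rewrite (_ : p / 2 * V%:R * m%:R = V%:R * (m%:R * p / 2)); last by ring.
  by rewrite ler_piMr //; lra.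
have sumV y : \sum_(s <- undup (sites y)) (visits s y)%:R = (size y).+1%:R :> R.
  have := sum_visits act o (fun=> 1 : R) y; rewrite big_const_seq count_predT.
  rewrite iter_addr addr0 size_sites => <-.
  by apply: eq_bigr => s _; rewrite mulr1.
have sumV2 y : \sum_(s <- undup (sites y)) (visits s y)%:R ^+ 2 =
    (\sum_(s <- sites y) visits s y)%N%:R :> R.
  rewrite natr_sum -(sum_visits act o (fun s => (visits s y)%:R)).
  by apply: eq_bigr => s _; rewrite expr2.
have pt a : a \in paths st n ->
    D * (p / 2 * n.+1%:R - p ^+ 2 / 16 * (\sum_(s <- sites a.2) visits s a.2)%N%:R) <=
    \sum_(s <- undup (sites a.2)) disp (switches act o s a.2).
  move=> /mem_paths[an _]; rewrite -an -sumV -sumV2 !mulr_sumr -sumrB mulr_sumr.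
  rewrite big_seq [leRHS]big_seq; apply: ler_sum => s; rewrite mem_undup => sy.
  by apply: lower; rewrite visits_le_switches ?an // -has_count has_pred1 sy.
have : E n (fun y => D * (p / 2 * n.+1%:R
    - p ^+ 2 / 16 * (\sum_(s <- sites y) visits s y)%N%:R)) <= lamp_sum n.
  exact: (ler_mean pn).
rewrite meanZ meanB mean_const // meanZ.
have := escape_sum_visits act o pst (leqnn n); rewrite -/p.
set Q := E n _ => hQ h; apply: le_trans h.
have nR : 1 <= n%:R :> R by rewrite ler1n.
rewrite (_ : 3 / 8 / (2 * C) * _ = D * (3 / 8 * (n%:R * p))); last by rewrite /D; ring.
apply: ler_wpM2l => //.
have : p * (p * Q) <= p * (2 * n.+1%:R) by rewrite ler_pM2l.
rewrite -[n.+1%:R]natr1; nra.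
Qed.

Variable c : R.
Hypothesis hyp : forall n, (1 <= n)%N ->
  speed mu n + range_entropy act mu o n + \sum_(k < n.+1) esc k <= c * n%:R * esc n.

Lemma esc_ge0 n : 0 <= esc n.
Proof. by apply: mean_ge0 => [|y]; [exact: pdist_paths|exact: ler0n]. Qed.

Lemma hyp_sum n : (1 <= n)%N -> [/\ \sum_(k < n.+1) esc k <= c * n%:R * esc n,
  1 <= c * n%:R * esc n & 1 + speed mu n + range_entropy act mu o n
     + \sum_(k < n.+1) esc k <= 2 * (c * n%:R * esc n)].
Proof.
move=> /hyp; have := range_entropy_ge0 act o mu n; have := speed_ge0 mu n.
have : 1 <= \sum_(k < n.+1) esc k.
  by rewrite big_ord_recl escape0 lerDl sumr_ge0 // => k _; exact: esc_ge0.
by split; lra.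
Qed.

Lemma esc_gt0 n : (1 <= n)%N -> 0 < esc n.
Proof.
move=> /hyp_sum[_ h _]; rewrite lt_def esc_ge0 andbT; apply: contraTneq h => ->.
by rewrite mulr0 -ltNge ltr01.
Qed.

Lemma c_gt0 : 0 < c.
Proof.
have [_ h _] := hyp_sum (leqnn 1); have := esc_gt0 (leqnn 1) => e.
rewrite ltNge; apply/negP => c0; move: h; apply/negP; rewrite -ltNge mulr1.
apply: le_lt_trans ltr01; rewrite mulr_le0_ge0 //; exact: ltW.
Qed.

(** By subadditivity, a lamp run for [T] steps costs at most of the order of
    [1 + T p] displacements at time [1 / p], where [p] is the escape probability.
    There are about [n p] sites, and their local times add up to about [n]. *)
Lemma lamp_sum_upper : exists2 b : R, 0 < b & forall n, (1 <= n)%N ->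
  lamp_sum n <= b * (n%:R * esc n * disp (Num.truncn (1 / esc n))).
Proof.
have [C C1 ratio] := displacement_ratio psl ssl fullL infL.
have c0 := c_gt0; exists (C * (c + 8)) => [|n n1]; first by rewrite mulr_gt0; lra.
have pn := pdist_paths n pst; have p0 := esc_gt0 n1.
have [hs _ _] := hyp_sum n1.
have p1 : esc n <= 1 by exact: escape_le1.
have [m1 mp mp2] := truncn_inv_scale p0 p1; move: hs p0 p1 m1 mp mp2.
set p := esc n; set m := Num.truncn _ => hs p0 p1 m1 mp mp2.
have m0 : 0 < m%:R :> R by rewrite ltr0n.
have dm := displacement_ge0 psl m.
have nR : 1 <= n%:R :> R by rewrite ler1n.
apply: (@le_trans _ _ (E n (fun y => C * disp m * ((size (undup (sites y)))%:R
    + 4 * p * (size y).+1%:R)))).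
  apply: (ler_mean pn) => a _; rewrite -(size_sites act o).
  have := sum_visits act o (fun=> 1 : R) a.2; rewrite big_const_seq count_predT.
  rewrite iter_addr addr0 => <-.
  have -> : (size (undup (sites a.2)))%:R = \sum_(s <- undup (sites a.2)) 1 :> R.
    by rewrite big_const_seq count_predT iter_addr addr0.
  rewrite mulr_sumr -big_split mulr_sumr; apply: ler_sum => s _ /=.
  apply: le_trans (ratio (switches act o s a.2) m m1) _.
  rewrite mulrAC; apply: ler_wpM2l; first by rewrite mulr_ge0 //; lra.
  rewrite lerD2l ler_pdivrMr // mulr1.
  have : (switches act o s a.2)%:R <= 2 * (visits s a.2)%:R :> R.
    by rewrite -natrM ler_nat -switches_visits -addnA leq_addr.
  have : 0 <= (visits s a.2)%:R :> R by exact: ler0n.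
  nra.
rewrite meanZ meanD mean_size_sites //.
have -> : E n (fun y => 4 * p * (size y).+1%:R) = 4 * p * n.+1%:R.
  rewrite -[RHS](mean_const pn); apply: eq_mean_in => a /mem_paths[-> _].
  by [].
have : \sum_(k < n.+1) esc k + 4 * p * n.+1%:R <= (c + 8) * (n%:R * p).
  by rewrite -[n.+1%:R]natr1; nra.
have Cd : 0 <= C * disp m by rewrite mulr_ge0 //; lra.
move=> h; apply: le_trans (ler_wpM2l Cd h) _.
by rewrite le_eqVlt; apply/orP; left; apply/eqP; ring.
Qed.

(** The cost of the tours is at most diffusive on the scale of the excursions,
    which a lamp cannot beat. *)
Lemma tour_cost : exists2 b : R, 0 < b & forall n, (1 <= n)%N ->
  walk (bit_steps act o st) n (fun x => (wlen (@switch_moves bit Gam S act o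
    [set: bit]%classic (letters st)) x)%:R) <=
  b * (n%:R * esc n * disp (Num.truncn (1 / esc n))).
Proof.
have [C C0 second] := bit_walk_second_moment act o mu.
have [d d0 diff] := displacement_diffusive psl ssl fullL infL.
have c0 := c_gt0; have Cc : 0 < C * c + 1 by rewrite addr_gt0 ?mulr_gt0.
exists ((C * c + 1) * (2 / d)) => [|n n1]; first by rewrite mulr_gt0 // divr_gt0.
have := second n n1; have [_ _ hs] := hyp_sum n1.
have p0 := esc_gt0 n1; have p1 : esc n <= 1 by exact: escape_le1.
have [m1 mp mp2] := truncn_inv_scale p0 p1; move: hs p0 p1 m1 mp mp2.
set p := esc n; set m := Num.truncn _ => hs p0 p1 m1 mp mp2.
have nR : 1 <= n%:R :> R by rewrite ler1n.
have n0 : 0 < n%:R :> R by lra.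
have [q qE] : exists q, q = Num.sqrt p by eexists.
have q0 : 0 < q by rewrite qE sqrtr_gt0.
have q2 : q ^+ 2 = p by rewrite qE sqr_sqrtr // ltW.
(* [M] is the expected bound; it balances [l <= (l ^+ 2 / M + M) / 2]. *)
have [M ME] : exists M, M = n%:R * q by eexists.
have M0 : 0 < M by rewrite ME mulr_gt0.
set X2 := walk _ _ _ => hX.
have hX2 : X2 <= 2 * (C * c) * M ^+ 2.
  apply: le_trans hX _; apply: le_trans (ler_wpM2l _ hs) _.
    by rewrite mulr_ge0 // ltW.
  by rewrite ME exprMn q2 le_eqVlt; apply/orP; left; apply/eqP; ring.
apply: (@le_trans _ _ ((C * c + 1) * M)).
  apply: (@le_trans _ _ ((2 * M)^-1 * (X2 + M ^+ 2))); last first.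
    rewrite mulrC ler_pdivrMr; last by rewrite mulr_gt0.
    by have := sqr_ge0 M; lra.
  have pb := @pdist_bit_steps R Gam S act o st pst.
  rewrite -[X in _ <= _ * (_ + X)](walk_const pb n) -walkDf -walkZ.
    apply: ler_walk => // x; rewrite mulrC ler_pdivlMr ?mulr_gt0 //.
  by set l : R := (wlen _ x)%:R; have := sqr_ge0 (l - M); lra.
rewrite [leRHS](_ : _ = (C * c + 1) * (n%:R * (2 * (d^-1 * disp m) * p))); last by ring.
rewrite ME !ler_pM2l //.
have mR : 1 <= m%:R :> R by rewrite ler1n.
have [s sE] : exists s, s = Num.sqrt m%:R :> R by eexists.
have s0 : 0 <= s by rewrite sE sqrtr_ge0.
have s2 : s ^+ 2 = m%:R by rewrite sE sqr_sqrtr //; lra.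
have sq : 1 <= 2 * s * q.
  rewrite -(ler_pXn2r (_ : (0 < 2)%N)) ?nnegrE ?mulr_ge0 // ?ltW // expr1n.
  by rewrite !exprMn s2 q2; nra.
have hd : s <= d^-1 * disp m by rewrite mulrC ler_pdivlMr // mulrC sE; exact: diff.
apply: (@le_trans _ _ (2 * s * p)).
  rewrite -q2 expr2 mulrA -{1}[q]mul1r.
  by rewrite ler_pM2r.
by rewrite ler_pM2r // ler_pM2l.
Qed.

End Comparison.

Section Assembly.
Variables (R : realType) (Gam Lam : groupType) (S : choiceType).
Variables (act : right_action Gam S) (o : S).
Variables (mu : step_dist R Gam) (nu : step_dist R Lam).
Local Notation st := (step_list mu).
Local Notation sl := (step_list nu).
Local Notation sites := (sites act o).
Local Notation visits s y := (count_mem s (sites y)).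
Local Notation gens := (@switch_moves Lam Gam S act o (letters sl) (letters st)).
Local Notation position := (@position_of Lam Gam S act o).
Local Notation len l := ((wlen (letters sl) l)%:R : R).
Local Notation disp := (displacement sl).
Local Notation E n F := (mean (paths st n) F).
Local Notation Es n F := (mean (paths (switch_steps mu nu) n) F).
Local Notation esc n := (escape act o st n).

Hypothesis fullL : forall l, reachable (letters sl) l.
Hypothesis infL : infinite_set [set: Lam]%classic.

Let pst : pdist st := pdist_step_list mu.
Let psl : pdist sl := pdist_step_list nu.
Let ssl : symmetric_steps sl := @symmetric_step_list R Lam nu.

(** Averaging over the bits, each visited site is lit either before or after the
    flip, so two bit configurations together provide a tour of all of them. *)
Lemma speed_le_tour : exists2 K : R, 0 <= K & forall n, (1 <= n)%N ->
  sws_speed act o nu mu n <= 3 * walk (bit_steps act o st) n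
      (fun x => (wlen (@switch_moves bit Gam S act o [set: bit]%classic (letters st)) x)%:R)
    + K * (lamp_sum act o mu nu n + 2).
Proof.
have lV := letters_inv ssl psl.
have gV := letters_inv (@symmetric_step_list R Gam mu) pst.
have [K0 _ evenK] := even_word_length lV (s := [seq b.2 | b <- sl]) (fun x h => h).
have [a a_sl] := pdist_inhabited psl; have [g g_st] := pdist_inhabited pst.
have la : letters sl a.2 by apply/mapP; exists a.
have lg : letters st g.2 by apply/mapP; exists g.
exists (2 * K0 + 2)%:R => // -[//|n] _; set N := n.+1.
pose B := @switch_moves bit Gam S act o [set: bit]%classic (letters st).
rewrite walk_bit_steps -(mean_moves act o mu nu) // /lamp_sum -mean_lamps sws_speedE.
have ps := pdist_paths N (pdist_switch_steps mu nu).
rewrite -[X in _ <= _ + _ * (_ + X)](mean_const ps) -meanD -!meanZ -meanD.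
apply: (ler_mean ps) => w /good_word_paths[wN gw].
set y := moves w.2; set D := _ * (_ + 2).
have yN : (0 < size y)%N by rewrite size_map wN.
have yl := letters_moves gw.
have pb := @pdist_bit_law R Gam S act o y.
have flipped b : b \in bit_law R act o y ->
    exists2 b', b' \in bit_law R act o y & b'.2 = flip o y b.2.
  move=> bL; apply: contrapT => nb.
  have := point_mass_gt0 pb bL.
  rewrite -(mean_bit_law_flip o y (fun x => (x == b.2)%:R)).
  rewrite (_ : mean _ _ = mean (bit_law R act o y) (fun=> 0)).
    by rewrite mean_const // ltxx.
  apply: eq_mean_in => b' b'L; case: eqP => // e; case: nb; exists b' => //.
  by rewrite -e flipK.
have tour b : b \in bit_law R act o y ->
    (wlen gens (position w.2))%:R <= 2 * (wlen B b.2)%:R + (wlen B (flip o y b.2))%:R + D.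
  move=> bL; have [b' bL' e] := flipped b bL.
  have [cb lb] := mem_bit_law bL; have [cb' _] := mem_bit_law bL'.
  have wb := wlen_word (ex_intro _ _ (word_bit_law yl yN bL)).
  have wb' := wlen_word (ex_intro _ _ (word_bit_law yl yN bL')).
  have cc : cursor b.2 = cursor b'.2 by rewrite cb cb'.
  have [z [sz zl gz cz]] := join_tours gV wb wb' cc.
  have zy : {subset sites y <= sites z}.
    move=> s sy; apply: cz; rewrite e lamps_flip sy /= bit_mulE bit_oneE.
    by case: (lamps b.2 s) => /=; [left|right].
  have gzy : gprod z = gprod y by rewrite gz cb.
  have := wlen_position_le gV lV fullL la lg evenK R gw zl gzy zy.
  by rewrite -/y -/D sz natrD natrM e -/B.
apply: (@le_trans _ _ (mean (bit_law R act o y) (fun x =>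
    2 * (wlen B x)%:R + (wlen B (flip o y x))%:R + D))).
  by rewrite -[leLHS](mean_const pb); exact: (ler_mean pb).
rewrite meanD meanD mean_const // meanZ lerD2r.
rewrite (mean_bit_law_flip o y (fun x => (wlen B x)%:R)).
by rewrite -/B; lra.
Qed.

Variable c : R.
Hypothesis hyp : forall n, (1 <= n)%N ->
  speed mu n + range_entropy act mu o n + \sum_(k < n.+1) esc k <= c * n%:R * esc n.

Theorem sws_speed_comparison : exists a b : R, [/\ 0 < a, 0 < b & forall n, (1 <= n)%N ->
  a * (n%:R * esc n * disp (Num.truncn (1 / esc n))) <= sws_speed act o nu mu n /\
  sws_speed act o nu mu n <= b * (n%:R * esc n * disp (Num.truncn (1 / esc n)))].
Proof.
have [a a0 lower] := lamp_sum_lower act o mu fullL infL.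
have [b b0 upper] := lamp_sum_upper fullL infL hyp.
have [d d0 tour] := tour_cost fullL infL hyp.
have [K K0 le] := speed_le_tour; have c0 := c_gt0 hyp.
have e0 := displacement2_gt0 psl ssl fullL infL.
exists (a / 2), (3 * d + K * b + K * (2 * (c * (2 / disp 2)))); split.
- by rewrite divr_gt0.
- have : 0 <= K * b by rewrite mulr_ge0 // ltW.
  have : 0 <= K * (2 * (c * (2 / disp 2))).
    by rewrite mulr_ge0 // mulr_ge0 // mulr_ge0 ?divr_ge0 // ltW.
  lra.
move=> n n1; have p0 := esc_gt0 hyp n1; have [_ one _] := hyp_sum hyp n1.
have cn0 : 0 <= c * n%:R * esc n := ltW (lt_le_trans ltr01 one).
have p1 : esc n <= 1 by exact: escape_le1.
have [m1 _ _] := truncn_inv_scale p0 p1.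
have := lower n n1 p0; have := upper n n1; have := tour n n1; have := le n n1.
have := lamp_sum_le_speed act o mu fullL n.
have := displacement_lower psl ssl fullL m1.
set L := lamp_sum _ _ _ _ _; set X := walk _ _ _; set V := sws_speed _ _ _ _ _.
set m := Num.truncn _; set rate := n%:R * esc n * disp m => hm h1 h2 h3 h4 h5.
split; first lra.
have r1 : 1 <= c * (2 / disp 2) * rate.
  have h : 1 <= (2 / disp 2) * disp m.
    by rewrite mulrAC ler_pdivlMr // mul1r; lra.
  have -> : c * (2 / disp 2) * rate = (c * n%:R * esc n) * (2 / disp 2 * disp m).
    by rewrite /rate; ring.
  by apply: le_trans one _; exact: ler_peMr.
have : K * L <= K * (b * rate) by rewrite ler_wpM2l.
have : K * 2 <= K * (2 * (c * (2 / disp 2) * rate)) by apply: ler_wpM2l => //; lra.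
lra.
Qed.

End Assembly.

Local Open Scope classical_set_scope.
Local Open Scope ring_scope.

Theorem theorem2 (R : realType) (Gam Lam : groupType) (S : choiceType)
    (act : right_action Gam S) (o : S)
    (mu : step_dist R Gam) (nu : step_dist R Lam)
    (fgGam : fin_generated Gam)
    (infLam : infinite_set [set: Lam])
    (gen_nu : generates [set l | l \in finsupp nu])
    (hyp : exists c : R, forall n : nat, (1 <= n)%N ->
      speed mu n + range_entropy act mu o n
        + \sum_(0 <= k < n.+1) no_return_prob act mu o k
      <= c * n%:R * no_return_prob act mu o n) :
  exists a b : R, [/\ 0 < a, 0 < b & forall n : nat, (1 <= n)%N ->
    let p := no_return_prob act mu o n in
    let rate := n%:R * p * speed nu (Num.truncn (1 / p)) in
    a * rate <= sws_speed act o nu mu n /\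
    sws_speed act o nu mu n <= b * rate].
Proof.
have lV := letters_inv (@symmetric_step_list R Lam nu) (pdist_step_list nu).
have full l : reachable (letters (step_list nu)) l.
  have [s <- sA] := gen_nu l; exists (size s), s; split=> // x /sA.
  rewrite letters_step_list in lV *.
  by case=> // /lV; rewrite invgK.
have [c hc] := hyp.
have [|a [b [a0 b0 ab]]] :=
    @sws_speed_comparison R Gam Lam S act o mu nu full infLam c.
  move=> n n1; have := hc n n1; rewrite big_mkord no_return_probE.
  by under eq_bigr do rewrite no_return_probE.
exists a, b; split=> // n n1 p rate; have := ab n n1.
by rewrite /rate /p no_return_probE speedE.
Qed.
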